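(* Let $A$ and $B$ be nonnegative selfadjoint linear relations in a complex Hilbert space $\mathcal H$. Define $$A_0:=A,\quad B_0:=B,\quad A_n:=\tfrac12(A_{n-1}\dot+B_{n-1}),\quad B_n:=h(A_{n-1},B_{n-1}),\quad n\in\mathbb N=\{1,2,\dots\}.$$ Then the sequence $\{A_n\}_{n\in\mathbb N}$ is non-increasing, the sequence $\{B_n\}_{n\in\mathbb N}$ is non-decreasing, and $A_n\ge B_n$ for all $n\in\mathbb N$. Moreover, the strong resolvent limits $$A_\infty:=\operatorname{s-R-}\lim_{n\to\infty}A_n,\qquad B_\infty:=\operatorname{s-R-}\lim_{n\to\infty}B_n$$ exist, are nonnegative selfadjoint linear relations, and have the following properties: $$h(A,B)\le B_\infty\le A_\infty\le\tfrac12(A\dot+B),$$ $$\mathcal D[B_\infty]\supseteq\mathcal D[A_\infty]\supseteq\mathcal D[A]\cap\mathcal D[B],$$ $$\operatorname{ran}A_\infty^{1/2}\supseteq\operatorname{ran}B_\infty^{1/2}\supseteq\operatorname{ran}A^{1/2}\cap\operatorname{ran}B^{1/2},$$ $$A_\infty[\varphi]=B_\infty[\varphi]\quad\forall\varphi\in\mathcal D[A_\infty],$$ $$A_\infty^{-1}[\psi]=B_\infty^{-1}[\psi]\quad\forall\psi\in\operatorname{ran}B_\infty^{1/2}.$$ If $A^{-1}$ and $B^{-1}$ are bounded (i.e. they are graphs of bounded everywhere defined nonnegative selfadjoint operators), then $$A_\infty=B_\infty=(A^{-1}\#B^{-1})^{-1}.$$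
   Context: A linear relation (l.r.) in $\mathcal H$ is a closed linear subspace $A=\{\{f,f'\}\}$ of $\mathcal H\oplus\mathcal H$ (bounded operators are identified with their graphs); $\operatorname{ran}A$ is the set of second components; $\operatorname{mul}A=\{f':\{0,f'\}\in A\}$; $A^{-1}=\{\{f',f\}:\{f,f'\}\in A\}$; $\lambda A=\{\{f,\lambda f'\}\}$. $A$ is selfadjoint if $A=A^*:=\{\{g,g'\}:(f',g)=(f,g')\ \forall\{f,f'\}\in A\}$, nonnegative if $(f',f)\ge0$ for all $\{f,f'\}\in A$. A nonnegative selfadjoint l.r. decomposes as $A=\mathrm{Graph}(A_o)\oplus(\{0\}\oplus\operatorname{mul}A)$ with $A_o$ a nonnegative selfadjoint operator in $\mathcal H\ominus\operatorname{mul}A$. Put $A^{1/2}=\mathrm{Graph}(A_o^{1/2})\oplus(\{0\}\oplus\operatorname{mul}A)$, so $\operatorname{ran}A^{1/2}=\operatorname{ran}A_o^{1/2}\oplus\operatorname{mul}A$. The closed form of $A$ is $A[\varphi]=\|A_o^{1/2}\varphi\|^2$, $\varphi\in\mathcal D[A]=\operatorname{dom}A_o^{1/2}$; this gives a bijection between nonnegative selfadjoint l.r. and closed nonnegative (not necessarily densely defined) forms, and $\mathcal D[A^{-1}]=\operatorname{ran}A^{1/2}$. The order $A_1\ge A_2$ means $\mathcal D[A_1]\subseteq\mathcal D[A_2]$ and $A_1[\varphi]\ge A_2[\varphi]$ for all $\varphi\in\mathcal D[A_1]$. The form sum $A\dot+B$ is the nonnegative selfadjoint l.r. associated with the closed form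 $A[\varphi]+B[\varphi]$, $\varphi\in\mathcal D[A]\cap\mathcal D[B]$. The harmonic mean is $h(A,B):=\big(\tfrac12(A^{-1}\dot+B^{-1})\big)^{-1}$. $\operatorname{s-R-}\lim A_n=A$ means $(A_n+I)^{-1}\to(A+I)^{-1}$ strongly. For bounded nonnegative selfadjoint operators $X,Y$ on $\mathcal H$, the geometric mean $X\#Y$ is the maximum of the set of bounded nonnegative selfadjoint operators $Z$ with $|(Z\varphi,\psi)|\le\|X^{1/2}\varphi\|\,\|Y^{1/2}\psi\|$ for all $\varphi,\psi\in\mathcal H$; if $X,Y$ have bounded inverses it equals $X^{1/2}(X^{-1/2}YX^{-1/2})^{1/2}X^{1/2}$. *)

(* Defs.v *)
From HB Require Import structures.
From mathcomp Require Import all_boot all_order all_algebra.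
From mathcomp Require Import all_classical all_reals all_analysis.
From mathcomp Require Import sesquilinear complex.

Set Implicit Arguments.
Unset Strict Implicit.
Unset Printing Implicit Defensive.

Import Order.TTheory GRing.Theory Num.Theory.
Import numFieldNormedType.Exports.

Local Open Scope classical_set_scope.
Local Open Scope ring_scope.
Local Open Scope complex_scope.

(* A complex Hilbert space is a complete normed space over R[i] whose norm
   comes from an inner product. The inner product is linear in its first and
   conjugate-linear in its second argument. *)
HB.mixin Record CompleteNormedModule_isHilbert (R : realType) H
    & CompleteNormedModule R[i] H := {
  inner : {dot H for (@Num.conj R[i])} ;
  sqr_normE : forall x : H, `|x| ^+ 2 = inner x x
}.

#[short(type="hilbertType")]
HB.structure Definition Hilbert (R : realType) :=
  {H of CompleteNormedModule_isHilbert R H & CompleteNormedModule R[i] H}.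

Notation lrel H := (set (H * H)).

Section LinearRelations.
Context {R : realType} {H : hilbertType R}.
Implicit Types (A B S X Y Z : lrel H) (K D : set H).

Local Notation "''[' x , y ]" := (@inner R H x y) : ring_scope.

Definition linear_relation A :=
  [/\ closed A, A 0 & forall (a : R[i]) p q, A p -> A q -> A (a *: p + q)].

Definition rdom A : set H := [set f | exists f', A (f, f')].
Definition rran A : set H := [set f' | exists f, A (f, f')].
Definition rmul A : set H := [set f' | A (0, f')].
Definition rinv A : lrel H := [set p | A (p.2, p.1)].
Definition rscale (a : R[i]) A : lrel H :=
  [set p | exists2 q, A q & p = (q.1, a *: q.2)].
Definition radd_id A : lrel H :=
  [set p | exists2 q, A q & p = (q.1, q.2 + q.1)].
Definition rcomp S A : lrel H :=
  [set p | exists2 g, A (p.1, g) & S (g, p.2)].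

(* The value at f of a relation that is the graph of an operator (0 if f is
   outside its domain). *)
Definition rapp A (f : H) : H := xget 0 [set f' | A (f, f')].

Definition orthoc K : set H := [set g | forall f, K f -> '[f, g] = 0].

(* The adjoint relative to the Hilbert space K, a closed subspace of H. *)
Definition radj_in K A : lrel H :=
  [set q | [/\ K q.1, K q.2 & forall p, A p -> '[p.2, q.1] = '[p.1, q.2]]].

Definition nonnegative_relation A := forall p, A p -> 0 <= '[p.2, p.1].

Definition nonneg_selfadjoint_in K A :=
  [/\ linear_relation A, A = radj_in K A & nonnegative_relation A].

Definition nonneg_selfadjoint A := nonneg_selfadjoint_in setT A.

Definition op_part A : lrel H :=
  [set p | [/\ A p, orthoc (rmul A) p.1 & orthoc (rmul A) p.2]].

Definition is_op_part_sqrt A S :=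
  [/\ nonneg_selfadjoint_in (orthoc (rmul A)) S,
      rmul S = [set 0] & rcomp S S = op_part A].

(* A_o^{1/2}, the nonnegative selfadjoint operator S in the orthogonal
   complement of mul A with S^2 = A_o. *)
Definition op_part_sqrt A : lrel H := xget set0 [set S | is_op_part_sqrt A S].

Definition rsqrt A : lrel H :=
  [set p | exists f' m,
     [/\ op_part_sqrt A (p.1, f'), rmul A m & p.2 = f' + m]].

Definition lr_form_dom A : set H := rdom (op_part_sqrt A).

(* A[phi]; the values are nonnegative elements of R[i] (0 off the domain). *)
Definition lr_form A (phi : H) : R[i] := `|rapp (op_part_sqrt A) phi| ^+ 2.

Definition lr_form_le A1 A2 :=
  lr_form_dom A2 `<=` lr_form_dom A1 /\
  forall phi, lr_form_dom A2 phi -> lr_form A1 phi <= lr_form A2 phi.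

(* The nonnegative selfadjoint relation associated with the closed
   nonnegative form t with domain D. *)
Definition relation_of_form D (t : H -> R[i]) : lrel H :=
  xget set0 [set A | [/\ nonneg_selfadjoint A, lr_form_dom A = D &
                        forall phi, D phi -> lr_form A phi = t phi]].

Definition lr_form_sum A B : lrel H :=
  relation_of_form (lr_form_dom A `&` lr_form_dom B)
                   (fun phi => lr_form A phi + lr_form B phi).

Definition lr_arithmetic_mean A B : lrel H := rscale 2^-1 (lr_form_sum A B).

Definition lr_harmonic_mean A B : lrel H :=
  rinv (rscale 2^-1 (lr_form_sum (rinv A) (rinv B))).

Definition resolvent A : lrel H := rinv (radd_id A).

Definition strong_resolvent_cvg (An : nat -> lrel H) A :=
  forall f : H, (fun n => rapp (resolvent (An n)) f) @ \oo -->
                rapp (resolvent A) f.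

Definition bounded_nonneg_selfadjoint X :=
  [/\ nonneg_selfadjoint X, rdom X = setT, rmul X = [set 0] &
      exists M : R[i], forall p, X p -> `|p.2| <= M * `|p.1|].

Definition geometric_bound X Y Z :=
  forall phi psi : H,
    `|'[rapp Z phi, psi]| <= `|rapp (rsqrt X) phi| * `|rapp (rsqrt Y) psi|.

Definition is_lr_geometric_mean X Y Z :=
  let C := [set W | bounded_nonneg_selfadjoint W /\ geometric_bound X Y W] in
  C Z /\ forall W, C W -> lr_form_le W Z.

Definition lr_geometric_mean X Y : lrel H :=
  xget set0 [set Z | is_lr_geometric_mean X Y Z].

End LinearRelations.

(* Main.v *)
(* A nonnegative selfadjoint relation A is determined by its resolvent
   X = (A + 1)^-1, an operator with 0 <= X <= 1; A^-1 has resolvent 1 - X.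
   With C = X^{1/2} and D = (1 - X)^{1/2} one has A^{1/2} = {(C g, D g)}, so that
   D[A] = ran C and D[A^-1] = ran D, the form of A^-1 is the convex conjugate of
   that of A, and A_1 <= A_2 holds iff X_2 <= X_1. Hence inversion reverses the
   order, h(A, B) <= (A + B)/2 follows from Young's inequality, and the monotone
   sequences A_n, B_n converge because their resolvents do (Vigier).
   On D[A_1] the gap A_n - B_n is halved at each step, so A_oo = B_oo there. For
   the resolvents X_n -> X of A_n -> A_oo and u = X_n f - X f one has
   |u|^2 + A_oo[u] <= ((X - X_n) f, f), whence ran X, a core of A_oo, is contained
   in the form closure of D[A_1], and A_oo = B_oo on all of D[A_oo]. Inversion
   exchanges the roles of A and B and yields the statement on the inverses.
   If X = A^-1 and Y = B^-1 are bounded, the block positivity of (X, W; W, Y) is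
   preserved by (X, Y) |-> (h(X, Y), (X + Y)/2), so every admissible W lies below
   G = B_oo^-1. For invertible X and Y the identity X_n X^-1 Y_n = Y is invariant,
   giving G X^-1 G = Y, so that G itself is admissible; the general case follows
   by replacing X, Y with X + 1/k, Y + 1/k. *)
From HB Require Import structures.
Require Import Defs.
From mathcomp Require Import all_boot all_order all_algebra.
From mathcomp Require Import all_classical all_reals all_analysis.
From mathcomp Require Import sesquilinear complex ring lra.

Set Implicit Arguments.
Unset Strict Implicit.
Unset Printing Implicit Defensive.

Import Order.TTheory GRing.Theory Num.Theory.
Import numFieldNormedType.Exports.

Local Open Scope classical_set_scope.
Local Open Scope ring_scope.
Local Open Scope complex_scope.

(** * The real inner product *)

Section RealInner.
Context {R : realType} {H : hilbertType R}.
Implicit Types (x y z : H) (a : R).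

(** No spectral theorem or functional calculus enters: the only calculus is the pair of commuting
    roots [C], [D], limits of polynomials in [X] that commute with every bounded operator commuting
    with [X]. The recurring device is C^2 + D^2 = 1: the pair (C g, D g) gives back g continuously,
    which yields closedness, selfadjointness and closed forms alike. Form domains are ranges of [C],
    and membership in them is decided by a Douglas-type range criterion, itself a Riesz argument.
    The root of the operator part, the relation of a form and the geometric mean are defined by
    choice, so each needs existence and uniqueness before it can be computed. For the root,
    uniqueness is delicate, because the competitor may be unbounded. A_0 and B_0 need not be
    comparable, so monotonicity starts at index 1. Resolvent convergence alone does not carry forms
    to the limit, hence the detour through convergence in the form norm. Arguments use the real part
    of the inner product; complex identities follow by testing also with i y. *)

Definition rdot x y : R := complex.Re (inner x y).
Definition nsq x : R := rdot x x.

Lemma rdotC x y : rdot x y = rdot y x.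
Proof.
rewrite /rdot hermC expr0 mul1r.
change (complex.Re (conjc (inner y x)) = complex.Re (inner y x)).
by case: (inner y x).
Qed.

Lemma rdotDl x y z : rdot (x + y) z = rdot x z + rdot y z.
Proof. by rewrite /rdot linearDl raddfD. Qed.

Lemma rdotDr x y z : rdot z (x + y) = rdot z x + rdot z y.
Proof. by rewrite rdotC rdotDl !(rdotC _ z). Qed.

Lemma rdotNl x z : rdot (- x) z = - rdot x z.
Proof. by rewrite /rdot linearNl raddfN. Qed.

Lemma rdotNr x z : rdot z (- x) = - rdot z x.
Proof. by rewrite rdotC rdotNl rdotC. Qed.

Lemma rdotZl a x y : rdot (a%:C *: x) y = a * rdot x y.
Proof. rewrite /rdot linearZl_LR /=. by case: (inner x y) => b c /=; rewrite mul0r subr0. Qed.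

Lemma rdotZr a x y : rdot x (a%:C *: y) = a * rdot x y.
Proof. by rewrite rdotC rdotZl rdotC. Qed.

Lemma rdot_i x y : rdot ('i *: x) y = - rdot x ('i *: y).
Proof.
rewrite /rdot linearZl_LR linearZr_LR /=.
by case: (inner x y) => b c /=; ring.
Qed.

Lemma innerE x y : inner x y = rdot x y +i* rdot x ('i *: y).
Proof.
rewrite /rdot linearZr_LR /=.
by case: (inner x y) => b c /=; congr (_ +i* _); ring.
Qed.
Lemma norm_nsq x : `|x| ^+ 2 = (nsq x)%:C.
Proof. rewrite sqr_normE innerE; congr (_ +i* _).
have := rdot_i x x; rewrite rdotC; lra.
Qed.

Definition rdE := (rdotDl, rdotDr, rdotNl, rdotNr, rdotZl, rdotZr).

Lemma rdot0l x : rdot 0 x = 0.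
Proof. by rewrite -(scale0r x) -[0]/(0%:C) rdotZl mul0r. Qed.

Lemma rdot0r x : rdot x 0 = 0.
Proof. by rewrite rdotC rdot0l. Qed.

Lemma nsq_ge0 x : 0 <= nsq x.
Proof. by rewrite -lecR -norm_nsq exprn_ge0. Qed.

Lemma nsq_eq0 x : nsq x = 0 -> x = 0.
Proof.
move=> h; apply/eqP; rewrite -normr_eq0 -sqrf_eq0 norm_nsq h; exact: eqxx.
Qed.

Lemma rdot_ext x y : (forall z, rdot x z = rdot y z) -> x = y.
Proof.
move=> h; apply/eqP; rewrite -subr_eq0; apply/eqP/nsq_eq0.
by rewrite /nsq rdotDl rdotNl h subrr.
Qed.

Lemma nsqD x y : nsq (x + y) = nsq x + 2 * rdot x y + nsq y.
Proof. rewrite /nsq !rdE (rdotC y x); ring. Qed.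

Lemma nsqB x y : nsq (x - y) = nsq x - 2 * rdot x y + nsq y.
Proof. rewrite /nsq !rdE (rdotC y x); ring. Qed.

Lemma nsqN x : nsq (- x) = nsq x.
Proof. by rewrite /nsq !rdE opprK. Qed.

Lemma nsqZ a x : nsq (a%:C *: x) = a ^+ 2 * nsq x.
Proof. rewrite /nsq !rdE; ring. Qed.

Lemma nsq_comm x y : nsq (x - y) = nsq (y - x).
Proof. by rewrite -opprB nsqN. Qed.

Lemma nsq_tri x y z : nsq (x - z) <= 2 * nsq (x - y) + 2 * nsq (y - z).
Proof.
have := nsq_ge0 ((x - y) - (y - z)).
have -> : x - z = (x - y) + (y - z) by rewrite addrA subrK.
move: (x - y) (y - z) => u v; rewrite nsqB nsqD; lra.
Qed.

End RealInner.

(** * Nonnegative quadratic polynomials *)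

Section Quadratic.
Context {R : realType}.
Implicit Types a b c : R.

(** The common source of all Cauchy-Schwarz type bounds below. The degenerate case a = 0 is
    included, since the forms involved may have a kernel. *)
Lemma discr_le a b c : 0 <= a -> (forall s, 0 <= s ^+ 2 * a - 2 * s * b + c) ->
  b ^+ 2 <= a * c.
Proof.
move=> a0 h; have [a00|an0] := eqVneq a 0.
  rewrite a00 in h *.
  have [->|bn0] := eqVneq b 0; first by rewrite mul0r expr0n.
  (* With a = 0 the polynomial is c - 2 s b, which takes the value -1 at this s. *)
  have := h ((c + 1) / (2 * b)).
  have -> : 2 * ((c + 1) / (2 * b)) * b = c + 1 by field.
  rewrite mulr0; lra.
have ap : 0 < a by rewrite lt_def an0.
have := mulr_ge0 a0 (h (b / a)).
have -> : a * ((b / a) ^+ 2 * a - 2 * (b / a) * b + c) = a * c - b ^+ 2.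
  by field.
by rewrite subr_ge0.
Qed.
End Quadratic.

(** * Cauchy-Schwarz and convergence in squared norm *)

Section CS.
Context {R : realType} {H : hilbertType R}.
Implicit Types (x y z : H) (a : R).

Lemma rdot_CS x y : rdot x y ^+ 2 <= nsq x * nsq y.
Proof.
rewrite mulrC; apply: discr_le; first exact: nsq_ge0.
move=> s; have := nsq_ge0 (x - s%:C *: y).
rewrite nsqB nsqZ rdotZr; lra.
Qed.

Lemma young x y : 2 * rdot x y <= nsq x + nsq y.
Proof. have := nsq_ge0 (x - y); rewrite nsqB; lra. Qed.

(** Measured by the real number [nsq], because the norm of the space takes its values in [R[i]]. *)
Definition cv (u : nat -> H) (l : H) :=
  forall e : R, 0 < e -> exists N, forall n, (N <= n)%N -> nsq (u n - l) < e.

Lemma normC_lt x (e : R) : 0 < e -> (`|x| < e%:C) = (nsq x < e ^+ 2).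
Proof.
move=> e0; rewrite -ltcR -norm_nsq rmorphXn /= ltr_sqr ?nnegrE //.
by rewrite ler0c ltW.
Qed.

Lemma posC_real (e : R[i]) : 0 < e ->
  e = (complex.Re e)%:C /\ 0 < complex.Re e.
Proof.
move=> e0; split; first by rewrite RRe_real ?gtr0_real.
by rewrite -ltcR RRe_real ?gtr0_real.
Qed.

Lemma cvP u l : cv u l <-> u @ \oo --> l.
Proof.
split.
  move=> h; apply/cvgrPdist_lt => e e0.
  have [er ep] := posC_real e0.
  have [|N hN] := h (complex.Re e ^+ 2); first by rewrite exprn_gt0.
  by exists N => // n /= Nn; rewrite er distrC normC_lt //; exact: hN.
move=> /cvgrPdist_lt h e e0.
have sp : 0 < (Num.sqrt e)%:C by rewrite ltcR sqrtr_gt0.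
have [N _ hN] := h _ sp.
exists N => n nN; have := hN n nN; rewrite /= distrC normC_lt ?sqrtr_gt0 //.
by rewrite sqr_sqrtr // ltW.
Qed.

Lemma cauchy_cv (u : nat -> H) :
  (forall e : R, 0 < e -> exists N, forall n m, (N <= n)%N -> (N <= m)%N ->
     nsq (u n - u m) < e) -> exists l, cv u l.
Proof.
move=> h; suff /cvg_ex[l hl] : cvgn u by exists l; apply/cvP.
apply: cauchy_cvg; apply: cauchy_exP => e e0.
have [er ep] := posC_real e0.
have [|N hN] := h (complex.Re e ^+ 2); first by rewrite exprn_gt0.
exists (u N); exists N => // n /= Nn; rewrite -ball_normE /= er normC_lt //.
exact: hN.
Qed.

Lemma cv_unique u l l' : cv u l -> cv u l' -> l = l'.
Proof. by move=> /cvP h /cvP h'; exact: cvg_unique h h'. Qed.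

Lemma cvE u l : cv u l <-> (fun n => nsq (u n - l)) @ \oo --> (0 : R).
Proof.
split=> [h|/cvgrPdist_lt h e /h [N _ hN]].
  apply/cvgrPdist_lt => e /h [N hN]; exists N => // n /= /hN.
  by rewrite sub0r normrN ger0_norm ?nsq_ge0.
by exists N => n /hN /=; rewrite sub0r normrN ger0_norm ?nsq_ge0.
Qed.

Lemma sq_cvg0 (x c : nat -> R) :
  (forall n, x n ^+ 2 <= c n) -> c @ \oo --> (0 : R) -> x @ \oo --> (0 : R).
Proof.
move=> xc /cvgrPdist_lt h; apply/cvgrPdist_lt => e e0.
have [|N _ hN] := h (e ^+ 2); first by rewrite exprn_gt0.
exists N => // n /hN /=; rewrite !sub0r !normrN => cn.
rewrite -ltr_sqr ?nnegrE // ?ltW // real_normK ?num_real //.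
exact: le_lt_trans (le_trans (xc n) (ler_norm _)) cn.
Qed.

Lemma cvR_le (f g : nat -> R) a b : f @ \oo --> a -> g @ \oo --> b ->
  (forall n, f n <= g n) -> a <= b.
Proof. by move=> ha hb h; apply: ler_cvg_to ha hb _; exact: nearW. Qed.

Lemma cvR_eq (f g : nat -> R) a b : f @ \oo --> a -> g @ \oo --> b ->
  (forall n, f n = g n) -> a = b.
Proof.
move=> ha hb h; apply/eqP; rewrite eq_le (cvR_le ha hb) ?(cvR_le hb ha) // => n;
  by rewrite h.
Qed.

Lemma cv_rdot u l v m : cv u l -> cv v m ->
  (fun n => rdot (u n) (v n)) @ \oo --> rdot l m.
Proof.
move=> /cvE hu /cvE hv.
have h1 : (fun n => rdot (u n - l) (v n - m)) @ \oo --> (0 : R).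
  apply: sq_cvg0 => [n|]; first exact: rdot_CS.
  by rewrite -[X in _ --> X](mul0r 0); exact: cvgM.
have h2 : (fun n => rdot (u n - l) m) @ \oo --> (0 : R).
  apply: sq_cvg0 => [n|]; first exact: rdot_CS.
  by rewrite -[X in _ --> X](mul0r (nsq m)); apply: cvgM => //; exact: cvg_cst.
have h3 : (fun n => rdot l (v n - m)) @ \oo --> (0 : R).
  apply: sq_cvg0 => [n|]; first exact: rdot_CS.
  by rewrite -[X in _ --> X](mulr0 (nsq l)); apply: cvgM => //; exact: cvg_cst.
have e0 : rdot l m = 0 + 0 + 0 + rdot l m by rewrite !add0r.
rewrite [X in _ --> X]e0.
have -> : (fun n => rdot (u n) (v n)) = (fun n => rdot (u n - l) (v n - m) +
    rdot (u n - l) m + rdot l (v n - m) + rdot l m).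
  by apply/funext => n; rewrite !rdE; ring.
exact: cvgD (cvgD (cvgD h1 h2) h3) (cvg_cst _).
Qed.

Lemma cv_nsq u l : cv u l -> (fun n => nsq (u n)) @ \oo --> nsq l.
Proof. by move=> h; exact: cv_rdot. Qed.

Lemma cv_cst l : cv (fun=> l) l.
Proof. by apply/cvP; exact: cvg_cst. Qed.

Lemma cvD u l v m : cv u l -> cv v m -> cv (fun n => u n + v n) (l + m).
Proof. by move=> /cvP hu /cvP hv; apply/cvP; exact: cvgD. Qed.

Lemma cvN u l : cv u l -> cv (fun n => - u n) (- l).
Proof. by move=> /cvP hu; apply/cvP; exact: cvgN. Qed.

Lemma cvB u l v m : cv u l -> cv v m -> cv (fun n => u n - v n) (l - m).
Proof. by move=> hu /cvN hv; exact: cvD. Qed.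

Lemma cvZ (c : R[i]) u l : cv u l -> cv (fun n => c *: u n) (c *: l).
Proof. by move=> /cvP hu; apply/cvP; exact: cvgZr. Qed.

Lemma cvS u l : cv u l -> cv (fun n => u n.+1) l.
Proof. by move=> h e /h [N hN]; exists N => n Nn; exact/hN/leqW. Qed.

Lemma closedE (A : lrel H) : closed A <->
  forall p, (forall e : R, 0 < e -> exists q,
     [/\ A q, nsq (q.1 - p.1) < e & nsq (q.2 - p.2) < e]) -> A p.
Proof.
split=> [cA p hp|h].
  apply: cA => B [[B1 B2] [/= n1 n2] sB].
  have [e1 e10 h1] := (@nbhs_ballP _ _ _ _).1 n1.
  have [e2 e20 h2] := (@nbhs_ballP _ _ _ _).1 n2.
  have [r1 p1] := posC_real e10; have [r2 p2] := posC_real e20.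
  set e := Num.min (complex.Re e1) (complex.Re e2).
  have e0 : 0 < e by rewrite lt_min p1 p2.
  have [|q [Aq q1 q2]] := hp (e ^+ 2); first by rewrite exprn_gt0.
  exists q; split=> //; apply: sB; split.
    apply: h1; rewrite -ball_normE /= r1 normC_lt // nsq_comm (lt_le_trans q1) //.
    by rewrite lerXn2r ?nnegrE ?(ltW e0) ?(ltW p1) // /e ge_min lexx.
  apply: h2; rewrite -ball_normE /= r2 normC_lt // nsq_comm (lt_le_trans q2) //.
  by rewrite lerXn2r ?nnegrE ?(ltW e0) ?(ltW p2) // /e ge_min lexx orbT.
move=> p clp; apply: h => e e0.
have sp : 0 < (Num.sqrt e)%:C by rewrite ltcR sqrtr_gt0.
have [q [Aq [/= q1 q2]]] := clp _ (nbhsx_ballx p _ sp).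
exists q; split=> //.
  move: q1; rewrite -ball_normE /= normC_lt ?sqrtr_gt0 // nsq_comm.
  by rewrite sqr_sqrtr // ltW.
move: q2; rewrite -ball_normE /= normC_lt ?sqrtr_gt0 // nsq_comm.
by rewrite sqr_sqrtr // ltW.
Qed.

Lemma closed_cv (A : lrel H) u v l m : closed A -> (forall n, A (u n, v n)) ->
  cv u l -> cv v m -> A (l, m).
Proof.
move=> /closedE cA Auv hu hv; apply: cA => e e0.
have [N1 h1] := hu e e0; have [N2 h2] := hv e e0.
exists (u (maxn N1 N2), v (maxn N1 N2)); split=> //=.
  by apply: h1; rewrite leq_maxl.
by apply: h2; rewrite leq_maxr.
Qed.

End CS.

(** * Bounded positive operators *)

Section Operators.
Context {R : realType} {H : hilbertType R}.
Implicit Types (x y z : H) (X Y Z T C D B : {linear H -> H}).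

Lemma linear_exists (f : H -> H) : (forall (a : R[i]) x y, f (a *: x + y) = a *: f x + f y) ->
  exists X : {linear H -> H}, forall x, X x = f x.
Proof.
move=> hf; pose m := GRing.isLinear.Build R[i] H H *:%R f hf.
by exists (HB.pack f m : {linear H -> H}).
Qed.

Definition symm (X : H -> H) := forall x y, rdot (X x) y = rdot x (X y).
Definition psd (X : H -> H) := symm X /\ forall x, 0 <= rdot (X x) x.
(** Effects in the sense of quantum theory, 0 <= X <= 1: exactly the resolvents at -1 of nonnegative
    selfadjoint relations, by [rel_nsa] and [nsa_rel]. *)
Definition effect (X : H -> H) :=
  symm X /\ forall x, 0 <= rdot (X x) x <= nsq x.
Definition bndop (X : H -> H) :=
  exists2 c, 0 <= c & forall x, nsq (X x) <= c * nsq x.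

Lemma effect_psd X : effect X -> psd X.
Proof. by case=> s h; split=> // x; case/andP: (h x). Qed.

Lemma psd_CS X x y : psd X ->
  rdot (X x) y ^+ 2 <= rdot (X x) x * rdot (X y) y.
Proof.
case=> s h; rewrite mulrC; apply: discr_le => [//|t].
have := h (x - t%:C *: y); rewrite linearB linearZ /= !rdE (s x y) (rdotC x (X y)); lra.
Qed.

Lemma psd_eq0 X x : psd X -> rdot (X x) x = 0 -> X x = 0.
Proof.
move=> pX h; apply: nsq_eq0; have := psd_CS x (X x) pX; rewrite h mul0r.
have := nsq_ge0 (X x); rewrite /nsq; nra.
Qed.

(** Cauchy-Schwarz for the form of X at x and X x gives |X x|^4 <= (X x, x) c |X x|^2. Bounds on
    quadratic forms thus become bounds on norms. *)
Lemma psd_nsq X c x : psd X -> 0 <= c -> (forall y, rdot (X y) y <= c * nsq y) ->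
  nsq (X x) <= c * rdot (X x) x.
Proof.
move=> pX c0 h; have := psd_CS x (X x) pX; have := h (X x); have := pX.2 x.
have := nsq_ge0 (X x); rewrite -/(nsq (X x)).
move: (nsq (X x)) (rdot (X x) x) (rdot _ _) => a b d a0 b0 h1 h2.
have [->|an0] := eqVneq a 0; first by rewrite mulr_ge0.
have ap : 0 < a by rewrite lt_def an0.
rewrite -(ler_pM2l ap); nra.
Qed.

Lemma effect_nsq X x : effect X -> nsq (X x) <= rdot (X x) x.
Proof.
move=> eX; rewrite -[leRHS]mul1r; apply: (psd_nsq _ (effect_psd eX)) => // y.
by rewrite mul1r; case/andP: (eX.2 y).
Qed.

Lemma effect_contr X x : effect X -> nsq (X x) <= nsq x.
Proof.
move=> eX; apply: le_trans (effect_nsq x eX) _; by case/andP: (eX.2 x).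
Qed.

Lemma effect_bnd X : effect X -> bndop X.
Proof. by move=> eX; exists 1 => // x; rewrite mul1r; exact: effect_contr. Qed.

Lemma bnd_cv X u l : bndop X -> cv u l -> cv (fun n => X (u n)) (X l).
Proof.
move=> [c c0 h] hu e e0.
have cp : 0 < c + 1 by lra.
have [|N hN] := hu (e / (c + 1)); first by rewrite divr_gt0.
exists N => n /hN; rewrite -linearB /= ltr_pdivlMr // => hn.
have := h (u n - l); have := nsq_ge0 (u n - l); nra.
Qed.

Lemma effect_cv X u l : effect X -> cv u l -> cv (fun n => X (u n)) (X l).
Proof. by move=> /effect_bnd; exact: bnd_cv. Qed.

Lemma effect_compl X : exists Y, (forall x, Y x = x - X x) /\ (effect X -> effect Y).
Proof.
have [|Y hY] := @linear_exists (fun x => x - X x).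
  by move=> a x y; rewrite linearP scalerBr opprD addrACA.
exists Y; split=> // -[s h]; split=> [x y|x].
  by rewrite !hY !rdE s.
rewrite hY !rdE; have := h x; rewrite -/(nsq x) => /andP[? ?]; apply/andP; split; lra.
Qed.

Definition nrm x : R := Num.sqrt (nsq x).

Lemma nrm_le x c : 0 <= c -> (nrm x <= c) = (nsq x <= c ^+ 2).
Proof.
move=> c0; rewrite -ler_sqr ?nnegrE ?sqrtr_ge0 // sqr_sqrtr //; exact: nsq_ge0.
Qed.

Lemma nrm_ge0 x : 0 <= nrm x. Proof. exact: sqrtr_ge0. Qed.

Lemma nrm_sqr x : nrm x ^+ 2 = nsq x.
Proof. by rewrite sqr_sqrtr ?nsq_ge0. Qed.

Lemma nrmD x y : nrm (x + y) <= nrm x + nrm y.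
Proof.
rewrite nrm_le ?addr_ge0 ?nrm_ge0 // nsqD -(nrm_sqr x) -(nrm_sqr y).
suff : rdot x y <= nrm x * nrm y by lra.
rewrite (le_trans (ler_norm _)) // -ler_sqr ?nnegrE ?mulr_ge0 ?nrm_ge0 //.
by rewrite real_normK ?num_real // exprMn !nrm_sqr rdot_CS.
Qed.

Lemma nrmZ (a : R) x : 0 <= a -> nrm (a%:C *: x) = a * nrm x.
Proof. by move=> a0; rewrite /nrm nsqZ sqrtrM ?sqr_ge0 // sqrtr_sqr ger0_norm. Qed.

Lemma nrm0 : nrm 0 = 0.
Proof. by rewrite /nrm /nsq rdot0l sqrtr0. Qed.

(** * Square roots by fixed-point iteration *)

Section Sqrt.
Variable T : {linear H -> H}.
Hypothesis sT : symm T.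
Hypothesis cT : forall x, nsq (T x) <= nsq x.

(** Iterates Y = (T + Y^2) / 2, that is (1 - Y)^2 = 1 - T, from 0. All iterates are polynomials in T
    with nonnegative coefficients. *)
Fixpoint sqrt_iter n : H -> H :=
  if n is n.+1 then fun x => 2^-1%:C *: (T x + sqrt_iter n (sqrt_iter n x)) else fun=> 0.

(* Dominates sqrt_iter in norm, as do the increments. *)
Fixpoint sqrt_bound n : R := if n is n.+1 then (1 + sqrt_bound n ^+ 2) / 2 else 0.

Lemma sqrt_iterP n a x y : sqrt_iter n (a *: x + y) = a *: sqrt_iter n x + sqrt_iter n y.
Proof.
elim: n a x y => [|n IH] a x y /=; first by rewrite scaler0 addr0.
by rewrite linearP !IH addrACA -scalerDr [LHS]scalerDr !scalerA [_ * a]mulrC.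
Qed.

Lemma sqrt_iterD n x y : sqrt_iter n (x + y) = sqrt_iter n x + sqrt_iter n y.
Proof. by rewrite -{1}(scale1r x) sqrt_iterP scale1r. Qed.

Lemma sqrt_iterB n x y : sqrt_iter n (x - y) = sqrt_iter n x - sqrt_iter n y.
Proof. by rewrite addrC -scaleN1r sqrt_iterP scaleN1r addrC. Qed.

Lemma sqrt_iter_symm n : symm (sqrt_iter n).
Proof.
elim: n => [|n IH] x y /=; first by rewrite rdot0l rdot0r.
by rewrite !rdE sT !IH.
Qed.

Lemma sqrt_bound_mono n : 0 <= sqrt_bound n <= sqrt_bound n.+1 /\ sqrt_bound n.+1 <= 1.
Proof.
elim: n => [|n [/andP[h0 h1] h2]] /=.
  by split; lra.
move: h1 h2 => /=; set b := sqrt_bound n => h1 h2; split.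
  apply/andP; split; first by nra.
  by nra.
by nra.
Qed.

Lemma nrmT x : nrm (T x) <= nrm x.
Proof. by rewrite ler_sqrt ?nsq_ge0. Qed.

Lemma half_ge0 : 0 <= (2^-1 : R). Proof. by rewrite invr_ge0. Qed.

Lemma sqrt_iter_nrm n x : nrm (sqrt_iter n x) <= sqrt_bound n * nrm x.
Proof.
elim: n x => [|n IH] x /=; first by rewrite nrm0 mul0r.
rewrite nrmZ ?half_ge0 //.
have [/andP[b0 _] _] := sqrt_bound_mono n.
have := nrmD (T x) (sqrt_iter n (sqrt_iter n x)); have := nrmT x.
have := le_trans (IH (sqrt_iter n x)) (ler_wpM2l b0 (IH x)); nra.
Qed.

(** The splitting U^2 - V^2 = (U - V) U + V (U - V) of consecutive iterates mirrors the scalar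
    identity for [sqrt_bound], which is the iteration at T = 1. The increments therefore telescope
    against a convergent real sequence. *)
Lemma sqrt_iter_step n x :
  nrm (sqrt_iter n.+1 x - sqrt_iter n x) <= (sqrt_bound n.+1 - sqrt_bound n) * nrm x.
Proof.
elim: n x => [|n IH] x.
  rewrite /= !subr0 addr0 nrmZ ?half_ge0 //; have := nrmT x; nra.
have -> : sqrt_iter n.+2 x - sqrt_iter n.+1 x = 2^-1%:C *: (
    (sqrt_iter n.+1 (sqrt_iter n.+1 x) - sqrt_iter n (sqrt_iter n.+1 x)) +
    sqrt_iter n (sqrt_iter n.+1 x - sqrt_iter n x)).
  rewrite sqrt_iterB subrKA [sqrt_iter n.+2 x]/= [X in _ - X]/= -scalerBr.
  by rewrite opprD addrACA subrr add0r.
rewrite nrmZ ?half_ge0 //.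
have [/andP[b0 b1] _] := sqrt_bound_mono n.
have d0 : 0 <= sqrt_bound n.+1 - sqrt_bound n by rewrite subr_ge0.
have h1 := le_trans (IH (sqrt_iter n.+1 x)) (ler_wpM2l d0 (sqrt_iter_nrm n.+1 x)).
have h2 := le_trans (sqrt_iter_nrm n (sqrt_iter n.+1 x - sqrt_iter n x)) (ler_wpM2l b0 (IH x)).
have h3 := le_trans (nrmD _ _) (lerD h1 h2).
apply: le_trans (ler_wpM2l half_ge0 h3) _.
rewrite le_eqVlt; apply/orP; left; apply/eqP => /=; by field.
Qed.

Lemma sqrt_iter_diff n k x :
  nrm (sqrt_iter (n + k) x - sqrt_iter n x) <= (sqrt_bound (n + k) - sqrt_bound n) * nrm x.
Proof.
elim: k => [|k IH]; first by rewrite addn0 !subrr nrm0 mul0r.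
rewrite addnS -(subrKA (sqrt_iter (n + k) x)).
apply: le_trans (nrmD _ _) _.
have := sqrt_iter_step (n + k) x; lra.
Qed.

Lemma sqrt_bound_cvg : cvgn sqrt_bound.
Proof.
apply: nondecreasing_is_cvgn.
  by apply/nondecreasing_seqP => n; have [/andP[]] := sqrt_bound_mono n.
by exists 1 => _ [n _ <-]; have [/andP[_ h] /(le_trans h)] := sqrt_bound_mono n.
Qed.

Lemma sqrt_iter_cauchy x : exists l, cv (sqrt_iter ^~ x) l.
Proof.
apply: cauchy_cv => e e0.
have nx := nsq_ge0 x.
have nd : nondecreasing_seq sqrt_bound.
  by apply/nondecreasing_seqP => n; have [/andP[]] := sqrt_bound_mono n.
pose d := Num.sqrt (e / (nsq x + 1)).
have dp : 0 < d by rewrite sqrtr_gt0 divr_gt0 //; lra.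
have /cvgrPdist_lt/(_ d dp)[N _ hN] := sqrt_bound_cvg.
have key n k : (N <= n)%N -> nsq (sqrt_iter (n + k) x - sqrt_iter n x) < e.
  move=> /hN /=; have := nondecreasing_cvgn_le nd sqrt_bound_cvg n => h1.
  have := nondecreasing_cvgn_le nd sqrt_bound_cvg (n + k)%N => h2.
  rewrite ger0_norm ?subr_ge0 // => h3.
  have h4 : sqrt_bound n <= sqrt_bound (n + k) by apply: nd; rewrite leq_addr.
  have := sqrt_iter_diff n k x; rewrite nrm_le ?mulr_ge0 ?nrm_ge0 ?subr_ge0 //.
  move=> /le_lt_trans; apply; rewrite exprMn nrm_sqr.
  have h5 : (sqrt_bound (n + k) - sqrt_bound n) ^+ 2 < d ^+ 2.
    have h : sqrt_bound (n + k) - sqrt_bound n < d.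
      by apply: le_lt_trans h3; rewrite lerD2r.
    by rewrite ltr_sqr ?nnegrE ?subr_ge0 // ltW.
  have h6 : d ^+ 2 * (nsq x + 1) = e.
    rewrite sqr_sqrtr ?divr_ge0 ?ltW //; last by lra.
    by rewrite divfK //; apply/eqP => ?; lra.
  nra.
exists N => n m Nn Nm; have [nm|/ltnW mn] := leqP n m.
  by rewrite nsq_comm -(subnKC nm); exact: key.
by rewrite -(subnKC mn); exact: key.
Qed.

(* 1 - Y is then the square root of 1 - T. *)
Lemma sqrt_fix : exists Y, [/\ symm Y, forall x, nsq (Y x) <= nsq x,
  forall x, Y x = 2^-1%:C *: (T x + Y (Y x)) &
  forall Z, bndop Z -> (forall x, Z (T x) = T (Z x)) -> forall x, Z (Y x) = Y (Z x)].
Proof.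
have /choice[f hf] := sqrt_iter_cauchy.
have [|Y hY] := @linear_exists f.
  move=> a x y; apply: cv_unique (hf _) _.
  have := cvD (cvZ a (hf x)) (hf y); rewrite /cv => h e /h [N hN].
  by exists N => n /hN; rewrite sqrt_iterP.
have {hf} hf x : cv (sqrt_iter ^~ x) (Y x) by rewrite hY.
have bY x : nsq (Y x) <= nsq x.
  apply: (cvR_le (cv_nsq (hf x)) (cvg_cst (nsq x))) => n.
  rewrite -(nrm_sqr x) -nrm_le ?nrm_ge0 // (le_trans (sqrt_iter_nrm n x)) //.
  by rewrite ler_piMl ?nrm_ge0 //; have [/andP[_ h] /(le_trans h)] := sqrt_bound_mono n.
exists Y; split=> //.
- move=> x y; apply: cvR_eq (cv_rdot (hf x) (cv_cst y)) (cv_rdot (cv_cst x) (hf y)) _.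
  by move=> n; rewrite sqrt_iter_symm.
- move=> x; apply: cv_unique (cvS (hf x)) _; apply: cvZ; apply: cvD; first exact: cv_cst.
  have sc n y : nsq (sqrt_iter n y) <= nsq y.
    rewrite -(nrm_sqr y) -nrm_le ?nrm_ge0 // (le_trans (sqrt_iter_nrm n y)) //.
    by rewrite ler_piMl ?nrm_ge0 //; have [/andP[_ h] /(le_trans h)] := sqrt_bound_mono n.
  (* The iterates are contractions, so the first summand tends to 0 although both the operator and
     its argument vary. *)
  have -> : (fun n => sqrt_iter n (sqrt_iter n x)) =
      (fun n => sqrt_iter n (sqrt_iter n x - Y x) + sqrt_iter n (Y x)).
    by apply/funext => n; rewrite -sqrt_iterD subrK.
  rewrite -[Y (Y x)]add0r; apply: cvD => // e /(hf x)[N hN].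
  by exists N => n /hN; rewrite subr0; apply: le_lt_trans.
move=> Z bZ hZ x; apply: cv_unique (bnd_cv bZ (hf x)) _.
have -> : (fun n => Z (sqrt_iter n x)) = (fun n => sqrt_iter n (Z x)); last exact: hf.
apply/funext => n; elim: n x => [|n IH] x /=; first by rewrite linear0.
by rewrite linearZ /= linearD /= hZ !IH.
Qed.
End Sqrt.
End Operators.

(** * Positive square roots and monotone limits *)

Section SquareRoot.
Context {R : realType} {H : hilbertType R}.
Implicit Types (x y z : H) (X Y Z T C D B : {linear H -> H}).

(** Apply [sqrt_fix] to T = 1 - X and take C = 1 - Y. The commutation clause replaces functional
    calculus later on. *)
Lemma sqrt_effect X : effect X -> exists C, [/\ effect C, forall x, C (C x) = X x &
  forall Z, bndop Z -> (forall x, Z (X x) = X (Z x)) -> forall x, Z (C x) = C (Z x)].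
Proof.
move=> eX; have [T [hT /(_ eX) eT]] := effect_compl X.
have [Y [sY cY fY mY]] := sqrt_fix eT.1 (fun x => effect_contr x eT).
have [C [hC _]] := effect_compl Y.
have CC x : C (C x) = X x.
  apply: rdot_ext => z; have := congr1 (rdot^~ z) (fY x).
  rewrite !hC linearB /= !rdE hT !rdE; lra.
have sC : symm C by move=> x y; rewrite !hC !rdE sY.
exists C; split=> //.
  split=> // x; apply/andP; split.
    have := young (Y x) x; have := cY x; rewrite hC !rdE /nsq; lra.
  have e : nsq (C x) = rdot (X x) x by rewrite /nsq (sC x (C x)) CC rdotC.
  by have := young (C x) x; rewrite e; have /andP[_] := eX.2 x; lra.
move=> Z bZ hZ x; rewrite !hC linearB /= mY // => y.
by rewrite !hT linearB /= hZ.
Qed.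

(** For y = (B - C) x commutation gives (B + C) y = (B^2 - C^2) x = 0. Both forms then vanish at y,
    so B y = C y = 0 and |y|^2 = (x, (B - C) y) = 0. *)
Lemma sqrt_uniq B C : psd B -> psd C -> (forall x, B (B x) = C (C x)) ->
  (forall x, B (C x) = C (B x)) -> forall x, B x = C x.
Proof.
move=> pB pC BC com x; apply/eqP; rewrite -subr_eq0; apply/eqP.
have [y yE] : exists y, y = B x - C x by exists (B x - C x).
rewrite -yE.
have h : B y + C y = 0.
  by rewrite yE !linearB /= com BC addrC subrKA subrr.
have h2 : rdot (B y) y + rdot (C y) y = 0 by rewrite -rdotDl h rdot0l.
have b0 := pB.2 y; have c0 := pC.2 y.
have hB : B y = 0 by apply: psd_eq0 => //; lra.
have hC : C y = 0 by apply: psd_eq0 => //; lra.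
by apply: nsq_eq0; rewrite /nsq {1}yE !rdE pB.1 pC.1 hB hC rdot0r subrr.
Qed.

(** With E the square root of C, which commutes with D, the product is C D = E D E. *)
Lemma comm_psd C D : effect C -> effect D -> (forall x, D (C x) = C (D x)) ->
  psd (C \o D).
Proof.
move=> eC eD com; split=> [x y|x] /=; first by rewrite eC.1 eD.1 com.
have [E [eE EE mE]] := sqrt_effect eC.
rewrite -EE eE.1 -mE //; last exact: effect_bnd.
by case/andP: (eD.2 (E x)).
Qed.

Lemma sqrt_pair X : effect X -> exists C D, [/\ effect C, effect D,
  (forall x, C (C x) = X x), (forall x, D (D x) = x - X x) &
  (forall x, C (D x) = D (C x)) /\
  forall Z, bndop Z -> (forall x, Z (X x) = X (Z x)) ->
     (forall x, Z (C x) = C (Z x)) /\ (forall x, Z (D x) = D (Z x))].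
Proof.
move=> eX; have [Y [hY /(_ eX) eY]] := effect_compl X.
have [C [eC CC mC]] := sqrt_effect eX.
have [D [eD DD mD]] := sqrt_effect eY.
have mD' Z : bndop Z -> (forall x, Z (X x) = X (Z x)) -> forall x, Z (D x) = D (Z x).
  by move=> bZ hZ; apply: mD => // y; rewrite !hY linearB /= hZ.
exists C, D; split=> //.
  by move=> x; rewrite DD hY.
split; last by move=> Z bZ hZ; split; [exact: mC|exact: mD'].
by move=> x; apply: mD'; [exact: effect_bnd|move=> y; rewrite -!CC].
Qed.

(** For n <= m one has 0 <= X_n - X_m <= X_0 <= c, so [psd_nsq] bounds |X_n x - X_m x|^2 by c times
    an increment of the monotone real sequence (X_n x, x). *)
Lemma decreasing_psd_cvg (X : nat -> {linear H -> H}) (c : R) :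
  (forall n, psd (X n)) -> 0 <= c -> (forall x, rdot (X 0%N x) x <= c * nsq x) ->
  (forall n x, rdot (X n.+1 x) x <= rdot (X n x) x) ->
  exists L : {linear H -> H}, [/\ psd L, (forall x, cv (fun n => X n x) (L x)) &
    forall n x, rdot (L x) x <= rdot (X n x) x].
Proof.
move=> pX c0 X0 dX.
have ni x : nonincreasing_seq (fun n => rdot (X n x) x).
  by apply/nonincreasing_seqP => n.
have cvx x : cvgn (fun n => rdot (X n x) x).
  apply: nonincreasing_is_cvgn => //; exists 0 => _ [n _ <-]; exact: (pX n).2.
have diff n m x : (n <= m)%N ->
    nsq (X n x - X m x) <= c * (rdot (X n x) x - rdot (X m x) x).
  move=> nm; have [|Z hZ] := @linear_exists _ H (fun x => X n x - X m x).
    by move=> a u v; rewrite !linearP scalerDr addrACA.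
  rewrite -!hZ -rdotNl -rdotDl -hZ; apply: psd_nsq => // [|y].
    split=> [u v|u]; first by rewrite !hZ !rdE (pX n).1 (pX m).1.
    by rewrite hZ !rdE subr_ge0; exact: ni.
  rewrite hZ !rdE; apply: le_trans (X0 y).
  have := ni y _ _ (leq0n n); have := (pX m).2 y; rewrite /=; lra.
have key x : exists l, cv (fun n => X n x) l.
  apply: cauchy_cv => e e0.
  have cp : 0 < c + 1 by lra.
  have /cvgrPdist_lt/(_ (e / (c + 1)))[|N _ hN] := cvx x; first by rewrite divr_gt0.
  have K n m : (N <= n)%N -> (n <= m)%N -> nsq (X n x - X m x) < e.
    move=> Nn nm; apply: le_lt_trans (diff _ _ _ nm) _.
    have := hN n Nn => /=; rewrite distrC ger0_norm; last first.
      by rewrite subr_ge0; exact: (nonincreasing_cvgn_ge (ni x) (cvx x)).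
    have := nonincreasing_cvgn_ge (ni x) (cvx x) m; rewrite /=.
    set l := limn _ => h1; rewrite ltr_pdivlMr // => h2.
    have := ni x _ _ nm; rewrite /=; nra.
  exists N => n m Nn Nm; have [nm|/ltnW mn] := leqP n m; first exact: K.
  by rewrite nsq_comm; exact: K.
have [f hf] := choice key.
have [|L hL] := @linear_exists _ H f.
  move=> a x y; apply: cv_unique (hf _) _.
  rewrite (_ : (fun n => _) = (fun n => a *: X n x + X n y)).
    exact: cvD (cvZ a (hf x)) (hf y).
  by apply/funext => n; rewrite linearP.
have {hf} hf x : cv (fun n => X n x) (L x) by rewrite hL.
have le n x : rdot (L x) x <= rdot (X n x) x.
  have h : (fun m => rdot (X (m + n)%N x) x) @ \oo --> rdot (L x) x.
    by rewrite (cvg_shiftn n (fun m => rdot (X m x) x)); exact: cv_rdot (hf x) (cv_cst x).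
  apply: cvR_le h (cvg_cst _) _ => m; apply: ni; exact: leq_addl.
exists L; split=> //; split=> [x y|x].
  apply: cvR_eq (cv_rdot (hf x) (cv_cst y)) (cv_rdot (cv_cst x) (hf y)) _ => n.
  exact: (pX n).1.
by apply: cvR_le (cvg_cst 0) (cv_rdot (hf x) (cv_cst x)) _ => n; exact: (pX n).2.
Qed.
End SquareRoot.

(** * Minimisation of quadratic forms *)

Section Riesz.
Context {R : realType} {H : hilbertType R}.
Implicit Types (x y z : H) (D : set H) (N : H -> H -> R).

Definition real_subspace D := D 0 /\ forall (a : R) x y, D x -> D y -> D (a%:C *: x + y).

Definition psd_form D N := [/\ real_subspace D,
  forall x y, D x -> D y -> N x y = N y x,
  forall (a : R) x y z, D x -> D y -> D z -> N (a%:C *: x + y) z = a * N x z + N y z &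
  forall x, D x -> 0 <= N x x].

Lemma psd_form_CS D N x y : psd_form D N -> D x -> D y ->
  N x y ^+ 2 <= N x x * N y y.
Proof.
move=> [[D0 DD] sN lN pN] Dx Dy; apply: discr_le; first exact: pN.
move=> s; have Dz := DD (- s) _ _ Dx Dy; have := pN _ Dz.
rewrite lN // sN // lN // (sN _ _ Dy Dz) lN // (sN _ _ Dy Dx); lra.
Qed.

Lemma psd_formZD D N (a : R) x y : psd_form D N -> D x -> D y ->
  N (a%:C *: x + y) (a%:C *: x + y) = a ^+ 2 * N x x + 2 * a * N x y + N y y.
Proof.
move=> [[D0 DD] sN lN pN] Dx Dy; have Dz := DD a _ _ Dx Dy.
rewrite lN // (sN _ _ Dx Dz) lN // (sN _ _ Dy Dz) lN // (sN _ _ Dy Dx); ring.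
Qed.

(* The minimising sequence of N x x - 2 l x represents l in the completion
   of (D, N). *)
Lemma riesz_seq D N (l : H -> R) (M : R) : psd_form D N ->
  (forall (a : R) x y, D x -> D y -> l (a%:C *: x + y) = a * l x + l y) ->
  0 <= M -> (forall x, D x -> l x ^+ 2 <= M * N x x) ->
  exists e : nat -> H, [/\ forall n, D (e n),
    forall n m, N (e n - e m) (e n - e m) <= 2 * (n.+1%:R^-1 + m.+1%:R^-1) &
    forall n x, D x -> (N (e n) x - l x) ^+ 2 <= N x x * n.+1%:R^-1].
Proof.
move=> pf ll M0 lM; have [[D0 DD] sN lN pN] := pf.
pose J x := N x x - 2 * l x.
have JM x : D x -> - M <= J x.
  (* If N x x - 2 l x < -M, then (N x x + M)^2 < 4 (l x)^2 <= 4 M N x x, against (N x x - M)^2 >=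
     0. *)
  move=> Dx; have := lM x Dx; have := pN x Dx; rewrite /J.
  move: (N x x) (l x) => a b a0 h1; rewrite leNgt; apply/negP => h.
  have : (a + M) ^+ 2 < (2 * b) ^+ 2 by rewrite ltr_sqr ?nnegrE; lra.
  have := sqr_ge0 (a - M); lra.
pose S := [set J x | x in D].
have hS : has_inf S.
  split; first by exists (J 0), 0.
  by exists (- M) => _ [x Dx <-]; exact: JM.
have infJ x : D x -> inf S <= J x by move=> Dx; apply: (ge_inf hS.2); exists x.
have /choice[e he] (n : nat) : exists x, D x /\ J x < inf S + n.+1%:R^-1.
  have [|_ [x Dx <-] hx] := inf_adherent (eps := n.+1%:R^-1) _ hS.
    by rewrite invr_gt0 ltr0n.
  by exists x.
have JZD (a : R) x y : D x -> D y -> J (a%:C *: x + y) =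
    a ^+ 2 * N x x + 2 * a * N x y + N y y - 2 * (a * l x + l y).
  by move=> Dx Dy; rewrite /J ll // (psd_formZD a pf Dx Dy).
exists e; split=> [n|n m|n x Dx]; first by case: (he n).
  have [Dn Jn] := he n; have [Dm Jm] := he m.
  (* Parallelogram argument: J at the midpoint of e n and e m is at least the infimum, which both
     points nearly attain. *)
  have dE : e n - e m = (-1)%:C *: e m + e n by rewrite rmorphN1 scaleN1r addrC.
  have Dd : D (e n - e m) by rewrite dE; exact: DD.
  have enE : e n = 1%:C *: (e n - e m) + e m by rewrite scale1r subrK.
  have Dmid := DD 2^-1 _ _ Dd Dm; have := infJ _ Dmid.
  have := Jn; rewrite {1}enE !JZD //; move: Jm; rewrite /J; move: (_^-1) (_^-1) => r s; lra.
(* First variation: J (s x + e n) exceeds J (e n) - 1/(n+1) for every s, and the discriminant in s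
   is the claim. *)
have [Dn Jn] := he n; rewrite -sqrrN; apply: discr_le; first exact: pN.
move=> s; have := infJ _ (DD s _ _ Dx Dn); rewrite JZD //.
move: Jn; rewrite (sN _ _ Dn Dx) /J; move: (_^-1) => r; lra.
Qed.

Lemma riesz_closed D N (f : H) : psd_form D N ->
  (forall x, D x -> nsq x <= N x x) ->
  (forall e : nat -> H, (forall n, D (e n)) ->
     (forall r : R, 0 < r -> exists K, forall n m, (K <= n)%N -> (K <= m)%N ->
        N (e n - e m) (e n - e m) < r) ->
     exists2 u, D u & forall r : R, 0 < r -> exists K, forall n, (K <= n)%N ->
        N (e n - u) (e n - u) < r) ->
  exists2 u, D u & forall x, D x -> N u x = rdot f x.
Proof.
move=> pf big cl; have [[D0 DD] sN lN pN] := pf.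
have [|||e [De ce re]] := @riesz_seq D N (rdot f) (nsq f) pf.
- by move=> a x y _ _; rewrite !rdE.
- exact: nsq_ge0.
- move=> x Dx; apply: le_trans (rdot_CS f x) _.
  by rewrite ler_wpM2l ?nsq_ge0 ?big.
have small (r : R) : 0 < r -> exists K, forall n, (K <= n)%N -> n.+1%:R^-1 < r.
  by move=> r0; have [K _ hK] := near_infty_natSinv_lt (PosNum r0); exists K.
have [|u Du hu] := cl e De.
  move=> r r0; have [|K hK] := small (r / 4); first by rewrite divr_gt0.
  exists K => n m /hK h1 /hK h2; apply: le_lt_trans (ce n m) _.
  by move: n.+1%:R^-1 m.+1%:R^-1 h1 h2 => p q; lra.
exists u => // x Dx.
have Dnu n : D (e n - u).
  have -> : e n - u = (-1)%:C *: u + e n by rewrite rmorphN1 scaleN1r addrC.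
  exact: DD.
have h1 : (fun n => N (e n - u) (e n - u)) @ \oo --> (0 : R).
  apply/cvgrPdist_lt => r /hu[K hK]; exists K => // n /hK /=.
  by rewrite sub0r normrN ger0_norm ?pN.
have h2 : (fun n => N (e n - u) x) @ \oo --> (0 : R).
  apply: sq_cvg0 => [n|]; first exact: psd_form_CS pf (Dnu n) Dx.
  by rewrite -[X in _ --> X](mul0r (N x x)); apply: cvgM => //; exact: cvg_cst.
have h3 : (fun n => N (e n) x - rdot f x) @ \oo --> (0 : R).
  apply: sq_cvg0 => [n|]; first exact: re.
  rewrite -[X in _ --> X](mulr0 (N x x)); apply: cvgM; first exact: cvg_cst.
  exact: cvg_harmonic.
apply/eqP; rewrite -subr_eq0; apply/eqP.
have h4 : (fun n => N (e n) x - rdot f x - N (e n - u) x) @ \oo --> (0 : R).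
  by rewrite -[X in _ --> X](subr0 0); exact: cvgB.
apply: (cvR_eq (f := fun=> N u x - rdot f x) _ h4); first exact: cvg_cst.
move=> n; have : N (e n) x = 1 * N (e n - u) x + N u x.
  by rewrite -lN // scale1r subrK.
by rewrite mul1r => ->; ring.
Qed.
End Riesz.

(** * Projections and operator ranges *)

Section Subspaces.
Context {R : realType} {H : hilbertType R}.
Implicit Types (x y z : H) (D K : set H) (A : lrel H) (C X Y : {linear H -> H}).

Definition subspace D := D 0 /\ forall (a : R[i]) x y, D x -> D y -> D (a *: x + y).

Definition seq_closed D := forall u l, (forall n, D (u n)) -> cv u l -> D l.

Lemma subspace_real D : subspace D -> real_subspace D.
Proof. by case=> D0 DD; split=> // a; exact: DD. Qed.

Lemma subspaceB D x y : subspace D -> D x -> D y -> D (x - y).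
Proof. by case=> _ DD Dx Dy; rewrite addrC -scaleN1r; exact: DD. Qed.

Lemma subspaceD D x y : subspace D -> D x -> D y -> D (x + y).
Proof. by case=> _ DD Dx Dy; rewrite -(scale1r x); exact: DD. Qed.

Lemma subspaceZ D (c : R[i]) x : subspace D -> D x -> D (c *: x).
Proof. by case=> D0 DD Dx; rewrite -[_ *: _]addr0; exact: DD. Qed.

Lemma inner_eq x y z w : rdot x y = rdot z w -> rdot x ('i *: y) = rdot z ('i *: w) ->
  inner x y = inner z w.
Proof. by rewrite !innerE => -> ->. Qed.

Lemma inner0P x y : inner x y = 0 <-> rdot x y = 0 /\ rdot x ('i *: y) = 0.
Proof. by rewrite innerE; split=> [[-> ->]|[-> ->]]. Qed.

Lemma orthocP D y : subspace D -> orthoc D y <-> forall x, D x -> rdot x y = 0.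
Proof.
move=> sD; split=> h x Dx; first by have /inner0P[] := h x Dx.
apply/inner0P; split; first exact: h.
apply/eqP; rewrite -oppr_eq0 -rdot_i h //; exact: subspaceZ.
Qed.

Lemma orthoc_sub D : subspace (orthoc D).
Proof.
split=> [x _|a x y hx hy z Dz]; first by rewrite linear0r.
by rewrite linearDr linearZr_LR /= (hx z Dz) (hy z Dz) mulr0 addr0.
Qed.

Lemma rdot_forms : psd_form setT (@rdot R H).
Proof.
split=> //; first by move=> x y _ _; exact: rdotC.
  by move=> a x y z _ _ _; rewrite !rdE.
by move=> x _; exact: nsq_ge0.
Qed.

Lemma psd_formS D (N : H -> H -> R) : real_subspace D -> psd_form setT N -> psd_form D N.
Proof.
move=> sD [_ h1 h2 h3]; split=> //; first by move=> *; exact: h1.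
  by move=> *; exact: h2.
by move=> *; exact: h3.
Qed.

(** Riesz with the inner product itself as form on D: the vector representing (f, .) on D is the
    projection of f. *)
Lemma projection D f : subspace D -> seq_closed D -> exists2 u, D u & orthoc D (f - u).
Proof.
move=> sD cD; have rD := subspace_real sD.
have [|||u Du hu] := @riesz_closed _ H D (@rdot R H) f.
- exact: psd_formS rdot_forms.
- by [].
- move=> e De hc; have [l hl] := cauchy_cv hc.
  by exists l; [exact: cD hl|exact: hl].
exists u => //; apply/orthocP => // x Dx.
by rewrite !rdE (rdotC x u) hu // (rdotC x f) subrr.
Qed.

(** Douglas' range criterion for a single vector. The preimage k is exhibited as a limit of vectors
    in ran C, hence orthogonal to ker C; [form_core] depends on this. *)
Lemma bounded_functional_range C phi M : effect C -> 0 <= M ->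
  (forall f, rdot f phi ^+ 2 <= M * nsq (C f)) ->
  exists k e, [/\ cv (fun n => C (e n)) k, C k = phi & nsq k <= M].
Proof.
move=> eC M0 hM; pose N x y := rdot (C x) (C y).
have pf : psd_form setT N.
  split=> //.
  - by move=> x y _ _; exact: rdotC.
  - by move=> a x y z _ _ _; rewrite /N linearD linearZ /= !rdE.
  - by move=> x _; exact: nsq_ge0.
have [|//||e [_ ce re]] := @riesz_seq _ H setT N (rdot^~ phi) M pf.
- by move=> a x y _ _; rewrite !rdE.
- by move=> x _; exact: hM.
have [|k hk] := @cauchy_cv _ H (fun n => C (e n)).
  move=> r r0; have r4 : 0 < r / 4 by rewrite divr_gt0.
  have [K _ hK] := near_infty_natSinv_lt (PosNum r4).
  exists K => n m /hK /= h1 /hK /= h2; rewrite -linearB.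
  apply: le_lt_trans (ce n m) _.
  by move: n.+1%:R^-1 m.+1%:R^-1 h1 h2 => p q; lra.
have kE x : rdot k (C x) = rdot phi x.
  apply/eqP; rewrite -subr_eq0; apply/eqP.
  have h1 : (fun n => rdot (C (e n)) (C x) - rdot x phi) @ \oo --> (0 : R).
    apply: sq_cvg0 => [n|]; first exact: re.
    rewrite -[X in _ --> X](mulr0 (N x x)); apply: cvgM; first exact: cvg_cst.
    exact: cvg_harmonic.
  have h2 : (fun n => rdot (C (e n)) (C x) - rdot x phi) @ \oo -->
      rdot k (C x) - rdot x phi.
    by apply: cvgB; [exact: cv_rdot hk (cv_cst _)|exact: cvg_cst].
  by rewrite (rdotC phi); exact: cvg_unique h2 h1.
exists k, e; split=> //.
  by apply: rdot_ext => z; rewrite eC.1 kE.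
(* The hypothesis at e n reads (k, C (e n))^2 <= M |C (e n)|^2; let n tend to infinity. *)
have h : nsq k * nsq k <= M * nsq k.
  have h1 : (fun n => rdot k (C (e n)) ^+ 2) @ \oo --> rdot k k ^+ 2.
    rewrite expr2; under eq_fun do rewrite expr2.
    by apply: cvgM; exact: cv_rdot (cv_cst k) hk.
  have h2 : (fun n => M * nsq (C (e n))) @ \oo --> M * nsq k.
    by apply: cvgM; [exact: cvg_cst|exact: cv_nsq].
  apply: (cvR_le h1 h2) => n; rewrite kE rdotC; exact: hM.
have [->|kn0] := eqVneq (nsq k) 0; first by [].
by rewrite -(ler_pM2r (x := nsq k)) // lt_def kn0 nsq_ge0.
Qed.

Lemma closedP A : closed A <-> forall u v l m, (forall n, A (u n, v n)) ->
  cv u l -> cv v m -> A (l, m).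
Proof.
split=> [cA u v l m|h]; first exact: closed_cv.
apply/closedE => -[l m] /= hp.
have /choice[q hq] (n : nat) : exists q, [/\ A q, nsq (q.1 - l) < n.+1%:R^-1 &
    nsq (q.2 - m) < n.+1%:R^-1].
  by apply: hp; rewrite invr_gt0 ltr0n.
have small (r : R) : 0 < r -> exists k : nat, forall n : nat, (k <= n)%N -> n.+1%:R^-1 < r.
  by move=> r0; have [k _ hk] := near_infty_natSinv_lt (PosNum r0); exists k.
apply: (h (fun n => (q n).1) (fun n => (q n).2)).
- by move=> n; case: (hq n); case: (q n).
- move=> e /small[K hK]; exists K => n /hK; apply: lt_trans; by case: (hq n).
- move=> e /small[K hK]; exists K => n /hK; apply: lt_trans; by case: (hq n).
Qed.

End Subspaces.

(** * Relations and resolvents *)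

Section Relations.
Context {R : realType} {H : hilbertType R}.
Implicit Types (x y z f g : H) (D K : set H) (A : lrel H) (C X Y : {linear H -> H}).

(* The relation whose resolvent (A + 1)^-1 is X. *)
Definition of_resolvent (X : H -> H) : lrel H := [set p | p.1 = X (p.1 + p.2)].

Lemma rel_mem X f : of_resolvent X (X f, f - X f).
Proof. by rewrite /of_resolvent /= addrC subrK. Qed.

Lemma rdot_i_self x : rdot x ('i *: x) = 0.
Proof. have := rdot_i x x; rewrite rdotC; lra. Qed.

Lemma inner_ge0P x y : rdot x ('i *: y) = 0 -> 0 <= rdot x y -> 0 <= inner x y.
Proof. by move=> h1 h2; rewrite innerE h1 lecE /= eqxx h2. Qed.

Lemma inner_ge0_rdot x y : 0 <= inner x y -> 0 <= rdot x y.
Proof. by rewrite innerE lecE /= => /andP[]. Qed.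

Lemma rel_sub X (a : R[i]) p q :
  of_resolvent X p -> of_resolvent X q -> of_resolvent X (a *: p + q).
Proof.
rewrite /of_resolvent /= => h1 h2; rewrite {1}h1 {1}h2 -linearP /=.
by rewrite scalerDr addrACA.
Qed.

Lemma rel_symm X p q : symm X -> of_resolvent X p -> of_resolvent X q ->
  rdot p.2 q.1 = rdot p.1 q.2.
Proof.
case: p q => [f f'] [g g'] sX; rewrite /of_resolvent /= => h1 h2.
have := sX (f + f') (g + g'); rewrite -h1 -h2 !rdE; lra.
Qed.

Lemma symm_inner X p q : symm X -> of_resolvent X p -> of_resolvent X q ->
  inner p.2 q.1 = inner p.1 q.2.
Proof.
move=> sX h1 h2; apply: inner_eq; first exact: rel_symm h1 h2.
have h3 : of_resolvent X ('i *: q).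
  by rewrite -[_ *: _]addr0; apply: rel_sub => //; rewrite /of_resolvent /= addr0 linear0.
exact: (rel_symm sX h1 h3).
Qed.

Lemma rel_nsa X : effect X -> nonneg_selfadjoint (of_resolvent X).
Proof.
move=> eX; have sX := eX.1; split.
- split.
  + apply/closedP => u v l m; rewrite /of_resolvent /= => h hu hv.
    apply: (cv_unique hu); have -> : u = fun n => X (u n + v n) by exact/funext.
    by apply: effect_cv => //; exact: cvD hu hv.
  + by rewrite /of_resolvent /= addr0 linear0.
  + exact: rel_sub.
- apply/seteqP; split=> [p hp|[u v] [_ _ /= h]].
    by split=> // q hq; exact: symm_inner.
  rewrite /of_resolvent /=; apply: rdot_ext => z.
  have := h _ (rel_mem X z) => /(congr1 (@complex.Re R)).
  rewrite -!/(rdot _ _) /= !rdE => e.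
  move: (sX z u) (sX z v) e; rewrite (rdotC u) (rdotC (X _)) linearD /= !rdE.
  rewrite (rdotC z (X u)) (rdotC z (X v)); lra.
- move=> p hp; apply: inner_ge0P.
    move: hp; case: p => [a b] /=; rewrite /of_resolvent /= => ha.
    have -> : b = (a + b) - a by rewrite addrAC subrr add0r.
    have := sX (a + b) ('i *: (a + b)); rewrite linearZ /= -ha.
    move: (a + b) => c h; have := rdot_i a c; have := rdot_i_self a.
    rewrite !rdE (rdotC _ c); lra.
  move: hp; case: p => [a b] /=; rewrite /of_resolvent /= => ha.
  have := effect_nsq (a + b) eX; rewrite -ha /nsq !rdE (rdotC b); lra.
Qed.

(** A + 1 is onto. Its range is closed because |f|^2 and |f'|^2 are at most |f + f'|^2 on A, and a
    vector w orthogonal to it satisfies (w, -w) in the adjoint, which is A, so that positivity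
    forces w = 0. *)
Lemma nsa_rel A : nonneg_selfadjoint A ->
  exists2 X : {linear H -> H}, effect X & A = of_resolvent X.
Proof.
case=> -[cA A0 lA] adjA posA.
have pos p : A p -> 0 <= rdot p.2 p.1 by move=> /posA /inner_ge0_rdot.
have symA p q : A p -> A q -> rdot p.2 q.1 = rdot p.1 q.2.
  move=> Ap; rewrite {1}adjA => -[_ _ /(_ p Ap)]; by move=> /(congr1 (@complex.Re R)).
have AB p q : A p -> A q -> A (p - q).
  by move=> Ap Aq; rewrite addrC -scaleN1r; exact: lA.
have low p : A p -> nsq p.1 <= nsq (p.1 + p.2) /\ nsq p.2 <= nsq (p.1 + p.2).
  move=> /pos h; rewrite nsqD rdotC; have := nsq_ge0 p.1; have := nsq_ge0 p.2; split; lra.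
pose D := [set h | exists2 p, A p & h = p.1 + p.2].
have sD : subspace D.
  split; first by exists 0 => //=; rewrite addr0.
  move=> a _ _ [p Ap ->] [q Aq ->]; exists (a *: p + q); first exact: lA.
  by rewrite /= scalerDr addrACA.
have cD : seq_closed D.
  move=> u l Du hu; have /choice[p hp] (n : nat) : exists q, A q /\ u n = q.1 + q.2.
    by have [q Aq ->] := Du n; exists q.
  have Ap n : A (p n) by case: (hp n).
  have uE n : u n = (p n).1 + (p n).2 by case: (hp n).
  have cauu (r : R) : 0 < r -> exists N, forall n m, (N <= n)%N -> (N <= m)%N -> nsq (u n - u m) < r.
    move=> r0; have [|N hN] := hu (r / 4); first by rewrite divr_gt0.
    exists N => n m /hN h1 /hN h2; apply: le_lt_trans (nsq_tri (u n) l (u m)) _.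
    by rewrite (nsq_comm l); lra.
  have uB n m : u n - u m = (p n - p m).1 + (p n - p m).2.
    by rewrite !uE /= opprD addrACA.
  have [|f hf] := @cauchy_cv _ H (fun n => (p n).1).
    move=> r /cauu[N hN]; exists N => n m Nn Nm; apply: le_lt_trans (hN n m Nn Nm).
    by rewrite uB; exact: (low _ (AB _ _ (Ap n) (Ap m))).1.
  exists (f, l - f); last by rewrite /= addrC subrK.
  apply: (closed_cv (u := fun n => (p n).1) (v := fun n => u n - (p n).1) cA) => //.
    by move=> n; rewrite uE addrAC subrr add0r; case: (p n) (Ap n).
  exact: cvB.
have surj h : exists f, A (f, h - f).
  have [_ [p Ap ->] ou] := projection h sD cD.
  have [w wE] : exists w, w = h - (p.1 + p.2) by exists (h - (p.1 + p.2)).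
  rewrite -wE in ou.
  have Aw : A (w, - w).
    rewrite adjA; split=> // q Aq; rewrite linearNr /=.
    have /= := ou _ (ex_intro2 _ _ q Aq erefl); rewrite linearDl /=.
    by move/eqP; rewrite addr_eq0 => /eqP ->; rewrite opprK.
  have w0 : w = 0.
    apply: nsq_eq0; have := pos _ Aw; rewrite /= !rdE => h1.
    by have := nsq_ge0 w; rewrite /nsq; lra.
  exists p.1; suff -> : h - p.1 = p.2 by case: (p) Ap.
  by apply/eqP; rewrite subr_eq -subr_eq0 (addrC p.2) -wE w0.
have uniq f f' g g' : A (f, f') -> A (g, g') -> f + f' = g + g' -> f = g.
  move=> Af Ag e; apply/eqP; rewrite -subr_eq0; apply/eqP/nsq_eq0.
  have [h _] := low _ (AB _ _ Af Ag); move: h.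
  rewrite /= addrACA -opprD e subrr {2}/nsq rdot0l => h.
  by apply/eqP; rewrite eq_le h nsq_ge0.
have [f hf] := choice surj.
have [|X hX] := @linear_exists _ H f.
  move=> a x y; apply: uniq (hf _) (lA a _ _ (hf x) (hf y)) _ => /=.
  by rewrite subrKC addrACA -scalerDr !subrKC.
have {hf}hX h : A (X h, h - X h) by rewrite hX.
have AE : A = of_resolvent X.
  apply/seteqP; split=> [[u v] Auv|[u v]]; rewrite /of_resolvent /=.
    by apply: uniq Auv (hX _) _; rewrite subrKC.
  by move=> e; have := hX (u + v); rewrite -e addrAC subrr add0r.
exists X => //; split=> [x y|x].
  have := symA _ _ (hX x) (hX y); rewrite /= !rdE; lra.
have := pos _ (hX x); have := (low _ (hX x)).1; have := nsq_ge0 (X x).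
have := young (X x) x; rewrite /= subrKC !rdE (rdotC x (X x)) /nsq => h1 h2 h3 h4.
by apply/andP; split; lra.
Qed.

Lemma rapp_eq (S : lrel H) f g : S (f, g) -> (forall g', S (f, g') -> g' = g) -> rapp S f = g.
Proof. by move=> Sf h; apply: xget_unique => //= g' /h. Qed.

Lemma rinv_rel X Y : (forall x, Y x = x - X x) -> rinv (of_resolvent X) = of_resolvent Y.
Proof.
move=> hY; apply/seteqP; split=> -[u v]; rewrite /rinv /of_resolvent /= hY.
  by move=> e; rewrite (addrC u v) -e addrAC subrr add0r.
move=> e; have : u + X (u + v) = u + v by rewrite {1}e subrK.
by move=> /addrI h; rewrite (addrC v) h.
Qed.

Lemma rinvK A : rinv (rinv A) = A.
Proof. by apply/seteqP; split=> -[]. Qed.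

Lemma nsa_rinv A : nonneg_selfadjoint A -> nonneg_selfadjoint (rinv A).
Proof.
move=> /nsa_rel[X eX ->]; have [Y [hY /(_ eX) eY]] := effect_compl X.
by rewrite (rinv_rel hY); exact: rel_nsa.
Qed.

Lemma resolvent_rel X f : rapp (resolvent (of_resolvent X)) f = X f.
Proof.
have E g : resolvent (of_resolvent X) (f, g) <-> g = X f.
  rewrite /resolvent /radd_id /rinv /of_resolvent /=; split=> [[[a b] /= h [-> ->]]|->].
    by rewrite addrC.
  by exists (X f, f - X f); rewrite /= ?subrK // subrKC.
by apply: rapp_eq => [|g' /E //]; apply/E.
Qed.

End Relations.

(** * Square roots of relations *)

Section FormOperator.
Context {R : realType} {H : hilbertType R}.
Implicit Types (x y z f g h m : H) (S : lrel H).
Variables X C D : {linear H -> H}.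
Hypothesis eX : effect X.
Hypothesis eC : effect C.
Hypothesis eD : effect D.
Hypothesis CC : forall x, C (C x) = X x.
Hypothesis DD : forall x, D (D x) = x - X x.
Hypothesis CD : forall x, C (D x) = D (C x).
Hypothesis com : forall Z : {linear H -> H}, bndop Z -> (forall x, Z (X x) = X (Z x)) ->
     (forall x, Z (C x) = C (Z x)) /\ (forall x, Z (D x) = D (Z x)).

Let K := orthoc (rmul (of_resolvent X)).

Lemma kerC x : X x = 0 -> C x = 0.
Proof. by move=> h; apply: nsq_eq0; rewrite /nsq eC.1 CC h rdot0r. Qed.

Lemma rmul_relE m : rmul (of_resolvent X) m <-> C m = 0.
Proof.
rewrite /rmul /of_resolvent /= add0r; split=> [h|h]; first exact/kerC/esym.
by rewrite -CC h linear0.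
Qed.

Lemma rmul_rel_sub : subspace (rmul (of_resolvent X)).
Proof.
split; first by apply/rmul_relE; rewrite linear0.
move=> a x y /rmul_relE hx /rmul_relE hy; apply/rmul_relE.
by rewrite linearP /= hx hy scaler0 addr0.
Qed.

Lemma memK g : K g <-> forall m, C m = 0 -> rdot m g = 0.
Proof.
rewrite /K (orthocP _ rmul_rel_sub); split=> h m.
  by move=> /rmul_relE; exact: h.
by move=> /rmul_relE; exact: h.
Qed.

Lemma subK : subspace K. Proof. exact: orthoc_sub. Qed.

Lemma K_C g : K (C g).
Proof. by apply/memK => m hm; rewrite -eC.1 hm rdot0l. Qed.

Lemma K_D g : K g -> K (D g).
Proof.
move=> /memK hg; apply/memK => m hm; rewrite -eD.1; apply: hg.
by rewrite CD hm linear0.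
Qed.

Lemma K_ker g : K g -> C g = 0 -> g = 0.
Proof. by move=> /memK hg /hg h; exact: nsq_eq0. Qed.

Lemma K_decomp g : exists2 k, K k & C (g - k) = 0.
Proof.
have [|m /rmul_relE hm hk] := @projection _ H (rmul (of_resolvent X)) g rmul_rel_sub.
  move=> u l hu cu; apply/rmul_relE; apply: cv_unique (effect_cv eC cu) _.
  by have -> : (fun n => C (u n)) = (fun=> 0);
    [apply/funext => n; exact/rmul_relE|exact: cv_cst].
by exists (g - m); rewrite // opprB addrCA subrr addr0.
Qed.

Lemma C2D2 x : C (C x) + D (D x) = x.
Proof. by rewrite CC DD subrKC. Qed.

(** The candidate for the root of the operator part. On K, the orthogonal complement of ker C, the
    map C is injective, so these pairs form the graph of an operator. *)
Definition form_op : lrel H := [set p | exists2 g, K g & p = (C g, D g)].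

Lemma form_op_linear : linear_relation form_op.
Proof.
split.
- apply/closedP => u v l m huv hu hv.
  have /choice[g hg] (n : nat) : exists g, [/\ K g, u n = C g & v n = D g].
    by have [g Kg [-> ->]] := huv n; exists g.
  (* Since C^2 + D^2 = 1, convergence of C (g n) and D (g n) forces convergence of g n. *)
  have cg : cv g (C l + D m).
    have -> : g = (fun n => C (u n) + D (v n)).
      by apply/funext => n; have [_ -> ->] := hg n; rewrite C2D2.
    by apply: cvD; exact: effect_cv.
  exists (C l + D m).
    apply/memK => y hy; apply: (cvR_eq (cv_rdot (cv_cst y) cg) (cvg_cst 0)) => n.
    by have [/memK -> ] := hg n.
  congr (_, _).
    apply: cv_unique hu _; have -> : u = (fun n => C (g n)).
      by apply/funext => n; case: (hg n).
    exact: effect_cv.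
  apply: cv_unique hv _; have -> : v = (fun n => D (g n)).
    by apply/funext => n; case: (hg n).
  exact: effect_cv.
- by exists 0; rewrite ?linear0 //; case: subK.
- move=> a _ _ [g Kg ->] [h Kh ->]; exists (a *: g + h); first exact: subK.2.
  by rewrite !linearP.
Qed.

Lemma CD_symm g h : rdot (D g) (C h) = rdot (C g) (D h).
Proof. by rewrite -eC.1 CD eD.1. Qed.

Lemma CD_inner g h : inner (D g) (C h) = inner (C g) (D h).
Proof.
by apply: inner_eq; [exact: CD_symm|rewrite -!linearZ; exact: CD_symm].
Qed.

Lemma form_op_sa : nonneg_selfadjoint_in K form_op.
Proof.
split; first exact: form_op_linear.
  apply/seteqP; split=> [_ [h Kh ->]|[u v] [/= Ku Kv huv]].
    split=> /=; [exact: K_C|exact: K_D|].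
    by move=> _ [g Kg ->] /=; exact: CD_inner.
  have e : D u = C v.
    have Kw : K (D u - C v) by apply: subspaceB subK (K_D Ku) (K_C v).
    apply/eqP; rewrite -subr_eq0; apply/eqP/nsq_eq0.
    have /(congr1 (@complex.Re R)) := huv _ (ex_intro2 _ _ _ Kw erefl).
    rewrite /= -!/(rdot _ _) eD.1 eC.1 /nsq => h.
    by rewrite [LHS]rdotDr rdotNr h subrr.
  exists (C u + D v); first by apply: subspaceD subK (K_C u) (K_D Kv).
  by rewrite !linearD /= (CD v) -e C2D2 -CD e C2D2.
move=> _ [g Kg ->] /=; apply: inner_ge0P.
  have := CD_symm g ('i *: g); rewrite !linearZ /=.
  have := rdot_i (C g) (D g); rewrite (rdotC _ (D g)); lra.
rewrite -eC.1; exact: (comm_psd eC eD (fun x => esym (CD x))).2.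
Qed.

Lemma form_op_sqrt : is_op_part_sqrt (of_resolvent X) form_op.
Proof.
split; first exact: form_op_sa.
  apply/seteqP; split=> [m [g Kg [/esym hg ->]]|_ ->] /=.
    by rewrite (K_ker Kg hg) linear0.
  by exists 0; rewrite ?linear0 //; case: subK.
apply/seteqP; split=> [[x z] [y /= [g Kg [-> ->]] [h Kh [e ->]]]|[x z] [/= hX Kx Kz]].
  split=> /=; [|exact: K_C|exact: K_D].
  by rewrite /of_resolvent /= -CC linearD /= (CD h) -e C2D2.
have xE : x = X (x + z) by [].
have Kf : K (x + z) by exact: subspaceD subK Kx Kz.
exists (D (C (x + z))).
  by exists (C (x + z)); [exact: K_C|rewrite CC -xE].
exists (D (x + z)); first exact: K_D.
by rewrite /= CD DD -xE addrAC subrr add0r.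
Qed.

(** * Uniqueness of the square root of the operator part *)

Section Uniqueness.
Variable S : lrel H.
Hypothesis hS : is_op_part_sqrt (of_resolvent X) S.

Let saS : nonneg_selfadjoint_in K S. Proof. by case: hS. Qed.
Let linS : linear_relation S. Proof. by case: saS. Qed.
Let adjS : S = radj_in K S. Proof. by case: saS. Qed.

Let SK x y : S (x, y) -> K x /\ K y.
Proof. by rewrite adjS => -[]. Qed.

Let SB x y x' y' : S (x, y) -> S (x', y') -> S (x - x', y - y').
Proof.
move=> h h'; have [_ _ lS] := linS; have := lS (-1) _ _ h' h.
by rewrite scaleN1r addrC.
Qed.

Let Suniq x y y' : S (x, y) -> S (x, y') -> y = y'.
Proof.
move=> h h'; have := SB h h'; rewrite subrr => h0.
have [_ mS _] := hS; have : rmul S (y - y') by [].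
by rewrite mS /= => /eqP; rewrite subr_eq0 => /eqP.
Qed.

Let Ssym x y x' y' : S (x, y) -> S (x', y') -> rdot y x' = rdot x y'.
Proof.
move=> h; rewrite adjS => -[_ _ /(_ _ h)] /=.
by move/(congr1 (@complex.Re R)).
Qed.

Let Spos x y : S (x, y) -> 0 <= rdot y x.
Proof. by move=> h; have [_ _ /(_ _ h) /inner_ge0_rdot] := saS. Qed.

Let Ssq x y z : S (x, y) -> S (y, z) -> x = X (x + z).
Proof.
move=> h h'; have [_ _ sq] := hS; have : rcomp S S (x, z) by exists y.
by rewrite sq => -[].
Qed.

Let Sdom h : exists b, S (X h, b) /\ (K h -> S (b, h - X h)).
Proof.
have [k Kk hk] := K_decomp h.
have Xhk : X h = X k.
  by apply/eqP; rewrite -subr_eq0 -linearB -CC hk linear0.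
have [_ _ sq] := hS; have : op_part (of_resolvent X) (X k, k - X k).
  split; first exact: rel_mem.
    by rewrite /= -CC; exact: K_C.
  by apply: subspaceB subK Kk _; rewrite -CC; exact: K_C.
rewrite -sq => -[/= b b1 b2]; exists b; split; first by rewrite Xhk.
move=> Kh; suff -> : h = k by [].
apply/eqP; rewrite -subr_eq0; apply/eqP/K_ker => //; exact: subspaceB subK Kh Kk.
Qed.

(* B = S X is the positive square root of X (1 - X), hence equals C D. *)
Let Sroot : exists B : {linear H -> H}, forall h, S (X h, B h) /\ (K h -> S (B h, h - X h)).
Proof.
have [f hf] := choice Sdom.
have [|B hB] := @linear_exists _ H f.
  move=> a x y; apply: (Suniq (hf _).1); rewrite linearP.
  by have [_ _ lS] := linS; exact: lS (hf x).1 (hf y).1.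
by exists B => h; rewrite hB.
Qed.

(** Once B = S X is identified with C D, every (x, y) in S satisfies C y = D x. This places
    [form_op] inside the adjoint of S, which is S, and a selfadjoint operator has no proper
    selfadjoint extension. *)
Lemma op_part_sqrt_uniq : S = form_op.
Proof.
have [B hB] := Sroot.
(* S maps B x to x - X x and x - X x to y - B x, so S^2 = A_o gives B x = X (B x + (y - B x)). *)
have comm x y : S (x, y) -> B x = X y.
  move=> h; have [Kx _] := SK h; have [h1 /(_ Kx) h2] := hB x.
  have := Ssq h2 (SB h h1); rewrite addrC subrK; exact.
have Bker k : C k = 0 -> B k = 0.
  move=> hk; apply: (Suniq (hB k).1); rewrite -CC hk linear0.
  by case: linS.
have BK h k : C (h - k) = 0 -> B h = B k.
  by move=> /Bker /eqP; rewrite linearB subr_eq0 => /eqP.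
have KB h : K (B h) by have [_] := SK (hB h).1.
have dotK h g k : K h -> C (g - k) = 0 -> rdot h g = rdot h k.
  by move=> /memK hh /hh; rewrite !rdE (rdotC g) (rdotC k); lra.
have symB : symm B.
  have symK h g : K h -> K g -> rdot (B h) g = rdot h (B g).
    move=> Kh Kg; have [h1 /(_ Kh) h2] := hB h; have [g1 /(_ Kg) g2] := hB g.
    have := Ssym h1 g1; have := Ssym h2 g2; rewrite !rdE; lra.
  move=> h g; have [h' Kh' eh] := K_decomp h; have [g' Kg' eg] := K_decomp g.
  rewrite (BK _ _ eh) (BK _ _ eg) (dotK _ _ _ (KB _) eg) (rdotC h).
  by rewrite (dotK _ _ _ (KB _) eh) (rdotC _ h') symK.
have BB h : B (B h) = X (h - X h).
  have [k Kk eh] := K_decomp h; have Xhk : X h = X k.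
    by apply/eqP; rewrite -subr_eq0 -linearB -CC eh linear0.
  have [h1 /(_ Kk) h2] := hB k.
  by rewrite (BK _ _ eh) (comm _ _ h2) !linearB /= Xhk.
have BX h : B (X h) = X (B h) by apply: comm; case: (hB h).
have pB : psd B.
  split=> // h; have [k Kk eh] := K_decomp h.
  rewrite (BK _ _ eh) (dotK _ _ _ (KB _) eh).
  have [h1 /(_ Kk) h2] := hB k; have := Spos h1; have := Spos h2.
  rewrite !rdE !(rdotC _ (B k)); lra.
have [Y hY] : exists Y : {linear H -> H}, forall x, Y x = C (D x).
  by apply: linear_exists => a x y; rewrite !linearP.
have pY : psd Y.
  have [s p] := comm_psd eC eD (fun x => esym (CD x)).
  by split=> [x y|x]; rewrite !hY; [exact: s|exact: p].
have YY x : B (B x) = Y (Y x).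
  by rewrite BB !hY -(CD (D x)) CC DD.
(* B is built from the possibly unbounded S; its bound comes from B^2 = (C D)^2 and symmetry, and is
   what lets [com] apply to it. *)
have bB : bndop B.
  exists 1 => // x; rewrite mul1r /nsq symB YY -pY.1 !hY -/(nsq _).
  exact: le_trans (effect_contr _ eC) (effect_contr _ eD).
have [BC BD] := com bB BX.
have BE x : B x = C (D x).
  by rewrite -hY; apply: sqrt_uniq => // y; rewrite !hY BC BD.
have sub p : form_op p -> S p.
  move=> [g Kg ->]; rewrite adjS; split=> /=; [exact: K_C|exact: K_D|].
  move=> [x y] hxy /=; have [Kx Ky] := SK hxy.
  have e : C y = D x.
    have Kw : K (C y - D x) by apply: subspaceB subK (K_C y) (K_D Kx).
    apply/eqP; rewrite -subr_eq0; apply/eqP/K_ker => //.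
    by rewrite linearB /= CC -(comm _ _ hxy) BE subrr.
  have key h : rdot y (C h) = rdot x (D h) by rewrite -eC.1 e eD.1.
  by apply: inner_eq; [exact: key|rewrite -!linearZ; exact: key].
(* Taking adjoints reverses [sub], and both relations equal their adjoints in K. *)
apply/seteqP; split=> // p; rewrite [in X in X -> _]adjS => -[K1 K2 h].
have [_ -> _] := form_op_sa; split=> // q /sub; exact: h.
Qed.

End Uniqueness.

Lemma op_part_sqrt_rel : op_part_sqrt (of_resolvent X) = form_op.
Proof.
apply: xget_unique; first exact: form_op_sqrt.
exact: op_part_sqrt_uniq.
Qed.

Lemma form_op_app g : K g -> rapp form_op (C g) = D g.
Proof.
move=> Kg; apply: rapp_eq; first by exists g.
move=> _ [h Kh [e ->]]; suff -> : g = h by [].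
apply/eqP; rewrite -subr_eq0; apply/eqP/K_ker; first exact: subspaceB subK Kg Kh.
by rewrite linearB /= e subrr.
Qed.

(** The summand mul A is ker C, where D^2 = 1; it is reached through D, and the restriction of g to
    K disappears. *)
Lemma rsqrt_relE u v : rsqrt (of_resolvent X) (u, v) <-> exists g, u = C g /\ v = D g.
Proof.
rewrite /rsqrt /= op_part_sqrt_rel; split.
  move=> [_ [m [[g Kg [-> ->]] /rmul_relE hm ->]]]; exists (g + D m).
  rewrite !linearD /= CD hm linear0 addr0; split=> //; congr (_ + _).
  by rewrite -[LHS]C2D2 hm linear0 add0r.
move=> [g [-> ->]]; have [k Kk hk] := K_decomp g.
exists (D k), (D (g - k)); split.
- exists k => //; congr (_, _); apply/eqP.
  by rewrite -subr_eq0 -linearB hk.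
- by apply/rmul_relE; rewrite CD hk linear0.
- by rewrite linearB /= addrC subrK.
Qed.

Lemma lr_form_dom_rel phi : lr_form_dom (of_resolvent X) phi <-> exists g, phi = C g.
Proof.
rewrite /lr_form_dom op_part_sqrt_rel /rdom /=; split.
  by move=> [_ [g _ [-> _]]]; exists g.
move=> [g ->]; have [k Kk hk] := K_decomp g; exists (D k); exists k => //.
by congr (_, _); apply/eqP; rewrite -subr_eq0 -linearB hk.
Qed.

End FormOperator.

(** * Closed forms, duality and order *)

Section Forms.
Context {R : realType} {H : hilbertType R}.
Implicit Types (x y z f g h m phi psi : H) (A : lrel H) (X Y C D : {linear H -> H}).

(* C and D are the square roots of X = (A + 1)^-1 and of 1 - X, so that
   A^{1/2} = {(C g, D g)}, and (D, C) is the same data for A^-1. *)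
Record spectral_pair A X C D : Prop := SpectralPair {
  spE : A = of_resolvent X;
  spX : effect X;
  spC : effect C;
  spD : effect D;
  spCC : forall x, C (C x) = X x;
  spDD : forall x, D (D x) = x - X x;
  spCD : forall x, C (D x) = D (C x);
  spcom : forall Z : {linear H -> H}, bndop Z -> (forall x, Z (X x) = X (Z x)) ->
     (forall x, Z (C x) = C (Z x)) /\ (forall x, Z (D x) = D (Z x)) }.

Lemma nsa_spectral A : nonneg_selfadjoint A -> exists X C D, spectral_pair A X C D.
Proof.
move=> /nsa_rel[X eX AE]; have [C [D [eC eD CC DD [CD com]]]] := sqrt_pair eX.
by exists X, C, D.
Qed.

Lemma spectral_inv A X C D : spectral_pair A X C D ->
  exists2 Y : {linear H -> H}, (forall x, Y x = x - X x) & spectral_pair (rinv A) Y D C.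
Proof.
case=> AE eX eC eD CC DD CD com; have [Y [hY /(_ eX) eY]] := effect_compl X.
exists Y => //; split=> //.
- by rewrite AE; exact: rinv_rel.
- by move=> x; rewrite DD hY.
- by move=> x; rewrite hY subKr CC.
- move=> Z bZ hZ; have [|h1 h2] := com Z bZ; last by split.
  move=> x; have := hZ x; rewrite !hY linearB /=.
  by move/addrI/oppr_inj.
Qed.

Definition form_app A : H -> H := rapp (op_part_sqrt A).
Definition form A phi psi : R := rdot (form_app A phi) (form_app A psi).
Definition formq A phi : R := form A phi phi.

Lemma lr_formE A phi : lr_form A phi = (formq A phi)%:C.
Proof. exact: norm_nsq. Qed.

Lemma formq_ge0 A phi : 0 <= formq A phi. Proof. exact: nsq_ge0. Qed.

Lemma lr_form_leE A1 A2 : lr_form_le A1 A2 <->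
  forall phi, lr_form_dom A2 phi -> lr_form_dom A1 phi /\ formq A1 phi <= formq A2 phi.
Proof.
split=> [[h1 h2] phi d2|h].
  by split; [exact: h1|rewrite -lecR -!lr_formE; exact: h2].
by split=> phi d2; [exact: (h phi d2).1|rewrite !lr_formE lecR; exact: (h phi d2).2].
Qed.

Definition ker_orth C g := forall m, C m = 0 -> rdot m g = 0.

Section SpectralPair.
Variables (A : lrel H) (X C D : {linear H -> H}).
Hypothesis s : spectral_pair A X C D.
Let CC := spCC s.
Let DD := spDD s.
Let CD := spCD s.
Let eC := spC s.
Let eD := spD s.
Let eX := spX s.

Lemma sp_norm g : nsq (C g) + nsq (D g) = nsq g.
Proof. rewrite /nsq eC.1 eD.1 CC DD !rdE; ring. Qed.

Lemma ker_orthE g : ker_orth C g <-> orthoc (rmul (of_resolvent X)) g.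
Proof. by split; [move=> h; apply/(memK eC CC)|move/(memK eC CC)]. Qed.

Lemma ker_orth_sub : subspace (ker_orth C).
Proof.
split=> [m _|a x y hx hy m hm]; first by rewrite rdot0r.
have := (@subK R H X).2 a x y ((ker_orthE x).1 hx) ((ker_orthE y).1 hy).
by move=> /ker_orthE; exact.
Qed.

Lemma ker_orth_ran g : ker_orth C (C g).
Proof. by move=> m hm; rewrite -eC.1 hm rdot0l. Qed.

Lemma ker_orth_cv u l : (forall n, ker_orth C (u n)) -> cv u l -> ker_orth C l.
Proof.
move=> hu cu m hm.
apply: (cvR_eq (cv_rdot (cv_cst m) cu) (cvg_cst 0)) => n; exact: hu.
Qed.

Lemma ker_orth_inj g h : ker_orth C g -> ker_orth C h -> C g = C h -> g = h.
Proof.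
move=> Kg Kh e; apply/eqP; rewrite -subr_eq0; apply/eqP/nsq_eq0.
have := (subspaceB ker_orth_sub Kg Kh); apply.
by rewrite linearB /= e subrr.
Qed.

Lemma form_domE phi : lr_form_dom A phi <-> exists g, phi = C g.
Proof. by rewrite (spE s); exact: (lr_form_dom_rel eC eD CC DD CD (spcom s)). Qed.

Lemma form_domK phi : lr_form_dom A phi -> exists2 g, ker_orth C g & phi = C g.
Proof.
move=> /form_domE[g ->]; have [k Kk hk] := K_decomp eC CC g.
exists k; first exact/ker_orthE.
by apply/eqP; rewrite -subr_eq0 -linearB hk.
Qed.

Lemma form_appE g : ker_orth C g -> form_app A (C g) = D g.
Proof.
move=> /ker_orthE Kg; rewrite /form_app (spE s).
rewrite (op_part_sqrt_rel eC eD CC DD CD (spcom s)).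
exact: form_op_app.
Qed.

Lemma formqK g : ker_orth C g -> nsq (C g) + formq A (C g) = nsq g.
Proof. by move=> Kg; rewrite /formq /form form_appE // -/(nsq _) sp_norm. Qed.

(** Only an inequality: the component of g in ker C contributes to |g| but not to C g. *)
Lemma formq_le g : nsq (C g) + formq A (C g) <= nsq g.
Proof.
have [k Kk hk] := K_decomp eC CC g.
have -> : C g = C k by apply/eqP; rewrite -subr_eq0 -linearB hk.
rewrite formqK; last exact/ker_orthE.
have -> : g = (g - k) + k by rewrite subrK.
have K' := (ker_orthE k).2 Kk; rewrite nsqD K' // mulr0 addr0 lerDr; exact: nsq_ge0.
Qed.

Lemma rsqrtE u v : rsqrt A (u, v) <-> exists g, u = C g /\ v = D g.
Proof. by rewrite (spE s); exact: rsqrt_relE eC eD CC DD CD (spcom s) u v. Qed.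

Lemma form_app_ker phi : lr_form_dom A phi ->
  exists g, [/\ ker_orth C g, phi = C g & form_app A phi = D g].
Proof. by move=> /form_domK[g Kg ->]; exists g; split=> //; exact: form_appE. Qed.

(** Kato's first representation theorem for relations: a relation is recovered from its form. *)
Lemma mem_formE f f' : A (f, f') <-> lr_form_dom A f /\
  forall psi, lr_form_dom A psi -> form A f psi = rdot f' psi.
Proof.
split=> [|[/form_domK[g Kg ->] h]].
  move=> Aff; have e : f = X (f + f') by move: Aff; rewrite (spE s).
  split; first by apply/form_domE; exists (C (f + f')); rewrite CC -e.
  move=> psi /form_domK[g Kg ->]; rewrite /form {1}e -CC.
  rewrite !form_appE //; last exact: ker_orth_ran.
  rewrite -eD.1 DD -eC.1 -(CC (C _)) (CC (f + f')) -e -linearB.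
  by rewrite addrAC subrr add0r.
have e : D (D g) = C f'.
  have Kw : ker_orth C (D (D g) - C f').
    apply: (subspaceB ker_orth_sub); last exact: ker_orth_ran.
    by rewrite DD -CC; apply: subspaceB ker_orth_sub Kg (ker_orth_ran _).
  apply/eqP; rewrite -subr_eq0; apply/eqP/nsq_eq0.
  have := h _ ((form_domE _).2 (ex_intro _ _ erefl)) : form A (C g) (C (D (D g) - C f')) = _.
  rewrite /form !form_appE // -eD.1 -eC.1 => h'.
  by rewrite /nsq {1}rdotDl rdotNl h' subrr.
rewrite (spE s) /of_resolvent /= -CC linearD /= -e.
by have := C2D2 CC DD g; rewrite (spCC s) => ->.
Qed.

End SpectralPair.

Lemma rran_rsqrt A psi : nonneg_selfadjoint A ->
  rran (rsqrt A) psi <-> lr_form_dom (rinv A) psi.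
Proof.
move=> /nsa_spectral[X [C [D s]]]; have [Y _ s'] := spectral_inv s.
rewrite (form_domE s'); split=> [[u /(rsqrtE s)[g [_ ->]]]|[g ->]].
  by exists g.
by exists (C g); apply/(rsqrtE s); exists g.
Qed.

Lemma form_dom_sub A : nonneg_selfadjoint A -> subspace (lr_form_dom A).
Proof.
move=> /nsa_spectral[X [C [D s]]]; split=> [|a x y].
  by apply/(form_domE s); exists 0; rewrite linear0.
move=> /(form_domE s)[g ->] /(form_domE s)[h ->].
by apply/(form_domE s); exists (a *: g + h); rewrite linearP.
Qed.

Lemma form_appP A (a : R[i]) x y : nonneg_selfadjoint A ->
  lr_form_dom A x -> lr_form_dom A y ->
  form_app A (a *: x + y) = a *: form_app A x + form_app A y.
Proof.
move=> /nsa_spectral[X [C [D s]]].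
move=> /(form_domK s)[g Kg ->] /(form_domK s)[h Kh ->].
rewrite -linearP !(form_appE s) // ?linearP //.
exact: (ker_orth_sub s).2.
Qed.

Lemma form_app_closed A (e : nat -> H) x y : nonneg_selfadjoint A ->
  (forall n, lr_form_dom A (e n)) -> cv e x -> cv (fun n => form_app A (e n)) y ->
  lr_form_dom A x /\ form_app A x = y.
Proof.
move=> /nsa_spectral[X [C [D s]]] he cx cy.
have /choice[g hg] (n : nat) := form_app_ker s (he n).
have eg : g = (fun n => C (e n) + D (form_app A (e n))).
  by apply/funext => n; have [_ e1 e2] := hg n; rewrite e2 e1 (C2D2 (spCC s) (spDD s)).
have cg : cv g (C x + D y).
  by rewrite eg; apply: cvD; apply: effect_cv => //; [exact: spC s|exact: spD s].
have Kg : ker_orth C (C x + D y).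
  by apply: ker_orth_cv cg => n; case: (hg n).
have xE : x = C (C x + D y).
  apply: cv_unique cx _; have -> : e = (fun n => C (g n)).
    by apply/funext => n; case: (hg n).
  exact: effect_cv (spC s) cg.
have yE : y = D (C x + D y).
  apply: cv_unique cy _; have -> : (fun n => form_app A (e n)) = (fun n => D (g n)).
    by apply/funext => n; case: (hg n).
  exact: effect_cv (spD s) cg.
split; first by apply/(form_domE s); exists (C x + D y).
by rewrite {1}xE (form_appE s).
Qed.

(* Together with form_conj: the form of A^-1 is the convex conjugate of that of A. *)
Lemma form_young A phi psi : nonneg_selfadjoint A -> lr_form_dom A phi ->
  lr_form_dom (rinv A) psi -> 2 * rdot phi psi <= formq A phi + formq (rinv A) psi.
Proof.
move=> /nsa_spectral[X [C [D s]]]; have [Y _ s'] := spectral_inv s.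
move=> /(form_app_ker s)[g [_ -> e]] /(form_app_ker s')[h [_ -> e']].
rewrite /formq /form e e' (spC s).1 (spCD s) -(spD s).1; exact: young.
Qed.

Lemma form_conj A phi M : nonneg_selfadjoint A ->
  (forall psi, lr_form_dom (rinv A) psi -> 2 * rdot phi psi <= M + formq (rinv A) psi) ->
  lr_form_dom A phi /\ formq A phi <= M.
Proof.
move=> /nsa_spectral[X [C [D s]]]; have [Y _ s'] := spectral_inv s => h.
have hg g : 2 * rdot phi (D g) <= M + nsq (C g).
  have := h (D g) ((form_domE s' _).2 (ex_intro _ g erefl)).
  by have := formq_le s' g; have := sp_norm s g; lra.
have M0 : 0 <= M.
  by have := hg 0; rewrite !linear0 rdot0r /nsq rdot0l; lra.
(* Scaling f by a real t and taking the discriminant turns [hg] into (f, D phi)^2 <= M |C f|^2. The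
   resulting k with C k = D phi is the missing second component: phi = C (C phi + D k), and the form
   at phi is at most |k|^2. *)
have [|k [e [he ke kM]]] := bounded_functional_range (phi := D phi) (spC s) M0.
  move=> f; rewrite mulrC; apply: discr_le; first exact: nsq_ge0.
  move=> t; have h1 := hg (t%:C *: f); rewrite !linearZ /= nsqZ rdotZr in h1.
  rewrite (rdotC phi) (spD s).1 in h1; lra.
have hC : C (C phi + D k) = phi.
  by rewrite linearD /= (spCD s) ke (C2D2 (spCC s) (spDD s)).
split; first by apply/(form_domE s); exists (C phi + D k).
have hD : D (C phi + D k) = k.
  by rewrite linearD /= -(spCD s) -ke (C2D2 (spCC s) (spDD s)).
have := formq_le s (C phi + D k); have := sp_norm s (C phi + D k).
rewrite hC hD; lra.
Qed.

Lemma lr_form_le_inv A1 A2 : nonneg_selfadjoint A1 -> nonneg_selfadjoint A2 ->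
  lr_form_le A1 A2 -> lr_form_le (rinv A2) (rinv A1).
Proof.
move=> n1 n2 /lr_form_leE h; apply/lr_form_leE => psi dpsi.
apply: form_conj; first exact: nsa_rinv.
rewrite rinvK => phi /h[d1 le]; have := form_young n1 d1 dpsi.
rewrite (rdotC psi); lra.
Qed.

(** Forward: write X2 f = C1 g with g orthogonal to ker C1. Then |g|^2 <= (X2 f, f), and Young for
    (g, C1 f) = (X2 f, f) concludes. Backward: |C2 f| <= |C1 f| and the range criterion turn C2 g
    into C1 k with |k| <= |g|. *)
Lemma lr_form_le_resolvent A1 X1 C1 D1 A2 X2 C2 D2 :
  spectral_pair A1 X1 C1 D1 -> spectral_pair A2 X2 C2 D2 ->
  lr_form_le A1 A2 <-> forall f, rdot (X2 f) f <= rdot (X1 f) f.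
Proof.
move=> s1 s2; split=> [/lr_form_leE h f|h].
  have d2 : lr_form_dom A2 (X2 f).
    by apply/(form_domE s2); exists (C2 f); rewrite (spCC s2).
  have [d1 le] := h _ d2; have [g [Kg gE _]] := form_app_ker s1 d1.
  have n1 := formqK s1 Kg; have n2 := formqK s2 (ker_orth_ran s2 f).
  rewrite -gE in n1; rewrite (spCC s2) in n2.
  have e1 : nsq (C1 f) = rdot (X1 f) f by rewrite /nsq (spC s1).1 (spCC s1) rdotC.
  have e2 : nsq (C2 f) = rdot (X2 f) f by rewrite /nsq (spC s2).1 (spCC s2) rdotC.
  have := young (C1 f) g; rewrite (spC s1).1 -gE (rdotC f); lra.
apply/lr_form_leE => phi /(form_app_ker s2)[g [Kg -> _]].
have [|k [e [_ ke kM]]] := bounded_functional_range (phi := C2 g) (spC s1) (nsq_ge0 g).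
  move=> f; rewrite -(spC s2).1; apply: le_trans (rdot_CS _ _) _.
  rewrite mulrC ler_wpM2l ?nsq_ge0 //.
  by rewrite /nsq (spC s1).1 (spC s2).1 (spCC s1) (spCC s2) !(rdotC f).
rewrite -ke; split; first by apply/(form_domE s1); exists k.
have := formq_le s1 k; have := formqK s2 Kg; rewrite -ke; lra.
Qed.

Lemma symm_quad_eq X Y : symm X -> symm Y ->
  (forall f, rdot (X f) f = rdot (Y f) f) -> forall f, X f = Y f.
Proof.
move=> sX sY h f; apply: rdot_ext => z.
have := h (f + z); have := h f; have := h z; rewrite !linearD /= !rdE.
by rewrite (sX z f) (sY z f) (rdotC z (X f)) (rdotC z (Y f)); lra.
Qed.

Lemma lr_form_le_anti A1 A2 : nonneg_selfadjoint A1 -> nonneg_selfadjoint A2 ->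
  lr_form_le A1 A2 -> lr_form_le A2 A1 -> A1 = A2.
Proof.
move=> /nsa_spectral[X1 [C1 [D1 s1]]] /nsa_spectral[X2 [C2 [D2 s2]]].
move=> /(lr_form_le_resolvent s1 s2) h1 /(lr_form_le_resolvent s2 s1) h2.
rewrite (spE s1) (spE s2); congr of_resolvent; apply/funext.
apply: symm_quad_eq; [exact: (spX s1).1|exact: (spX s2).1|].
by move=> f; apply/eqP; rewrite eq_le h1 h2.
Qed.

(** ran X is a core: g orthogonal to ker C is a limit of C (e n), and C, D map this sequence to X (e
    n) and to the values of the root at X (e n). *)
Lemma form_core A X C D phi : spectral_pair A X C D -> lr_form_dom A phi ->
  exists e, cv (fun n => X (e n)) phi /\
    cv (fun n => form_app A (X (e n))) (form_app A phi).
Proof.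
move=> s /(form_app_ker s)[g [Kg -> ->]].
have [|k [e [he ke _]]] := bounded_functional_range (phi := C g) (spC s) (nsq_ge0 g).
  move=> f; rewrite -(spC s).1 mulrC; exact: rdot_CS.
have kg : k = g.
  apply: (ker_orth_inj s) => //; apply: ker_orth_cv he => n; exact: (ker_orth_ran s).
rewrite kg in he; exists e; split.
  have := effect_cv (spC s) he; congr (cv _ _); apply/funext => n; exact: spCC s _.
have := effect_cv (spD s) he; congr (cv _ _); apply/funext => n.
by rewrite -(spCC s) (form_appE s) //; exact: (ker_orth_ran s).
Qed.

End Forms.

(** * Form sums and means *)

Section FormSum.
Context {R : realType} {H : hilbertType R}.
Implicit Types (x y z f g h phi psi : H) (A B E : lrel H) (X Y C D : {linear H -> H}).

Lemma rdotZc (a : R[i]) x y : rdot (a *: x) y = rdot x (conjc a *: y).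
Proof.
rewrite /rdot linearZl_LR linearZr_LR /=.
change (complex.Re (a * inner x y) = complex.Re (conjc (conjc a) * inner x y)).
by rewrite conjcK.
Qed.

Lemma cauchy_of_cv (u : nat -> H) l : cv u l -> forall r : R, 0 < r ->
  exists K, forall n m, (K <= n)%N -> (K <= m)%N -> nsq (u n - u m) < r.
Proof.
move=> hu r r0; have [|N hN] := hu (r / 4); first by rewrite divr_gt0.
exists N => n m /hN h1 /hN h2; apply: le_lt_trans (nsq_tri (u n) l (u m)) _.
by rewrite (nsq_comm l); lra.
Qed.

Lemma form_appB A x y : nonneg_selfadjoint A -> lr_form_dom A x -> lr_form_dom A y ->
  form_app A (x - y) = form_app A x - form_app A y.
Proof.
move=> nA dx dy; rewrite addrC -scaleN1r form_appP //.
by rewrite scaleN1r addrC.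
Qed.

Lemma form_app0 A : nonneg_selfadjoint A -> form_app A 0 = 0.
Proof.
move=> nA; have d0 : lr_form_dom A 0 by case: (form_dom_sub nA).
by have := form_appB nA d0 d0; rewrite !subrr.
Qed.

Lemma form_appZ A (a : R[i]) x : nonneg_selfadjoint A -> lr_form_dom A x ->
  form_app A (a *: x) = a *: form_app A x.
Proof.
move=> nA dx; have d0 : lr_form_dom A 0 by case: (form_dom_sub nA).
by rewrite -[a *: x]addr0 form_appP // form_app0 // addr0.
Qed.

Section Sum.
Variables (A B : lrel H) (c : R).
Hypothesis nA : nonneg_selfadjoint A.
Hypothesis nB : nonneg_selfadjoint B.
Hypothesis c0 : 0 < c.

Let Dm : set H := [set x | lr_form_dom A x /\ lr_form_dom B x].
Let N x y := c * (form A x y + form B x y) + rdot x y.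

Let Dsub : subspace Dm.
Proof.
have sA := form_dom_sub nA; have sB := form_dom_sub nB.
split; first by split; [exact: sA.1|exact: sB.1].
by move=> a x y [xa xb] [ya yb]; split; [exact: sA.2|exact: sB.2].
Qed.

Let Npsd : psd_form Dm N.
Proof.
split; first exact: subspace_real Dsub.
- by move=> x y _ _; rewrite /N /form (rdotC (form_app A x)) (rdotC (form_app B x)) (rdotC x).
- move=> a x y z [xa xb] [ya yb] _; rewrite /N /form !form_appP // !rdE; ring.
- move=> x _; apply: addr_ge0; last exact: nsq_ge0.
  by rewrite mulr_ge0 ?(ltW c0) // addr_ge0 // nsq_ge0.
Qed.

Let Nsub x y : Dm x -> Dm y -> N (x - y) (x - y) =
  c * (nsq (form_app A x - form_app A y) + nsq (form_app B x - form_app B y)) + nsq (x - y).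
Proof. by move=> [xa xb] [ya yb]; rewrite /N /form !form_appB. Qed.

Let Ncauchy (e : nat -> H) : (forall n, Dm (e n)) ->
  (forall r : R, 0 < r -> exists K, forall n m, (K <= n)%N -> (K <= m)%N ->
     N (e n - e m) (e n - e m) < r) ->
  exists u, [/\ Dm u, cv e u, cv (fun n => form_app A (e n)) (form_app A u) &
    cv (fun n => form_app B (e n)) (form_app B u)].
Proof.
move=> De ce.
have cau (F : H -> H) (k : R) : 0 < k ->
    (forall n m, k * nsq (F (e n) - F (e m)) <= N (e n - e m) (e n - e m)) ->
    exists l, cv (fun n => F (e n)) l.
  move=> k0 hk; apply: cauchy_cv => r r0.
  have [|K hK] := ce (k * r); first exact: mulr_gt0.
  exists K => n m Kn Km; rewrite -(ltr_pM2l k0).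
  exact: le_lt_trans (hk n m) (hK n m Kn Km).
have pos x y : 0 <= c * nsq (x - y) by rewrite mulr_ge0 ?nsq_ge0 ?(ltW c0).
have [||u hu] := cau id 1 => // [n m|].
  by rewrite Nsub // mul1r lerDr mulrDr addr_ge0.
have [|a ha] := cau (form_app A) c c0.
  by move=> n m; rewrite Nsub // mulrDr -addrA lerDl addr_ge0 ?nsq_ge0.
have [|b hb] := cau (form_app B) c c0.
  by move=> n m; rewrite Nsub // mulrDr addrAC lerDr addr_ge0 ?nsq_ge0.
have [da ea] := form_app_closed nA (fun n => (De n).1) hu ha.
have [db eb] := form_app_closed nB (fun n => (De n).2) hu hb.
by exists u; rewrite ea eb; split.
Qed.

Let Nriesz f : exists2 u, Dm u & forall x, Dm x -> N u x = rdot f x.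
Proof.
apply: riesz_closed Npsd _ _.
  by move=> x _; rewrite lerDr mulr_ge0 ?(ltW c0) // addr_ge0 // nsq_ge0.
move=> e De ce; have [u [Du hu ha hb]] := Ncauchy De ce.
exists u => // r r0; pose d := r / (2 * c + 2).
have cp : 0 < 2 * c + 2 by rewrite addr_gt0 ?mulr_gt0.
have d0 : 0 < d by rewrite divr_gt0.
have [k1 h1] := hu d d0; have [k2 h2] := ha d d0; have [k3 h3] := hb d d0.
exists (maxn k1 (maxn k2 k3)) => n; rewrite !geq_max => /and3P[n1 n2 n3].
rewrite Nsub //; have := h1 n n1; have := h2 n n2; have := h3 n n3.
have -> : r = d * (2 * c + 2) by rewrite divfK ?lt0r_neq0.
clearbody d.
move: (nsq _) (nsq _) (nsq _) => p q s hp hq hs.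
have e1 : c * s < c * d by rewrite ltr_pM2l.
have e2 : c * q < c * d by rewrite ltr_pM2l.
lra.
Qed.

(** The resolvent X is the Riesz solution operator of N (X f, x) = (f, x). Its kernel, nonzero when
    the common domain is not dense, becomes mul E. The factor c serves two purposes: c = 1 gives the
    form sum, and c = 1/4 with equal forms gives the scaling by 1/2. *)
Lemma form_sum_exists : exists E, [/\ nonneg_selfadjoint E,
  (forall phi, lr_form_dom E phi <-> lr_form_dom A phi /\ lr_form_dom B phi) &
  forall phi psi, lr_form_dom E phi -> lr_form_dom E psi ->
    form E phi psi = c * (form A phi psi + form B phi psi)].
Proof.
have /choice[u hu] f : exists u, Dm u /\ forall x, Dm x -> N u x = rdot f x.
  by have [u Du hu] := Nriesz f; exists u.
have uniq x y : Dm x -> Dm y -> (forall z, Dm z -> N x z = N y z) -> x = y.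
  move=> Dx Dy h; apply/eqP; rewrite -subr_eq0; apply/eqP/nsq_eq0.
  have Dd : Dm (x - y) by exact: subspaceB Dsub Dx Dy.
  have : N (x - y) (x - y) = 0.
    have [_ _ lN _] := Npsd; have := lN (-1) _ _ _ Dy Dx Dd.
    by rewrite rmorphN1 scaleN1r (addrC (- y)) h // mulN1r addNr.
  rewrite Nsub // => e; apply/eqP; rewrite eq_le nsq_ge0 andbT -e lerDr.
  by rewrite mulr_ge0 ?(ltW c0) // addr_ge0 // nsq_ge0.
have [X hX] : exists X : {linear H -> H}, forall x, X x = u x.
  apply: linear_exists => a f g; apply: uniq; [exact: (hu _).1|apply: Dsub.2; exact: (hu _).1|].
  move=> x Dx; rewrite (hu _).2 // !rdE rdotZc.
  have Dcx : Dm (conjc a *: x) by exact: subspaceZ.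
  have [[fa fb] hf] := hu f; have [[ga gb] hg] := hu g; have [xa xb] := Dx.
  rewrite -(hf _ Dcx) -(hg _ Dx) /N /form !form_appP // !form_appZ // !rdE !rdotZc; ring.
have [XD XN] : (forall f, Dm (X f)) /\ forall f x, Dm x -> N (X f) x = rdot f x.
  by split=> [f|f x Dx]; rewrite hX; [exact: (hu f).1|exact: (hu f).2].
have [_ sN _ pN] := Npsd.
have Nbig x : nsq x <= N x x.
  by rewrite lerDr mulr_ge0 ?(ltW c0) // addr_ge0 // nsq_ge0.
have eX : effect X.
  split=> [f g|f]; first by rewrite rdotC -(XN g) // sN // XN.
  have h := Nbig (X f); rewrite XN // in h; rewrite rdotC; apply/andP; split.
    exact: le_trans (nsq_ge0 _) h.
  have := young f (X f); lra.
have [E EE] : exists E, E = of_resolvent X by exists (of_resolvent X).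
have nE : nonneg_selfadjoint E by rewrite EE; exact: rel_nsa.
have [X' [C [D s]]] := nsa_spectral nE.
have XX' f : X' f = X f.
  have := rel_mem X f; rewrite -EE (spE s) /of_resolvent /= => ->.
  by rewrite subrKC.
have eE f psi : lr_form_dom E psi -> form E (X f) psi + rdot (X f) psi = rdot f psi.
  have h : E (X f, f - X f) by rewrite EE; exact: rel_mem.
  by move=> /((mem_formE s _ _).1 h).2 ->; rewrite !rdE subrK.
have XE f : lr_form_dom E (X f).
  by have h : E (X f, f - X f) by [rewrite EE; exact: rel_mem]; exact: ((mem_formE s _ _).1 h).1.
(* On ran X the form norms of E and N coincide, so a sequence converging in the first is Cauchy in
   the second, and closedness of the forms of A and B identifies the limits. *)
have core phi : lr_form_dom E phi -> exists e, [/\ Dm phi, cv (fun n => X (e n)) phi,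
    cv (fun n => form_app A (X (e n))) (form_app A phi),
    cv (fun n => form_app B (X (e n))) (form_app B phi) &
    cv (fun n => form_app E (X (e n))) (form_app E phi)].
  move=> /(form_core s)[e [h1 h2]].
  have XXe : (fun n => X' (e n)) = (fun n => X (e n)) by apply/funext => n; rewrite XX'.
  have {}h2 : cv (fun n => form_app E (X (e n))) (form_app E phi).
    by move: h2; congr cv; apply/funext => n; rewrite XX'.
  rewrite XXe in h1.
  have [|v [Dv v1 v2 v3]] := Ncauchy (fun n => XD (e n)).
    move=> r r0; have r2 : 0 < r / 2 by rewrite divr_gt0.
    have [k1 c1] := cauchy_of_cv h1 r2; have [k2 c2] := cauchy_of_cv h2 r2.
    exists (maxn k1 k2) => n m; rewrite !geq_max => /andP[n1 n2] /andP[m1 m2].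
    have := c1 n m n1 m1; have := c2 n m n2 m2; rewrite -form_appB //.
    rewrite -linearB XN; last by rewrite linearB; exact: subspaceB Dsub (XD _) (XD _).
    by rewrite -eE // /form -!/(nsq _); lra.
  have vphi : v = phi by exact: cv_unique v1 h1.
  by exists e; rewrite -vphi; split=> //; rewrite vphi.
exists E; split=> //.
- move=> phi; split=> [/core[e []] //|Dx].
  apply/(form_domE s).
  (* Cauchy-Schwarz for N gives (f, phi)^2 = N (X f, phi)^2 <= |C f|^2 N (phi, phi), the hypothesis
     of the range criterion. *)
  have [||k [e [_ <- _]]] := @bounded_functional_range _ H C phi (N phi phi) (spC s).
  + exact: pN.
  + move=> f; rewrite -(XN f) // mulrC; apply: le_trans (psd_form_CS Npsd (XD f) Dx) _.
    rewrite ler_wpM2r ?pN // XN // /nsq (spC s).1 (spCC s) XX'; exact: lexx.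
  by exists k.
move=> phi psi /core[e [_ p1 p2 p3 p4]] /core[e' [_ q1 q2 q3 q4]].
suff : form E phi psi + rdot phi psi = N phi psi by rewrite /N => /addIr.
have h1 : (fun n => form E (X (e n)) (X (e' n)) + rdot (X (e n)) (X (e' n))) @ \oo -->
    form E phi psi + rdot phi psi.
  by apply: cvgD; exact: cv_rdot.
have h2 : (fun n => N (X (e n)) (X (e' n))) @ \oo --> N phi psi.
  apply: cvgD; last exact: cv_rdot.
  by apply: cvgM; [exact: cvg_cst|apply: cvgD; exact: cv_rdot].
by apply: (cvR_eq h1 h2) => n; rewrite XN // eE.
Qed.
End Sum.
End FormSum.

(** * Means, the iteration and monotone resolvent limits *)

Section Means.
Context {R : realType} {H : hilbertType R}.
Implicit Types (x y z f g h phi psi : H) (A B E F : lrel H) (X Y C D : {linear H -> H}).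

Lemma lr_form_le_refl A : lr_form_le A A.
Proof. by split. Qed.

Lemma lr_form_le_trans A B E : lr_form_le A B -> lr_form_le B E -> lr_form_le A E.
Proof.
move=> /lr_form_leE h1 /lr_form_leE h2; apply/lr_form_leE => phi /h2[/h1[d1 l1] l2].
by split=> //; exact: le_trans l1 l2.
Qed.

Lemma form_eq_nsa A B : nonneg_selfadjoint A -> nonneg_selfadjoint B ->
  (forall phi, lr_form_dom A phi <-> lr_form_dom B phi) ->
  (forall phi, lr_form_dom A phi -> formq A phi = formq B phi) -> A = B.
Proof.
move=> nA nB hd hf; apply: lr_form_le_anti => //; apply/lr_form_leE => phi.
  by move=> /hd d; split=> //; rewrite hf.
by move=> d; split; [exact/hd|rewrite hf].
Qed.

Lemma lr_form_sumP A B : nonneg_selfadjoint A -> nonneg_selfadjoint B ->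
  [/\ nonneg_selfadjoint (lr_form_sum A B),
   (forall phi, lr_form_dom (lr_form_sum A B) phi <->
      lr_form_dom A phi /\ lr_form_dom B phi) &
   forall phi psi, lr_form_dom (lr_form_sum A B) phi ->
     lr_form_dom (lr_form_sum A B) psi ->
     form (lr_form_sum A B) phi psi = form A phi psi + form B phi psi].
Proof.
move=> nA nB; have [E [nE dE fE]] := form_sum_exists nA nB ltr01.
suff -> : lr_form_sum A B = E by split=> // phi psi d1 d2; rewrite fE // mul1r.
have hE : [/\ nonneg_selfadjoint E, lr_form_dom E = lr_form_dom A `&` lr_form_dom B &
    forall phi, (lr_form_dom A `&` lr_form_dom B) phi ->
      lr_form E phi = lr_form A phi + lr_form B phi].
  split=> //; first by apply/seteqP; split=> phi /dE.
  move=> phi dphi; rewrite !lr_formE -rmorphD /=; congr (_%:C).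
  by rewrite /formq fE ?mul1r //; exact/dE.
apply: xget_unique => // F [nF dF fF].
apply: form_eq_nsa => // phi; rewrite dF; first by rewrite (dE phi).
move=> dphi; have [_ _ fE'] := hE; have := fF phi dphi.
by rewrite -(fE' phi dphi) !lr_formE => -[].
Qed.

Lemma rscale_half E : nonneg_selfadjoint E ->
  [/\ nonneg_selfadjoint (rscale 2^-1 E),
   (forall phi, lr_form_dom (rscale 2^-1 E) phi <-> lr_form_dom E phi) &
   forall phi psi, lr_form_dom E phi -> lr_form_dom E psi ->
     form (rscale 2^-1 E) phi psi = 2^-1 * form E phi psi].
Proof.
move=> nE; have c0 : 0 < (4^-1 : R) by rewrite invr_gt0.
have [F [nF dF fF]] := form_sum_exists nE nE c0.
have {}dF phi : lr_form_dom F phi <-> lr_form_dom E phi.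
  by rewrite dF; split=> [[]|].
have {}fF phi psi : lr_form_dom E phi -> lr_form_dom E psi ->
     form F phi psi = 2^-1 * form E phi psi.
  by move=> /dF d1 /dF d2; rewrite fF //; field.
suff -> : rscale 2^-1 E = F by [].
have [X [C [D s]]] := nsa_spectral nE; have [X' [C' [D' s']]] := nsa_spectral nF.
have c2 : (2^-1 : R[i]) = (2^-1 : R)%:C by rewrite fmorphV rmorph_nat.
apply/seteqP; split=> [_ [[f f'] Ef ->]|[f f'] Ff] /=.
  have [df hf] := (mem_formE s _ _).1 Ef.
  apply/(mem_formE s'); split; first exact/dF.
  by move=> psi /dF dp; rewrite fF // hf // c2 rdotZl.
exists (f, 2 *: f'); last by rewrite /= scalerA mulVf ?scale1r // pnatr_eq0.
have [df hf] := (mem_formE s' _ _).1 Ff.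
apply/(mem_formE s); split; first exact/dF.
move=> psi dp; have := hf psi ((dF psi).2 dp); rewrite fF //; last exact/dF.
have -> : (2 : R[i]) = (2 : R)%:C by rewrite rmorph_nat.
by rewrite rdotZl => <-; rewrite mulrA divff ?mul1r // pnatr_eq0.
Qed.

Lemma lr_arithmetic_meanP A B : nonneg_selfadjoint A -> nonneg_selfadjoint B ->
  [/\ nonneg_selfadjoint (lr_arithmetic_mean A B),
   (forall phi, lr_form_dom (lr_arithmetic_mean A B) phi <->
      lr_form_dom A phi /\ lr_form_dom B phi) &
   forall phi psi, lr_form_dom (lr_arithmetic_mean A B) phi ->
     lr_form_dom (lr_arithmetic_mean A B) psi ->
     form (lr_arithmetic_mean A B) phi psi = 2^-1 * (form A phi psi + form B phi psi)].
Proof.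
move=> nA nB; have [nS dS fS] := lr_form_sumP nA nB.
have [nM dM fM] := rscale_half nS.
split=> // [phi|phi psi /dM d1 /dM d2]; first by rewrite dM dS.
by rewrite fM // fS.
Qed.

Lemma lr_arithmetic_meanC A B : lr_arithmetic_mean A B = lr_arithmetic_mean B A.
Proof.
rewrite /lr_arithmetic_mean /lr_form_sum setIC; congr (rscale _ (relation_of_form _ _)).
by apply/funext => phi; rewrite addrC.
Qed.

Lemma rinv_harmonic A B :
  rinv (lr_harmonic_mean A B) = lr_arithmetic_mean (rinv A) (rinv B).
Proof. exact: rinvK. Qed.

Lemma rinv_arithmetic A B :
  rinv (lr_arithmetic_mean A B) = lr_harmonic_mean (rinv A) (rinv B).
Proof. by rewrite /lr_harmonic_mean !rinvK. Qed.

Lemma lr_harmonic_mean_nsa A B : nonneg_selfadjoint A -> nonneg_selfadjoint B ->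
  nonneg_selfadjoint (lr_harmonic_mean A B).
Proof.
move=> nA nB; apply: nsa_rinv.
by have [] := lr_arithmetic_meanP (nsa_rinv nA) (nsa_rinv nB).
Qed.

Lemma harmonic_le_arithmetic A B : nonneg_selfadjoint A -> nonneg_selfadjoint B ->
  lr_form_le (lr_harmonic_mean A B) (lr_arithmetic_mean A B).
Proof.
move=> nA nB; have [nM dM fM] := lr_arithmetic_meanP nA nB.
have [nI dI fI] := lr_arithmetic_meanP (nsa_rinv nA) (nsa_rinv nB).
apply/lr_form_leE => phi dphi; have [da db] := (dM phi).1 dphi.
apply: form_conj; first exact: lr_harmonic_mean_nsa.
rewrite rinv_harmonic => psi dpsi; have [da' db'] := (dI psi).1 dpsi.
rewrite /formq fM // fI //; have := form_young nA da da'; have := form_young nB db db'.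
rewrite /formq; lra.
Qed.

Lemma arithmetic_le_left A B : nonneg_selfadjoint A -> nonneg_selfadjoint B ->
  lr_form_le B A -> lr_form_le (lr_arithmetic_mean A B) A.
Proof.
move=> nA nB /lr_form_leE h; have [nM dM fM] := lr_arithmetic_meanP nA nB.
apply/lr_form_leE => phi dA; have [dB le] := h _ dA.
have dphi : lr_form_dom (lr_arithmetic_mean A B) phi by apply/dM.
by split=> //; rewrite {1}/formq fM //; move: le; rewrite /formq; lra.
Qed.

Definition agm_seq (A_ B_ : nat -> lrel H) :=
  [/\ nonneg_selfadjoint (A_ 0%N), nonneg_selfadjoint (B_ 0%N),
   (forall n, A_ n.+1 = lr_arithmetic_mean (A_ n) (B_ n)) &
   forall n, B_ n.+1 = lr_harmonic_mean (A_ n) (B_ n)].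

Lemma agm_seq_inv (A_ B_ : nat -> lrel H) : agm_seq A_ B_ -> agm_seq (rinv \o B_) (rinv \o A_).
Proof.
move=> [nA nB hA hB]; split=> [||n|n] /=; [exact: nsa_rinv|exact: nsa_rinv| |].
  by rewrite hB rinv_harmonic lr_arithmetic_meanC.
by rewrite hA rinv_arithmetic /lr_harmonic_mean -!/(lr_arithmetic_mean _ _) lr_arithmetic_meanC.
Qed.

Section Sequence.
Variables A_ B_ : nat -> lrel H.
Hypothesis agm : agm_seq A_ B_.

Lemma agm_nsa n : nonneg_selfadjoint (A_ n) /\ nonneg_selfadjoint (B_ n).
Proof.
have [nA nB hA hB] := agm; elim: n => [//|n [iA iB]]; rewrite hA hB; split.
  by have [] := lr_arithmetic_meanP iA iB.
exact: lr_harmonic_mean_nsa.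
Qed.

(** A harmonic mean lies below the arithmetic mean of the same pair; nothing of the kind holds
    between A_0 and B_0. *)
Lemma agm_le n : lr_form_le (B_ n.+1) (A_ n.+1).
Proof.
have [_ _ hA hB] := agm; have [nA nB] := agm_nsa n.
by rewrite hA hB; exact: harmonic_le_arithmetic.
Qed.

Lemma agm_decr n : lr_form_le (A_ n.+2) (A_ n.+1).
Proof.
have [_ _ hA _] := agm; have [nA nB] := agm_nsa n.+1.
by rewrite hA; apply: arithmetic_le_left => //; exact: agm_le.
Qed.

End Sequence.

Lemma agm_incr (A_ B_ : nat -> lrel H) n : agm_seq A_ B_ -> lr_form_le (B_ n.+1) (B_ n.+2).
Proof.
move=> agm; have := agm_decr (agm_seq_inv agm) n.
have n1 := (agm_nsa agm n.+1).2; have n2 := (agm_nsa agm n.+2).2.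
by move=> /(lr_form_le_inv (nsa_rinv n2) (nsa_rinv n1)); rewrite /= !rinvK.
Qed.

Lemma lr_form_le_incr (E_ : nat -> lrel H) : (forall n, lr_form_le (E_ n.+1) (E_ n.+2)) ->
  forall m n, (0 < m <= n)%N -> lr_form_le (E_ m) (E_ n).
Proof.
move=> h m n /andP[m0 mn]; rewrite -(subnKC mn).
elim: (n - m)%N => [|k IH]; first by rewrite addn0; exact: lr_form_le_refl.
apply: lr_form_le_trans IH _; rewrite addnS.
by case: m m0 mn => // m _ _; rewrite addSn; exact: h.
Qed.

Lemma lr_form_le_decr (E_ : nat -> lrel H) : (forall n, lr_form_le (E_ n.+2) (E_ n.+1)) ->
  forall m n, (0 < m <= n)%N -> lr_form_le (E_ n) (E_ m).
Proof.
move=> h m n /andP[m0 mn]; rewrite -(subnKC mn).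
elim: (n - m)%N => [|k IH]; first by rewrite addn0; exact: lr_form_le_refl.
apply: lr_form_le_trans _ IH; rewrite addnS.
by case: m m0 mn => // m _ _; rewrite addSn; exact: h.
Qed.

Lemma resolventE A X C D f : spectral_pair A X C D -> rapp (resolvent A) f = X f.
Proof. by move=> s; rewrite (spE s) resolvent_rel. Qed.

(** The least upper bound clause is what later gives B_oo <= A_oo and the maximality of the
    geometric mean. *)
Lemma increasing_resolvent_limit (E_ : nat -> lrel H) :
  (forall n, nonneg_selfadjoint (E_ n)) -> (forall n, lr_form_le (E_ n.+1) (E_ n.+2)) ->
  exists E, [/\ nonneg_selfadjoint E, strong_resolvent_cvg E_ E,
    (forall n, lr_form_le (E_ n.+1) E) &
    forall F, nonneg_selfadjoint F -> (forall n, lr_form_le (E_ n.+1) F) -> lr_form_le E F].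
Proof.
move=> nE incr.
have /choice[X_ hX] (n : nat) : exists X : {linear H -> H},
    exists C D, spectral_pair (E_ n.+1) X C D.
  exact: nsa_spectral.
have eX n : effect (X_ n) by have [C [D s]] := hX n; exact: spX s.
have [||X [pX cX lX]] := @decreasing_psd_cvg _ H X_ 1 (fun n => effect_psd (eX n)) ler01.
- by move=> x; rewrite mul1r; case/andP: ((eX 0%N).2 x).
- move=> n x; have [C1 [D1 s1]] := hX n; have [C2 [D2 s2]] := hX n.+1.
  exact: (lr_form_le_resolvent s1 s2).1 (incr n) x.
have eXX : effect X.
  split=> [|x]; first exact: pX.1.
  rewrite pX.2 /=; apply: le_trans (lX 0%N x) _; by case/andP: ((eX 0%N).2 x).
have [X' [C [D s]]] := nsa_spectral (rel_nsa eXX).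
have XX' f : X' f = X f.
  have := rel_mem X f; rewrite (spE s) /of_resolvent /= => ->.
  by rewrite subrKC.
exists (of_resolvent X); split.
- exact: rel_nsa.
- move=> f; rewrite (resolventE f s) XX'; apply/cvP => e /(cX f)[N hN].
  (* [X_ n] is the resolvent of [E_ n.+1], hence the shift by one. *)
  exists N.+1 => -[//|n] Nn; have [C1 [D1 s1]] := hX n.
  by rewrite (resolventE f s1); exact: hN.
- move=> n; have [C1 [D1 s1]] := hX n; apply/(lr_form_le_resolvent s1 s) => f.
  by rewrite XX'; exact: lX.
move=> F nF hF; have [XF [CF [DF sF]]] := nsa_spectral nF.
apply/(lr_form_le_resolvent s sF) => f; rewrite XX'.
apply: (cvR_le (cvg_cst (rdot (XF f) f)) (cv_rdot (cX f) (cv_cst f))) => n.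
by have [C1 [D1 s1]] := hX n; exact: (lr_form_le_resolvent s1 sF).1 (hF n) f.
Qed.

Lemma resolvent_rinv A f : nonneg_selfadjoint A ->
  rapp (resolvent (rinv A)) f = f - rapp (resolvent A) f.
Proof.
move=> /nsa_spectral[X [C [D s]]]; have [Y hY s'] := spectral_inv s.
by rewrite (resolventE f s) (resolventE f s') hY.
Qed.

Lemma strong_resolvent_cvg_inv (E_ : nat -> lrel H) E :
  (forall n, nonneg_selfadjoint (E_ n)) -> nonneg_selfadjoint E ->
  strong_resolvent_cvg E_ E -> strong_resolvent_cvg (rinv \o E_) (rinv E).
Proof.
move=> nE n0 h f; rewrite resolvent_rinv //; apply/cvP.
rewrite (_ : (fun n => _) = fun n => f - rapp (resolvent (E_ n)) f).
  by apply: cvB; [exact: cv_cst|exact/cvP].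
by apply/funext => n; rewrite /= resolvent_rinv.
Qed.

End Means.

(** * Limits of the iteration *)

Section Limits.
Context {R : realType} {H : hilbertType R}.
Implicit Types (x y z f g h phi psi : H) (A B E F : lrel H) (X Y C D : {linear H -> H}).

Lemma form_app_cv_le A B (e : nat -> H) phi : nonneg_selfadjoint A -> nonneg_selfadjoint B ->
  lr_form_le B A -> (forall n, lr_form_dom A (e n)) -> lr_form_dom A phi ->
  cv (fun n => form_app A (e n)) (form_app A phi) ->
  cv (fun n => form_app B (e n)) (form_app B phi).
Proof.
move=> nA nB /lr_form_leE le de dphi h r /h[N hN]; exists N => n /hN.
have [d1 _] := le _ (de n); have [d2 _] := le _ dphi.
rewrite -!form_appB //; apply: le_lt_trans.
by apply: (le _ _).2; exact: subspaceB (form_dom_sub nA) (de n) dphi.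
Qed.

Lemma formq_eq_cv A B (e : nat -> H) phi : nonneg_selfadjoint A -> nonneg_selfadjoint B ->
  lr_form_le B A -> (forall n, lr_form_dom A (e n)) -> lr_form_dom A phi ->
  cv (fun n => form_app A (e n)) (form_app A phi) ->
  (forall n, formq A (e n) = formq B (e n)) -> formq A phi = formq B phi.
Proof.
move=> nA nB le de dphi h he; apply: (cvR_eq (cv_nsq h) _ he).
exact: cv_nsq (form_app_cv_le nA nB le de dphi h).
Qed.

(** From index 1 on, B_n <= A_n puts D[A_n] inside D[B_n], so intersecting the domains changes
    nothing. *)
Lemma agm_form_dom (A_ B_ : nat -> lrel H) n phi : agm_seq A_ B_ ->
  lr_form_dom (A_ n.+1) phi <-> lr_form_dom (A_ 1%N) phi.
Proof.
move=> agm; have [_ _ hA _] := agm; elim: n => [//|n IH]; rewrite -IH hA.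
have [nA nB] := agm_nsa agm n.+1.
have [_ dM _] := lr_arithmetic_meanP nA nB.
rewrite dM; split=> [[]//|d]; split=> //.
exact: ((lr_form_leE _ _).1 (agm_le agm n) _ d).1.
Qed.

(** As B_n increases, A_{n+1} - B_{n+1} <= A_{n+1} - B_n = (A_n - B_n) / 2. *)
Lemma agm_gap (A_ B_ : nat -> lrel H) n phi : agm_seq A_ B_ -> lr_form_dom (A_ 1%N) phi ->
  formq (A_ n.+1) phi - formq (B_ n.+1) phi <=
    2^-1 ^+ n * (formq (A_ 1%N) phi - formq (B_ 1%N) phi).
Proof.
move=> agm dphi; have [_ _ hA _] := agm.
elim: n => [|n IH]; first by rewrite expr0 mul1r.
have d1 := (agm_form_dom n _ agm).2 dphi; have d2 := (agm_form_dom n.+1 _ agm).2 dphi.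
have [d3 h3] := (lr_form_leE _ _).1 (agm_incr n agm) phi
  ((lr_form_leE _ _).1 (agm_le agm n.+1) _ d2).1.
have [nA nB] := agm_nsa agm n.+1.
have [_ dM fM] := lr_arithmetic_meanP nA nB.
rewrite exprS -mulrA; rewrite {1}hA {1}/formq fM -?hA //.
move: IH h3; rewrite /formq; lra.
Qed.

Lemma cvg_half (a g : R) : (fun n => a + 2^-1 ^+ n * g) @ \oo --> a.
Proof.
rewrite -[X in _ --> X]addr0 -[X in _ --> _ + X](mul0r g).
apply: cvgD; first exact: cvg_cst.
apply: cvgM; last exact: cvg_cst.
by apply: cvg_expr; rewrite ger0_norm ?invr_ge0 // invf_lt1 // ltr1n.
Qed.

Lemma agm_limit_form (A_ B_ : nat -> lrel H) Ainf Binf : agm_seq A_ B_ ->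
  nonneg_selfadjoint Ainf -> nonneg_selfadjoint Binf ->
  strong_resolvent_cvg A_ Ainf -> (forall n, lr_form_le Ainf (A_ n.+1)) ->
  (forall n, lr_form_le (B_ n.+1) Binf) -> lr_form_le Binf Ainf ->
  forall phi, lr_form_dom Ainf phi -> formq Ainf phi = formq Binf phi.
Proof.
move=> agm nA nB cA leA leB leBA.
have [_ _ hA hB] := agm.
have nAn n := (agm_nsa agm n).1; have nBn n := (agm_nsa agm n).2.
have domA n phi := agm_form_dom n phi agm.
have gap n phi := @agm_gap _ _ n phi agm.
have eqD phi : lr_form_dom (A_ 1%N) phi -> formq Ainf phi = formq Binf phi.
  move=> dphi; have [dI hI] := (lr_form_leE _ _).1 (leA 0%N) _ dphi.
  have [dJ hJ] := (lr_form_leE _ _).1 leBA _ dI.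
  apply/eqP; rewrite eq_le hJ andbT.
  set g := formq (A_ 1%N) phi - formq (B_ 1%N) phi in gap.
  have lim := @cvg_half (formq Binf phi) g.
  apply: (cvR_le (cvg_cst (formq Ainf phi)) lim) => n.
  have := ((lr_form_leE _ _).1 (leA n) _ ((domA n _).2 dphi)).2.
  have := ((lr_form_leE _ _).1 (leB n) _ dJ).2; have := gap n phi dphi.
  rewrite -/g; lra.
have /choice[X_ hX] (n : nat) : exists X : {linear H -> H},
    exists C D, spectral_pair (A_ n.+1) X C D.
  exact: nsa_spectral.
have [X [C [D s]]] := nsa_spectral nA.
have XE f : lr_form_dom Ainf (X f).
  by apply/(form_domE s); exists (C f); rewrite (spCC s).
have XnE n f : lr_form_dom (A_ 1%N) (X_ n f).
  have [C' [D' s']] := hX n; apply/(domA n)/(form_domE s').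
  by exists (C' f); rewrite (spCC s').
have XnI n f : lr_form_dom Ainf (X_ n f).
  exact: ((lr_form_leE _ _).1 (leA 0%N) _ (XnE n f)).1.
have cX f : cv (fun n => X_ n f) (X f).
  have /cvP h := cA f; have := cvS h; rewrite (resolventE f s); congr cv.
  by apply/funext => n; have [C' [D' s']] := hX n; rewrite (resolventE f s').
(* X_ n f converges to X f even in the form norm of Ainf, since
   |u|^2 + Ainf[u] <= ((X - X_ n) f, f) for u = X_ n f - X f. *)
have eqX f : formq Ainf (X f) = formq Binf (X f).
  apply: (formq_eq_cv (e := fun n => X_ n f)) => // [|n]; last exact: eqD.
  have key n : nsq (X_ n f - X f) + nsq (form_app Ainf (X_ n f) - form_app Ainf (X f)) <=
      rdot (X f - X_ n f) f.
    have [C' [D' s']] := hX n.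
    (* A_oo <= A_n together with A_n[X_n f] = (f - X_n f, X_n f); the cross terms come from (X f, f
       - X f) in A_oo. *)
    have h1 : formq Ainf (X_ n f) <= rdot (f - X_ n f) (X_ n f).
      have d1 := (domA n _).2 (XnE n f).
      apply: le_trans ((lr_form_leE _ _).1 (leA n) _ d1).2 _.
      have m : A_ n.+1 (X_ n f, f - X_ n f) by rewrite (spE s'); exact: rel_mem.
      by rewrite /formq ((mem_formE s' _ _).1 m).2.
    have m : Ainf (X f, f - X f) by rewrite (spE s); exact: rel_mem.
    have h2 := ((mem_formE s _ _).1 m).2 _ (XnI n f).
    have h3 := ((mem_formE s _ _).1 m).2 _ (XE f).
    move: h1 h2 h3; rewrite /formq /form -!/(nsq _) !nsqB /nsq !rdE.
    rewrite (rdotC (form_app Ainf (X f)) (form_app Ainf (X_ n f))).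
    rewrite (rdotC (X f) (X_ n f)) !(rdotC f); lra.
  have h0 : (fun n => rdot (X f - X_ n f) f) @ \oo --> rdot (X f - X f) f.
    exact: cv_rdot (cvB (cv_cst _) (cX f)) (cv_cst f).
  rewrite subrr rdot0l in h0; apply/cvE.
  apply: (squeeze_cvgr _ (cvg_cst 0) h0); apply: nearW => n; rewrite nsq_ge0 /=.
  by apply: le_trans (key n); rewrite lerDr nsq_ge0.
move=> phi dphi; have [e [_ he]] := form_core s dphi.
by apply: (formq_eq_cv (e := fun n => X (e n))).
Qed.

(** A_oo is obtained as the inverse of the limit of the increasing sequence A_n^-1, so only
    increasing limits are ever constructed. *)
Lemma agm_limits (A_ B_ : nat -> lrel H) : agm_seq A_ B_ ->
  exists Ainf Binf, [/\ nonneg_selfadjoint Ainf /\ strong_resolvent_cvg A_ Ainf,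
    nonneg_selfadjoint Binf /\ strong_resolvent_cvg B_ Binf,
    (forall n, lr_form_le Ainf (A_ n.+1)) /\ (forall n, lr_form_le (B_ n.+1) Binf),
    lr_form_le Binf Ainf &
    forall E, nonneg_selfadjoint E -> (forall n, lr_form_le (B_ n.+1) E) -> lr_form_le Binf E].
Proof.
move=> agm; have nAn n := (agm_nsa agm n).1; have nBn n := (agm_nsa agm n).2.
have [Binf [nB cB leB supB]] := increasing_resolvent_limit nBn (fun n => agm_incr n agm).
have agm' := agm_seq_inv agm.
have [F [nF cF leF supF]] := increasing_resolvent_limit (fun n => (agm_nsa agm' n).2)
  (fun n => agm_incr n agm').
exists (rinv F), Binf; split=> //.
- split; first exact: nsa_rinv.
  have := strong_resolvent_cvg_inv (fun n => (agm_nsa agm' n).2) nF cF.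
  by move=> h f; have := h f; rewrite /= /comp; under eq_fun do rewrite rinvK.
- split=> // n; have := lr_form_le_inv (nsa_rinv (nAn n.+1)) nF (leF n).
  by rewrite rinvK.
apply: supB; first exact: nsa_rinv.
move=> n; rewrite -(rinvK (B_ n.+1)); apply: lr_form_le_inv => //; first exact: nsa_rinv.
apply: supF; first exact: nsa_rinv.
move=> m; apply: lr_form_le_inv => //.
have mono1 := lr_form_le_incr (fun n => agm_incr n agm).
have mono2 := lr_form_le_decr (fun n => agm_decr agm n).
(* B and A are compared at unrelated indices by passing through the larger one. *)
apply: lr_form_le_trans (mono1 n.+1 (maxn n m).+1 _) _.
  by rewrite /= ltnS leq_maxl.
apply: lr_form_le_trans (agm_le agm _) (mono2 m.+1 (maxn n m).+1 _).
by rewrite /= ltnS leq_maxr.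
Qed.

End Limits.

(** * The bounded case *)

Section Everywhere.
Context {R : realType} {H : hilbertType R}.
Implicit Types (x y z f g h phi psi : H) (A B E F : lrel H) (C D : {linear H -> H}).

Definition form_total A := forall phi, lr_form_dom A phi.

Definition graph (Z : H -> H) : lrel H := [set p | p.2 = Z p.1].

Lemma total_op A : nonneg_selfadjoint A -> form_total A ->
  exists Z : {linear H -> H}, [/\ psd Z, A = graph Z &
    forall phi psi, form A phi psi = rdot (Z phi) psi].
Proof.
move=> nA tA; have [X [C [D s]]] := nsa_spectral nA.
(* As ran C is the whole space, C can be inverted twice: f = C g and g = C h give f = X h. *)
have dA f : exists f', A (f, f').
  have [g fE] := (form_domE s f).1 (tA f); have [h gE] := (form_domE s g).1 (tA g).
  exists (h - f); rewrite fE gE (spCC s) (spE s); exact: rel_mem.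
have uA f f' f'' : A (f, f') -> A (f, f'') -> f' = f''.
  move=> /(mem_formE s)[_ h'] /(mem_formE s)[_ h'']; apply: rdot_ext => z.
  by rewrite -h' ?h''.
have [Z0 hZ0] := choice dA.
have [Z hZ] : exists Z : {linear H -> H}, forall f, Z f = Z0 f.
  apply: linear_exists => a x y; apply: (uA (a *: x + y)) => //.
  by have [[_ _ lA] _ _] := nA; exact: (lA a _ _ (hZ0 x) (hZ0 y)).
have {hZ0} hZ0 f : A (f, Z f) by rewrite hZ.
have fE phi psi : form A phi psi = rdot (Z phi) psi.
  exact: ((mem_formE s _ _).1 (hZ0 phi)).2.
exists Z; split=> //.
  split=> [x y|x]; last by rewrite -fE; exact: formq_ge0.
  by rewrite -fE (rdotC x) -fE /form rdotC.
apply/seteqP; split=> [[f f'] Af|[f f']]; rewrite /graph /=; first exact: uA Af (hZ0 f).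
by move=> ->.
Qed.

Lemma graph_nsa (Z : {linear H -> H}) : psd Z -> bndop Z -> nonneg_selfadjoint (graph Z).
Proof.
move=> [sZ pZ] bZ.
have iZ f g : inner (Z f) g = inner f (Z g).
  by apply: inner_eq; rewrite -?linearZ sZ.
split.
- split.
  + apply/closedP => u v l m; rewrite /graph /= => h hu hv.
    apply: cv_unique hv _; have -> : v = (fun n => Z (u n)) by exact/funext.
    exact: bnd_cv.
  + by rewrite /graph /= linear0.
  + by move=> a p q; rewrite /graph /= linearP => -> ->.
- apply/seteqP; split=> [p hp|[u v] [_ _ /= h]].
    by split=> // q; move: hp; rewrite /graph /= => -> ->.
  rewrite /graph /=; apply: rdot_ext => z.
  have := h (z, Z z) erefl => /= /(congr1 (@complex.Re R)).
  by rewrite -!/(rdot _ _) sZ !(rdotC z) => ->.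
move=> [f f']; rewrite /graph /= => ->; apply: inner_ge0P => //.
have h := rdot_i f (Z f); have := sZ f ('i *: f); rewrite linearZ /=.
by rewrite (rdotC _ (Z f)) in h; lra.
Qed.

Lemma form_graph (Z : {linear H -> H}) : psd Z -> bndop Z ->
  form_total (graph Z) /\ forall phi psi, form (graph Z) phi psi = rdot (Z phi) psi.
Proof.
move=> pZ bZ; have [X [C [D s]]] := nsa_spectral (graph_nsa pZ bZ).
have h f : graph Z (f, Z f) by [].
have t : form_total (graph Z) by move=> f; exact: ((mem_formE s _ _).1 (h f)).1.
by split=> // phi psi; exact: ((mem_formE s _ _).1 (h phi)).2.
Qed.

Lemma psd_bndop (Z : {linear H -> H}) c : psd Z -> 0 <= c ->
  (forall x, rdot (Z x) x <= c * nsq x) -> bndop Z.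
Proof.
move=> pZ c0 hc; exists (c * c); first exact: mulr_ge0.
move=> x; apply: le_trans (psd_nsq x pZ c0 hc) _.
by rewrite -mulrA ler_wpM2l.
Qed.

Lemma rapp_graph (Z : H -> H) f : rapp (graph Z) f = Z f.
Proof. by apply: rapp_eq. Qed.

Lemma graph_mul0 (Z : {linear H -> H}) : rmul (graph Z) = [set 0].
Proof. by apply/seteqP; split=> m; rewrite /rmul /graph /= linear0. Qed.

Lemma graph_bounded (Z : {linear H -> H}) c : psd Z -> 0 <= c ->
  (forall x, rdot (Z x) x <= c * nsq x) -> bounded_nonneg_selfadjoint (graph Z).
Proof.
move=> pZ c0 hc; split.
- exact: graph_nsa pZ (psd_bndop pZ c0 hc).
- by apply/seteqP; split=> // f _; exists (Z f).
- exact: graph_mul0.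
exists c%:C => -[f f']; rewrite /graph /= => ->.
rewrite -ler_sqr ?nnegrE ?mulr_ge0 ?ler0c // exprMn !norm_nsq -rmorphXn -rmorphM /= lecR.
apply: le_trans (psd_nsq f pZ c0 hc) _.
by rewrite expr2 -mulrA ler_wpM2l.
Qed.

Lemma boundedP A : bounded_nonneg_selfadjoint A ->
  [/\ nonneg_selfadjoint A, form_total A & exists2 c : R, 0 <= c & forall phi, formq A phi <= c * nsq phi].
Proof.
move=> [nA dA mA [M hM]]; have [X [C [D s]]] := nsa_spectral nA.
have dA' f : exists f', A (f, f').
  by have : rdom A f by rewrite dA.
split=> //.
  by move=> f; have [f' Af] := dA' f; exact: ((mem_formE s _ _).1 Af).1.
pose m := complex.Re `|M|.
have ME : `|M| = m%:C by rewrite RRe_real // normr_real.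
have m0 : 0 <= m by rewrite -lecR -ME; exact: normr_ge0.
exists (m ^+ 2 + 1); first by rewrite addr_ge0 ?sqr_ge0.
move=> f; have [f' Af] := dA' f; have [df hf] := (mem_formE s _ _).1 Af.
rewrite /formq hf //.
have : nsq f' <= m ^+ 2 * nsq f.
  rewrite -lecR rmorphM rmorphXn /= -!norm_nsq -ME -exprMn ler_sqr ?nnegrE ?mulr_ge0 //.
  apply: le_trans (hM _ Af) _ => /=.
  have h0 : 0 <= M * `|f| by apply: le_trans (hM _ Af).
  by rewrite -[leLHS]ger0_norm // normrM normr_id.
by have := young f' f; have := nsq_ge0 f'; have := nsq_ge0 f; lra.
Qed.

Lemma rapp_rsqrt A phi : nonneg_selfadjoint A -> form_total A -> rapp (rsqrt A) phi = form_app A phi.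
Proof.
move=> nA tA; have [Z [_ AE _]] := total_op nA tA.
rewrite /form_app /rapp; congr (xget _ _); apply/seteqP; split=> f'; rewrite /rsqrt /=.
  by move=> [f'' [m [h]]]; rewrite AE graph_mul0 /= => -> ->; rewrite addr0 -AE.
by move=> h; exists f', 0; rewrite addr0 AE graph_mul0 -AE.
Qed.

(** The bound in Young's form, which is block positivity up to the sign of psi. Being linear in the
    two forms, it passes to averages and limits. *)
Definition gbound A B (w : H -> H) :=
  forall phi psi, 2 * rdot (w phi) psi <= formq A phi + formq B psi.

Lemma conj_mul (z : R[i]) : conjc z * z = (complex.Re z ^+ 2 + complex.Im z ^+ 2)%:C.
Proof. by case: z => a b; apply/eqP; rewrite eq_complex /=; apply/andP; split; apply/eqP; ring. Qed.

Lemma normc_sq (z : R[i]) : `|z| ^+ 2 = (complex.Re z ^+ 2 + complex.Im z ^+ 2)%:C.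
Proof. by rewrite normCK mulrC -conj_mul. Qed.

Lemma formqZ A (a : R[i]) phi : nonneg_selfadjoint A -> lr_form_dom A phi ->
  formq A (a *: phi) = (complex.Re a ^+ 2 + complex.Im a ^+ 2) * formq A phi.
Proof.
by move=> nA dA; rewrite /formq /form form_appZ // rdotZc scalerA conj_mul rdotZr.
Qed.

Lemma geometric_boundP A B (w : {linear H -> H}) : nonneg_selfadjoint A -> form_total A ->
  nonneg_selfadjoint B -> form_total B -> geometric_bound A B (graph w) <-> gbound A B w.
Proof.
move=> nA tA nB tB; split=> h phi psi.
  have h1 : rdot (w phi) psi ^+ 2 + complex.Im (inner (w phi) psi) ^+ 2 <=
      formq A phi * formq B psi.
    have := h phi psi; rewrite rapp_graph !rapp_rsqrt //.
    by rewrite -ler_sqr ?nnegrE ?mulr_ge0 // exprMn !norm_nsq normc_sq -rmorphM lecR.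
  have p0 := formq_ge0 A phi; have q0 := formq_ge0 B psi.
  move: (formq A phi) (formq B psi) (rdot _ _) (complex.Im _) p0 q0 h1 => p q r j p0 q0 h1.
  rewrite leNgt; apply/negP => h2.
  have : (p + q) ^+ 2 < (2 * r) ^+ 2 by rewrite ltr_sqr ?nnegrE; lra.
  have := sqr_ge0 (p - q); have := sqr_ge0 j; lra.
rewrite rapp_graph !rapp_rsqrt //.
rewrite -ler_sqr ?nnegrE ?mulr_ge0 // exprMn !norm_nsq normc_sq -rmorphM lecR.
set z := inner _ _; set n := _ + _.
have n0 : 0 <= n by rewrite addr_ge0 ?sqr_ge0.
(* Multiplying psi by z = (w phi, psi) makes the inner product the real number |z|^2 = n. The
   discriminant in the scaling of phi then gives the product bound with an extra factor n, which is
   cancelled. *)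
have zE : rdot (w phi) (z *: psi) = n.
  rewrite /rdot linearZr_LR /=.
  by change (complex.Re (conjc z * z) = n); rewrite conj_mul.
have : rdot (w phi) (z *: psi) ^+ 2 <= formq A phi * (n * formq B psi).
  apply: discr_le => [|t]; first exact: formq_ge0.
  have h1 := h (t%:C *: phi) (z *: psi).
  rewrite !formqZ //= expr0n addr0 -/n linearZ rdotZl in h1. lra.
rewrite zE -/(formq A phi) -/(formq B psi).
have [->|nn0] := eqVneq n 0; first by rewrite mulr_ge0 ?formq_ge0.
have np : 0 < n by rewrite lt_def nn0.
rewrite expr2 mulrCA ler_pM2l //.
Qed.
End Everywhere.

(** * Monotonicity of the means and the Riccati identity *)

Section GeometricMean.
Context {R : realType} {H : hilbertType R}.
Implicit Types (f g h phi psi : H) (A B E F : lrel H) (C D : {linear H -> H}).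

Lemma arithmetic_mono A B E F : nonneg_selfadjoint A -> nonneg_selfadjoint B ->
  nonneg_selfadjoint E -> nonneg_selfadjoint F -> lr_form_le A E -> lr_form_le B F ->
  lr_form_le (lr_arithmetic_mean A B) (lr_arithmetic_mean E F).
Proof.
move=> nA nB nE nF /lr_form_leE h1 /lr_form_leE h2.
have [nM dM fM] := lr_arithmetic_meanP nA nB.
have [nN dN fN] := lr_arithmetic_meanP nE nF.
apply/lr_form_leE => phi dphi; have [/h1[dA l1] /h2[dB l2]] := (dN phi).1 dphi.
have dm : lr_form_dom (lr_arithmetic_mean A B) phi by apply/dM.
by split=> //; move: l1 l2; rewrite /formq fM // fN //; lra.
Qed.

Lemma harmonic_mono A B E F : nonneg_selfadjoint A -> nonneg_selfadjoint B ->
  nonneg_selfadjoint E -> nonneg_selfadjoint F -> lr_form_le A E -> lr_form_le B F ->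
  lr_form_le (lr_harmonic_mean A B) (lr_harmonic_mean E F).
Proof.
move=> nA nB nE nF h1 h2; have nIA := nsa_rinv nA; have nIB := nsa_rinv nB.
have nIE := nsa_rinv nE; have nIF := nsa_rinv nF.
apply: lr_form_le_inv; [by have [] := lr_arithmetic_meanP nIE nIF|
  by have [] := lr_arithmetic_meanP nIA nIB|].
by apply: arithmetic_mono => //; exact: lr_form_le_inv.
Qed.

Lemma agm_mono (A_ B_ E_ F_ : nat -> lrel H) : agm_seq A_ B_ -> agm_seq E_ F_ ->
  lr_form_le (A_ 0%N) (E_ 0%N) -> lr_form_le (B_ 0%N) (F_ 0%N) ->
  forall n, lr_form_le (A_ n) (E_ n) /\ lr_form_le (B_ n) (F_ n).
Proof.
move=> a1 a2 hA hB; elim=> [//|n [i1 i2]].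
have [_ _ e1 e2] := a1; have [_ _ e3 e4] := a2.
have [? ?] := agm_nsa a1 n; have [? ?] := agm_nsa a2 n.
by rewrite e1 e2 e3 e4; split; [exact: arithmetic_mono|exact: harmonic_mono].
Qed.

Fixpoint agm_pair A B n : lrel H * lrel H :=
  if n is m.+1 then
    (lr_arithmetic_mean (agm_pair A B m).1 (agm_pair A B m).2,
     lr_harmonic_mean (agm_pair A B m).1 (agm_pair A B m).2)
  else (A, B).

Lemma agm_pairP A B : nonneg_selfadjoint A -> nonneg_selfadjoint B ->
  agm_seq (fun n => (agm_pair A B n).1) (fun n => (agm_pair A B n).2).
Proof. by []. Qed.

Section Bounded.
Variables A_ B_ : nat -> lrel H.
Hypothesis agm : agm_seq A_ B_.
Hypothesis tX : form_total (rinv (A_ 0%N)).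
Hypothesis tY : form_total (rinv (B_ 0%N)).

Let nA n : nonneg_selfadjoint (A_ n). Proof. exact: (agm_nsa agm n).1. Qed.
Let nB n : nonneg_selfadjoint (B_ n). Proof. exact: (agm_nsa agm n).2. Qed.
Let nX n : nonneg_selfadjoint (rinv (A_ n)). Proof. exact: nsa_rinv. Qed.
Let nY n : nonneg_selfadjoint (rinv (B_ n)). Proof. exact: nsa_rinv. Qed.

Let YE n : rinv (B_ n.+1) = lr_arithmetic_mean (rinv (A_ n)) (rinv (B_ n)).
Proof. by have [_ _ _ ->] := agm; exact: rinv_harmonic. Qed.

Lemma agm_total n : form_total (rinv (A_ n)) /\ form_total (rinv (B_ n)).
Proof.
elim: n => [//|n [i1 i2]].
have t2 : form_total (rinv (B_ n.+1)).
  rewrite YE => phi; have [_ dM _] := lr_arithmetic_meanP (nX n) (nY n).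
  by apply/dM; split; [exact: i1|exact: i2].
split=> // phi; have := lr_form_le_inv (nB n.+1) (nA n.+1) (agm_le agm n).
by move=> /lr_form_leE h; exact: (h phi (t2 phi)).1.
Qed.

Let tXn n : form_total (rinv (A_ n)). Proof. exact: (agm_total n).1. Qed.
Let tYn n : form_total (rinv (B_ n)). Proof. exact: (agm_total n).2. Qed.

Lemma form_agm_inv n phi psi : form (rinv (B_ n.+1)) phi psi =
  2^-1 * (form (rinv (A_ n)) phi psi + form (rinv (B_ n)) phi psi).
Proof.
have [_ _ fM] := lr_arithmetic_meanP (nX n) (nY n).
by rewrite YE fM // -YE; exact: tYn.
Qed.

(* The condition |(w phi, psi)| <= |X^{1/2} phi| |Y^{1/2} psi| is preserved by
   the iteration (X, Y) |-> (h(X, Y), (X + Y)/2). *)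
Lemma gbound_agm w : symm w -> gbound (rinv (A_ 0%N)) (rinv (B_ 0%N)) w ->
  forall n, gbound (rinv (A_ n)) (rinv (B_ n)) w.
Proof.
move=> sw h; elim=> [//|n IH] phi psi.
have swap x y : rdot (w x) y = rdot (w y) x by rewrite sw rdotC.
(* By conjugation the bound says A_n[w psi] <= Y_n[psi] and, w being symmetric, B_n[w psi] <=
   X_n[psi], where X_n = A_n^-1 and Y_n = B_n^-1. Their average is A_{n+1}[w psi] <=
   Y_{n+1}[psi]. *)
have [|dA lA] := @form_conj _ _ (A_ n) (w psi) (formq (rinv (B_ n)) psi) (nA n).
  by move=> x _; have := IH x psi; rewrite swap; lra.
have [|dB lB] := @form_conj _ _ (B_ n) (w psi) (formq (rinv (A_ n)) psi) (nB n).
  by move=> x _; have := IH psi x; lra.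
have [_ dM fM] := lr_arithmetic_meanP (nA n) (nB n).
have [_ _ eA _] := agm; rewrite -eA in dM fM.
have d : lr_form_dom (A_ n.+1) (w psi) by apply/dM.
have := form_young (nA n.+1) d (tXn n.+1 phi).
rewrite {1}/formq fM // swap /formq (form_agm_inv n psi psi).
move: lA lB; rewrite /formq; lra.
Qed.

(** On the diagonal the bound compares 2 w with A_n^-1 + B_n^-1 = 2 B_{n+1}^-1. *)
Lemma gbound_le_agm w n phi : symm w -> gbound (rinv (A_ 0%N)) (rinv (B_ 0%N)) w ->
  rdot (w phi) phi <= formq (rinv (B_ n.+1)) phi.
Proof.
move=> sw /(gbound_agm sw)/(_ n phi phi).
by rewrite /formq form_agm_inv; lra.
Qed.

(* If X = A^-1 and Y = B^-1 are invertible, (A Y_n phi, X_n psi) = (Y phi, psi)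
   for all n, so the limit w satisfies the Riccati equation w A w = Y. *)
Lemma agm_invertible (cA c : R) : form_total (A_ 0%N) -> form_total (B_ 0%N) ->
  0 <= cA -> (forall phi, formq (A_ 0%N) phi <= cA * nsq phi) ->
  0 <= c -> (forall phi, formq (rinv (B_ 1%N)) phi <= c * nsq phi) ->
  exists w : {linear H -> H}, [/\ psd w, gbound (rinv (A_ 0%N)) (rinv (B_ 0%N)) w,
    (forall phi, (fun n => formq (rinv (B_ n.+1)) phi) @ \oo --> rdot (w phi) phi) &
    forall n phi, rdot (w phi) phi <= formq (rinv (B_ n.+1)) phi].
Proof.
move=> tA0 tB0 cA0 hcA c0 hc; have [_ _ eA eB] := agm.
have tAB n : form_total (A_ n) /\ form_total (B_ n).
  elim: n => [//|n [i1 i2]].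
  have [_ dM _] := lr_arithmetic_meanP (nA n) (nB n); rewrite -eA in dM.
  have t1 : form_total (A_ n.+1) by move=> phi; apply/dM; split; [exact: i1|exact: i2].
  split=> // phi; exact: ((lr_form_leE _ _).1 (agm_le agm n) phi (t1 phi)).1.
have /choice[x hx] n : exists x : {linear H -> H}, [/\ psd x, rinv (A_ n) = graph x &
    forall phi psi, form (rinv (A_ n)) phi psi = rdot (x phi) psi].
  exact: total_op.
have /choice[y hy] n : exists x : {linear H -> H}, [/\ psd x, rinv (B_ n) = graph x &
    forall phi psi, form (rinv (B_ n)) phi psi = rdot (x phi) psi].
  exact: total_op.
have /choice[a ha] n : exists x : {linear H -> H}, [/\ psd x, A_ n = graph x &
    forall phi psi, form (A_ n) phi psi = rdot (x phi) psi].
  exact: (total_op (nA n) (tAB n).1).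
have /choice[b hb] n : exists x : {linear H -> H}, [/\ psd x, B_ n = graph x &
    forall phi psi, form (B_ n) phi psi = rdot (x phi) psi].
  exact: (total_op (nB n) (tAB n).2).
have px n : psd (x n) by case: (hx n).
have py n : psd (y n) by case: (hy n).
have pa n : psd (a n) by case: (ha n).
have fx n phi psi : form (rinv (A_ n)) phi psi = rdot (x n phi) psi by case: (hx n).
have fy n phi psi : form (rinv (B_ n)) phi psi = rdot (y n phi) psi by case: (hy n).
have fa n phi psi : form (A_ n) phi psi = rdot (a n phi) psi by case: (ha n).
have fb n phi psi : form (B_ n) phi psi = rdot (b n phi) psi by case: (hb n).
have xa n f : x n (a n f) = f.
  have [_ e _] := hx n; have [_ e' _] := ha n.
  have : rinv (A_ n) (a n f, f) by rewrite e'.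
  by rewrite e.
have yb n f : y n (b n f) = f.
  have [_ e _] := hy n; have [_ e' _] := hb n.
  have : rinv (B_ n) (b n f, f) by rewrite e'.
  by rewrite e.
have ax n f : a n (x n f) = f.
  have [_ e _] := hx n; have [_ e' _] := ha n.
  have : A_ n (x n f, f) by change (rinv (A_ n) (f, x n f)); rewrite e.
  by rewrite e'.
have yS n f : y n.+1 f = 2^-1%:C *: (x n f + y n f).
  by apply: rdot_ext => z; rewrite -fy form_agm_inv fx fy !rdE.
have aS n f : a n.+1 f = 2^-1%:C *: (a n f + b n f).
  apply: rdot_ext => z; rewrite -fa.
  have [_ dM fM] := lr_arithmetic_meanP (nA n) (nB n); rewrite -eA in dM fM.
  by rewrite fM ?fa ?fb ?rdE //; exact: (tAB n.+1).1.
have ric n phi psi : rdot (a 0%N (y n phi)) (x n psi) = rdot (y 0%N phi) psi.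
  elim: n phi psi => [|n IH] phi psi; first by rewrite (pa 0%N).1 ax.
  (* For u = X_{n+1} psi one has psi = (A_n u + B_n u) / 2. The induction hypothesis matches the X_n
     half of Y_{n+1} with B_n u and the Y_n half with A_n u. *)
  have u : psi = 2^-1%:C *: (a n (x n.+1 psi) + b n (x n.+1 psi)).
    by rewrite -aS ax.
  move: (x n.+1 psi) u => {psi}u ->.
  rewrite yS !linearZ !linearD /= !rdE.
  have e1 : rdot (a 0%N (x n phi)) u = rdot (y 0%N phi) (b n u).
    rewrite (pa 0%N).1 -{1}(yb n u) rdotC IH (py 0%N).1; exact: rdotC.
  have e2 : rdot (a 0%N (y n phi)) u = rdot (y 0%N phi) (a n u).
    by rewrite -{1}(xa n u) IH.
  by rewrite e1 e2; ring.
have agm' := agm_seq_inv agm.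
have dY n phi : rdot (y n.+2 phi) phi <= rdot (y n.+1 phi) phi.
  rewrite -!fy; apply: ((lr_form_leE _ _).1 _ phi (tYn n.+1 phi)).2.
  exact: agm_decr agm' n.
have [|w [pw cw lw]] := @decreasing_psd_cvg _ H (fun n => y n.+1) c (fun n => py n.+1) c0 _ dY.
  by move=> phi; rewrite -fy; exact: hc.
(* The gap Y_n - X_n is nonnegative and at most c, so [psd_nsq] turns its halving as a form into
   strong convergence to 0. *)
have cx phi : cv (fun n => x n.+1 phi) (w phi).
  have key n : nsq (y n.+1 phi - x n.+1 phi) <=
      0 + 2^-1 ^+ n * (c * (formq (rinv (B_ 1%N)) phi - formq (rinv (A_ 1%N)) phi)).
    have [Z hZ] : exists Z : {linear H -> H}, forall f, Z f = y n.+1 f - x n.+1 f.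
      by apply: linear_exists => t f g; rewrite !linearP scalerDr addrACA.
    have pZ : psd Z.
      split=> [f g|f]; first by rewrite !hZ !rdE (py n.+1).1 (px n.+1).1.
      rewrite hZ !rdE subr_ge0 -fx -fy.
      exact: ((lr_form_leE _ _).1 (agm_le agm' n) f (tYn n.+1 f)).2.
    have bZ f : rdot (Z f) f <= c * nsq f.
      rewrite hZ !rdE; apply: le_trans (hc f).
      have h1 := (px n.+1).2 f.
      have h2 : rdot (y n.+1 f) f <= formq (rinv (B_ 1%N)) f.
        rewrite -fy; apply: ((lr_form_leE _ _).1 _ f (tYn 1%N f)).2.
        by apply: (lr_form_le_decr (agm_decr agm')).
      lra.
    rewrite add0r mulrCA -hZ; apply: le_trans (psd_nsq phi pZ c0 bZ) _.
    rewrite ler_wpM2l // hZ !rdE -fx -fy.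
    exact: agm_gap agm' (tYn 1%N phi).
  have h0 : cv (fun n => y n.+1 phi - x n.+1 phi) 0.
    apply/cvE; apply: (squeeze_cvgr _ (cvg_cst 0) (@cvg_half R 0 _)); apply: nearW => n.
    by rewrite nsq_ge0 subr0; exact: key.
  have := cvB (cw phi) h0; rewrite subr0; congr cv.
  by apply/funext => n; rewrite subKr.
have ba : bndop (a 0%N).
  by apply: (psd_bndop (pa 0%N) cA0) => f; rewrite -fa; exact: hcA.
have ricw phi psi : rdot (a 0%N (w phi)) (w psi) = rdot (y 0%N phi) psi.
  apply: (cvR_eq (cv_rdot (bnd_cv ba (cw phi)) (cx psi)) (cvg_cst _)) => n.
  exact: ric.
exists w; split=> //.
(* The Riccati equation gives A[w psi] = Y[psi], so Young's inequality between w psi and phi is the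
   bound. *)
- move=> phi psi; have := form_young (nA 0%N) (tA0 (w psi)) (tX phi).
  have -> : rdot (w phi) psi = rdot (w psi) phi by rewrite pw.1 rdotC.
  by rewrite /formq fa ricw -fy; lra.
- move=> phi; rewrite (_ : (fun n => _) = (fun n => rdot (y n.+1 phi) phi)).
    exact: cv_rdot (cw phi) (cv_cst phi).
  by apply/funext => n; rewrite /formq fy.
by move=> n phi; rewrite /formq fy; exact: lw.
Qed.
End Bounded.
End GeometricMean.

(** * Regularisation and identification with the geometric mean *)

Section Perturbation.
Context {R : realType} {H : hilbertType R}.
Implicit Types (f g h phi psi : H) (A B E F : lrel H) (C D : {linear H -> H}).

Lemma lr_form_le_graph (Z W : {linear H -> H}) : psd Z -> bndop Z -> psd W -> bndop W ->
  (forall f, rdot (Z f) f <= rdot (W f) f) -> lr_form_le (graph Z) (graph W).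
Proof.
move=> pZ bZ pW bW h; have [t1 f1] := form_graph pZ bZ; have [t2 f2] := form_graph pW bW.
by apply/lr_form_leE => f _; split; [exact: t1|rewrite /formq f1 f2].
Qed.

(** Conjugation of the scalar inequality 2 (f, psi) <= |f|^2 / e + e |psi|^2. *)
Lemma total_inv_lower A (e : R) : nonneg_selfadjoint A -> 0 < e -> form_total A ->
  (forall f, e * nsq f <= formq A f) ->
  form_total (rinv A) /\ forall f, formq (rinv A) f <= e^-1 * nsq f.
Proof.
move=> nA e0 tA lA.
suff h f : lr_form_dom (rinv A) f /\ formq (rinv A) f <= e^-1 * nsq f.
  by split=> f; case: (h f).
apply: form_conj; first exact: nsa_rinv.
rewrite rinvK => psi _; have := lA psi; have := nsq_ge0 (f - e%:C *: psi).
rewrite nsqB nsqZ rdotZr => h1 h2.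
have i0 : 0 <= e^-1 by rewrite invr_ge0 ltW.
have e1 : e^-1 * (nsq f - 2 * (e * rdot f psi) + e ^+ 2 * nsq psi) =
    e^-1 * nsq f - 2 * rdot f psi + e * nsq psi by field; rewrite gt_eqF.
by have := mulr_ge0 i0 h1; rewrite e1; move: (e^-1 * nsq f) (e * nsq psi) h2 => p q; lra.
Qed.

Lemma add_scalar_op (Z : {linear H -> H}) (c e : R) : psd Z -> 0 <= c -> 0 <= e ->
  (forall f, rdot (Z f) f <= c * nsq f) ->
  exists W : {linear H -> H}, [/\ psd W, bndop W &
    forall f, rdot (W f) f = rdot (Z f) f + e * nsq f].
Proof.
move=> pZ c0 e0 hc.
have [W hW] : exists W : {linear H -> H}, forall f, W f = Z f + e%:C *: f.
  apply: linear_exists => a f g; rewrite linearP /= !scalerDr addrACA; congr (_ + _ + _).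
  by rewrite !scalerA mulrC.
have wE f : rdot (W f) f = rdot (Z f) f + e * nsq f by rewrite hW !rdE.
have pW : psd W.
  split=> [f g|f]; first by rewrite !hW !rdE pZ.1.
  by rewrite wE addr_ge0 ?mulr_ge0 ?nsq_ge0 //; exact: pZ.2.
exists W; split=> //; apply: (psd_bndop pW (addr_ge0 c0 e0)) => f.
by rewrite wE mulrDl lerD2r.
Qed.

(* Riccati's equation only gives the bound for invertible A^-1 and B^-1; in
   general apply it to A^-1 + 1/k and B^-1 + 1/k. *)
Lemma agm_limit_gbound (A_ B_ : nat -> lrel H) Binf (G : {linear H -> H}) (c : R) :
  agm_seq A_ B_ -> form_total (rinv (A_ 0%N)) -> form_total (rinv (B_ 0%N)) -> 0 <= c ->
  (forall f, formq (rinv (A_ 0%N)) f <= c * nsq f) ->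
  (forall f, formq (rinv (B_ 0%N)) f <= c * nsq f) ->
  nonneg_selfadjoint Binf -> (forall n, lr_form_le (B_ n.+1) Binf) ->
  (forall E, nonneg_selfadjoint E -> (forall n, lr_form_le (B_ n.+1) E) -> lr_form_le Binf E) ->
  psd G -> (forall phi psi, form (rinv Binf) phi psi = rdot (G phi) psi) ->
  gbound (rinv (A_ 0%N)) (rinv (B_ 0%N)) G.
Proof.
move=> agm tX tY c0 hcX hcY nB leB supB pG fG.
have nA0 := (agm_nsa agm 0%N).1; have nB0 := (agm_nsa agm 0%N).2.
have [x [px xE fx]] := total_op (nsa_rinv nA0) tX.
have [y [py yE fy]] := total_op (nsa_rinv nB0) tY.
have {}hcX f : rdot (x f) f <= c * nsq f by rewrite -fx; exact: hcX.
have {}hcY f : rdot (y f) f <= c * nsq f by rewrite -fy; exact: hcY.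
pose ep k : R := k.+1%:R^-1.
have ep0 k : 0 < ep k by rewrite invr_gt0 ltr0n.
have ep1 k : ep k <= 1 by rewrite invf_le1 ?ltr0n // ler1n.
have epS k : ep k.+1 <= ep k by rewrite lef_pV2 ?posrE ?ltr0n // ler_nat.
have /choice[xk hxk] k := add_scalar_op px c0 (ltW (ep0 k)) hcX.
have /choice[yk hyk] k := add_scalar_op py c0 (ltW (ep0 k)) hcY.
have pxk k : psd (xk k) by case: (hxk k).
have pyk k : psd (yk k) by case: (hyk k).
have bxk k : bndop (xk k) by case: (hxk k).
have byk k : bndop (yk k) by case: (hyk k).
have xkE k f : rdot (xk k f) f = rdot (x f) f + ep k * nsq f by case: (hxk k).
have ykE k f : rdot (yk k f) f = rdot (y f) f + ep k * nsq f by case: (hyk k).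
have nxk k : nonneg_selfadjoint (graph (xk k)) by exact: graph_nsa.
have nyk k : nonneg_selfadjoint (graph (yk k)) by exact: graph_nsa.
pose A' k n := (agm_pair (rinv (graph (xk k))) (rinv (graph (yk k))) n).1.
pose B' k n := (agm_pair (rinv (graph (xk k))) (rinv (graph (yk k))) n).2.
have agm' k : agm_seq (A' k) (B' k).
  by apply: agm_pairP; exact: nsa_rinv.
have tXk k : form_total (rinv (A' k 0%N)).
  by rewrite /A' /= rinvK; exact: (form_graph (pxk k) (bxk k)).1.
have tYk k : form_total (rinv (B' k 0%N)).
  by rewrite /B' /= rinvK; exact: (form_graph (pyk k) (byk k)).1.
have fXk k phi psi : form (rinv (A' k 0%N)) phi psi = rdot (xk k phi) psi.
  by rewrite /A' /= rinvK; exact: (form_graph (pxk k) (bxk k)).2.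
have fYk k phi psi : form (rinv (B' k 0%N)) phi psi = rdot (yk k phi) psi.
  by rewrite /B' /= rinvK; exact: (form_graph (pyk k) (byk k)).2.
have c1 : 0 <= c + 1 by lra.
have bnd k phi : formq (rinv (B' k 1%N)) phi <= (c + 1) * nsq phi.
  rewrite /formq (form_agm_inv (agm' k) (tXk k) (tYk k)) fXk fYk xkE ykE.
  have := hcX phi; have := hcY phi; have := ler_wpM2r (nsq_ge0 phi) (ep1 k); lra.
have /choice[w hw] k : exists w : {linear H -> H}, [/\ psd w,
    gbound (rinv (A' k 0%N)) (rinv (B' k 0%N)) w,
    (forall phi, (fun n => formq (rinv (B' k n.+1)) phi) @ \oo --> rdot (w phi) phi) &
    forall n phi, rdot (w phi) phi <= formq (rinv (B' k n.+1)) phi].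
  have lx f : ep k * nsq f <= formq (graph (xk k)) f.
    by rewrite /formq (form_graph (pxk k) (bxk k)).2 xkE lerDr; exact: px.2.
  have ly f : ep k * nsq f <= formq (graph (yk k)) f.
    by rewrite /formq (form_graph (pyk k) (byk k)).2 ykE lerDr; exact: py.2.
  have [tA lA] := total_inv_lower (nxk k) (ep0 k) (form_graph (pxk k) (bxk k)).1 lx.
  have [tB _] := total_inv_lower (nyk k) (ep0 k) (form_graph (pyk k) (byk k)).1 ly.
  have i0 : 0 <= (ep k)^-1 by rewrite invr_ge0 ltW.
  exact: (agm_invertible (agm' k) (tXk k) (tYk k) tA tB i0 lA c1 (bnd k)).
have pw k : psd (w k) by case: (hw k).
have lw k phi : (fun n => formq (rinv (B' k n.+1)) phi) @ \oo --> rdot (w k phi) phi.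
  by case: (hw k).
have nB'n k n := (agm_nsa (agm' k) n).2.
have tB' k n : form_total (rinv (B' k n)) by exact: (agm_total (agm' k) (tXk k) (tYk k) n).2.
(* Both means are monotone in each argument, so the regularised limits decrease with k and converge
   strongly. *)
have dw k phi : rdot (w k.+1 phi) phi <= rdot (w k phi) phi.
  apply: (cvR_le (lw k.+1 phi) (lw k phi)) => n.
  have hA : lr_form_le (A' k 0%N) (A' k.+1 0%N).
    apply: lr_form_le_inv => //; apply: lr_form_le_graph => // f.
    by rewrite !xkE lerD2l ler_wpM2r ?nsq_ge0.
  have hB : lr_form_le (B' k 0%N) (B' k.+1 0%N).
    apply: lr_form_le_inv => //; apply: lr_form_le_graph => // f.
    by rewrite !ykE lerD2l ler_wpM2r ?nsq_ge0.
  have [_ h] := agm_mono (agm' k) (agm' k.+1) hA hB n.+1.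
  have := lr_form_le_inv (nB'n _ _) (nB'n _ _) h.
  by move=> /lr_form_leE/(_ phi (tB' _ _ _))[].
have w0 phi : rdot (w 0%N phi) phi <= (c + 1) * nsq phi.
  by have [_ _ _ /(_ 0%N phi)] := hw 0%N; move/le_trans; apply; exact: bnd.
have [W [pW cW lW]] := decreasing_psd_cvg pw c1 w0 dw.
have bW : bndop W.
  by apply: (psd_bndop pW c1) => f; exact: le_trans (lW 0%N f) (w0 f).
have gW : gbound (rinv (A_ 0%N)) (rinv (B_ 0%N)) W.
  move=> phi psi.
  have h1 : (fun k => 2 * rdot (w k phi) psi) @ \oo --> 2 * rdot (W phi) psi.
    by apply: cvgM; [exact: cvg_cst|exact: cv_rdot (cW phi) (cv_cst psi)].
  have h2 : (fun k => formq (rinv (A_ 0%N)) phi + formq (rinv (B_ 0%N)) psi +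
      ep k * (nsq phi + nsq psi)) @ \oo -->
      formq (rinv (A_ 0%N)) phi + formq (rinv (B_ 0%N)) psi + 0 * (nsq phi + nsq psi).
    apply: cvgD; first exact: cvg_cst.
    by apply: cvgM; [exact: cvg_harmonic|exact: cvg_cst].
  rewrite mul0r addr0 in h2; apply: (cvR_le h1 h2) => k.
  have [_ h _ _] := hw k; have := h phi psi.
  by rewrite /formq fXk fYk xkE ykE fx fy; lra.
have nI := nsa_rinv nB.
have tI : form_total (rinv Binf).
  move=> phi; have := lr_form_le_inv (agm_nsa agm 1%N).2 nB (leB 0%N).
  by move=> /lr_form_leE/(_ phi ((agm_total agm tX tY 1%N).2 phi))[].
(* X <= X + 1/k and Y <= Y + 1/k, so G lies below every regularised limit. *)
have GW phi : rdot (G phi) phi <= rdot (W phi) phi.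
  apply: (cvR_le (cvg_cst _) (cv_rdot (cW phi) (cv_cst phi))) => k.
  apply: (cvR_le (cvg_cst _) (lw k phi)) => n.
  have hA : lr_form_le (A' k 0%N) (A_ 0%N).
    rewrite -(rinvK (A_ 0%N)); apply: lr_form_le_inv => //; first exact: nsa_rinv.
    apply/lr_form_leE => f _; split; first exact: tX.
    by rewrite /formq fx (form_graph (pxk k) (bxk k)).2 xkE lerDl mulr_ge0 ?nsq_ge0 ?(ltW (ep0 k)).
  have hB : lr_form_le (B' k 0%N) (B_ 0%N).
    rewrite -(rinvK (B_ 0%N)); apply: lr_form_le_inv => //; first exact: nsa_rinv.
    apply/lr_form_leE => f _; split; first exact: tY.
    by rewrite /formq fy (form_graph (pyk k) (byk k)).2 ykE lerDl mulr_ge0 ?nsq_ge0 ?(ltW (ep0 k)).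
  have [_ h] := agm_mono (agm' k) agm hA hB n.+1.
  have := lr_form_le_inv (nB'n _ _) nB (lr_form_le_trans h (leB n)).
  by move=> /lr_form_leE/(_ phi (tB' _ _ _))[_]; rewrite {1}/formq fG.
(* W satisfies the bound for X and Y themselves, hence lies below all B_n^-1; the least upper bound
   property of B_oo puts it below G. With [GW] this identifies the limit without any continuity of
   the mean. *)
have WG phi : rdot (W phi) phi <= rdot (G phi) phi.
  have [tW fW] := form_graph pW bW; have nW := graph_nsa pW bW.
  have := supB (rinv (graph W)) (nsa_rinv nW) _.
  move=> h; have {}h : lr_form_le Binf (rinv (graph W)).
    apply: h => n; rewrite -(rinvK (B_ n.+1)); have nBn := (agm_nsa agm n.+1).2.
    apply: lr_form_le_inv => //; first exact: nsa_rinv.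
    apply/lr_form_leE => f _; split; first exact: tW.
    by rewrite {1}/formq fW; exact: gbound_le_agm agm tX tY _ n f pW.1 gW.
  have := lr_form_le_inv nB (nsa_rinv nW) h; rewrite rinvK.
  by move=> /lr_form_leE/(_ phi (tI phi))[_]; rewrite /formq fW fG.
have GE : forall f, G f = W f.
  apply: symm_quad_eq; [exact: pG.1|exact: pW.1|].
  by move=> f; apply/eqP; rewrite eq_le GW WG.
by move=> phi psi; rewrite GE; exact: gW.
Qed.

Lemma agm_bounded (A_ B_ : nat -> lrel H) Ainf Binf : agm_seq A_ B_ ->
  nonneg_selfadjoint Ainf -> nonneg_selfadjoint Binf ->
  (forall psi, lr_form_dom (rinv Binf) psi -> formq (rinv Ainf) psi = formq (rinv Binf) psi) ->
  lr_form_le Binf Ainf -> (forall n, lr_form_le (B_ n.+1) Binf) ->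
  (forall E, nonneg_selfadjoint E -> (forall n, lr_form_le (B_ n.+1) E) -> lr_form_le Binf E) ->
  bounded_nonneg_selfadjoint (rinv (A_ 0%N)) -> bounded_nonneg_selfadjoint (rinv (B_ 0%N)) ->
  Ainf = Binf /\ Binf = rinv (lr_geometric_mean (rinv (A_ 0%N)) (rinv (B_ 0%N))).
Proof.
move=> agm nAi nBi eqI leBA leB supB /boundedP[nX tX [cx cx0 hcx]] /boundedP[nY tY [cy cy0 hcy]].
have le1 := lr_form_le_inv (agm_nsa agm 1%N).2 nBi (leB 0%N).
have tG : form_total (rinv Binf).
  by move=> phi; move: le1 => /lr_form_leE/(_ phi ((agm_total agm tX tY 1%N).2 phi))[].
have tG' : form_total (rinv Ainf).
  by move=> phi; have := lr_form_le_inv nBi nAi leBA => /lr_form_leE/(_ phi (tG phi))[].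
have nG := nsa_rinv nBi; have nG' := nsa_rinv nAi.
split.
  (* Both inverse forms are defined on the whole space, so agreement on D[B_oo^-1] already makes the
     relations equal. *)
  rewrite -(rinvK Ainf) -(rinvK Binf); congr rinv; apply: form_eq_nsa => // phi _.
  exact/eqI/tG.
rewrite -{1}(rinvK Binf); congr rinv.
pose c := cx + cy; have c0 : 0 <= c by rewrite addr_ge0.
have hcx' f : formq (rinv (A_ 0%N)) f <= c * nsq f.
  by apply: le_trans (hcx f) _; rewrite ler_wpM2r ?nsq_ge0 // lerDl.
have hcy' f : formq (rinv (B_ 0%N)) f <= c * nsq f.
  by apply: le_trans (hcy f) _; rewrite ler_wpM2r ?nsq_ge0 // lerDr.
have [G [pG GE fG]] := total_op nG tG.
have gG := agm_limit_gbound agm tX tY c0 hcx' hcy' nBi leB supB pG fG.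
have bG f : rdot (G f) f <= c * nsq f.
  rewrite -fG; have := le1 => /lr_form_leE/(_ f ((agm_total agm tX tY 1%N).2 f))[_].
  move=> /le_trans; apply; rewrite /formq (form_agm_inv agm tX tY).
  by have := hcx' f; have := hcy' f; rewrite /formq; lra.
have CG : is_lr_geometric_mean (rinv (A_ 0%N)) (rinv (B_ 0%N)) (rinv Binf).
  split.
    split; first by rewrite GE; exact: graph_bounded pG c0 bG.
    by rewrite GE; apply/geometric_boundP.
  move=> W0 [/boundedP[nW tW _] gW0]; have [W [pW WE fW]] := total_op nW tW.
  rewrite WE in gW0; have gW := (geometric_boundP W nX tX nY tY).1 gW0.
  have h : lr_form_le Binf (rinv W0).
    apply: supB; first exact: nsa_rinv.
    move=> n; rewrite -(rinvK (B_ n.+1)); have nBn := (agm_nsa agm n.+1).2.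
    apply: lr_form_le_inv => //; first exact: nsa_rinv.
    apply/lr_form_leE => f _; split; first exact: tW.
    by rewrite {1}/formq fW; exact: gbound_le_agm agm tX tY _ n f pW.1 gW.
  by have := lr_form_le_inv nBi (nsa_rinv nW) h; rewrite rinvK.
(* Two maxima of the admissible set lie below each other, hence coincide. *)
apply/esym; apply: xget_unique => // Z CZ.
have nZ : nonneg_selfadjoint Z by case: CZ.1 => -[].
apply: lr_form_le_anti => //; first exact: CG.2 CZ.1.
exact: CZ.2 CG.1.
Qed.

End Perturbation.

Theorem theorem6p1 (R : realType) (H : hilbertType R) (A B : lrel H)
    (hA : nonneg_selfadjoint A) (hB : nonneg_selfadjoint B)
    (A_ B_ : nat -> lrel H)
    (hA0 : A_ 0%N = A) (hB0 : B_ 0%N = B)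
    (hAS : forall n, A_ n.+1 = lr_arithmetic_mean (A_ n) (B_ n))
    (hBS : forall n, B_ n.+1 = lr_harmonic_mean (A_ n) (B_ n)) :
  [/\ forall m n, (0 < m <= n)%N -> lr_form_le (A_ n) (A_ m),
      forall m n, (0 < m <= n)%N -> lr_form_le (B_ m) (B_ n),
      forall n, (0 < n)%N -> lr_form_le (B_ n) (A_ n) &
      exists Ainf Binf : lrel H,
        [/\ nonneg_selfadjoint Ainf /\ strong_resolvent_cvg A_ Ainf,
            nonneg_selfadjoint Binf /\ strong_resolvent_cvg B_ Binf &
        [/\ [/\ lr_form_le (lr_harmonic_mean A B) Binf,
                lr_form_le Binf Ainf &
                lr_form_le Ainf (lr_arithmetic_mean A B)],
            lr_form_dom Ainf `<=` lr_form_dom Binf /\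
              lr_form_dom A `&` lr_form_dom B `<=` lr_form_dom Ainf,
            rran (rsqrt Binf) `<=` rran (rsqrt Ainf) /\
              rran (rsqrt A) `&` rran (rsqrt B) `<=` rran (rsqrt Binf),
            (forall phi, lr_form_dom Ainf phi -> lr_form Ainf phi = lr_form Binf phi) /\
            (forall psi, rran (rsqrt Binf) psi ->
               lr_form (rinv Ainf) psi = lr_form (rinv Binf) psi) &
            bounded_nonneg_selfadjoint (rinv A) ->
            bounded_nonneg_selfadjoint (rinv B) ->
            Ainf = Binf /\
            Binf = rinv (lr_geometric_mean (rinv A) (rinv B))]]].
Proof.
have agm : agm_seq A_ B_ by split; rewrite ?hA0 ?hB0.
have agm' := agm_seq_inv agm.
split.
- exact: lr_form_le_decr (agm_decr agm).
- by apply: lr_form_le_incr => n; exact: agm_incr n agm.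
- by case=> // n _; exact: agm_le.
have [Ai [Bi [[nA cA] [nB cB] [leA leB] leBA supB]]] := agm_limits agm.
have nIA := nsa_rinv nA; have nIB := nsa_rinv nB.
have leI := lr_form_le_inv nB nA leBA.
have eqF := agm_limit_form agm nA nB cA leA leB leBA.
(* In the inverted iteration B_n^-1 plays the role of A_n, so the limit of its arithmetic means is
   the inverse of [Bi], and the forms agree on D[Bi^-1] = ran Bi^{1/2}. *)
have eqI : forall psi, lr_form_dom (rinv Bi) psi -> formq (rinv Bi) psi = formq (rinv Ai) psi.
  apply: (agm_limit_form agm' nIB nIA) => //.
  - exact: strong_resolvent_cvg_inv (fun n => (agm_nsa agm n).2) nB cB.
  - by move=> n; exact: lr_form_le_inv (agm_nsa agm n.+1).2 nB (leB n).
  - by move=> n; exact: lr_form_le_inv nA (agm_nsa agm n.+1).1 (leA n).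
have eA1 : A_ 1%N = lr_arithmetic_mean A B by rewrite hAS hA0 hB0.
have eB1 : B_ 1%N = lr_harmonic_mean A B by rewrite hBS hA0 hB0.
exists Ai, Bi; split=> //; split.
- by split=> //; rewrite -?eA1 -?eB1; [exact: leB|exact: leA].
- split; first by case: leBA.
  move=> phi hphi; apply: (leA 0%N).1; rewrite eA1.
  by have [_ dM _] := lr_arithmetic_meanP hA hB; apply/dM.
- split=> psi.
    by move=> /(rran_rsqrt _ nB) d; apply/(rran_rsqrt _ nA); exact: leI.1.
  move=> [/(rran_rsqrt _ hA) dA /(rran_rsqrt _ hB) dB]; apply/(rran_rsqrt _ nB).
  apply: (lr_form_le_inv (agm_nsa agm 1%N).2 nB (leB 0%N)).1.
  rewrite eB1 rinv_harmonic.
  by have [_ dM _] := lr_arithmetic_meanP (nsa_rinv hA) (nsa_rinv hB); apply/dM.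
- split=> phi; first by move=> /eqF; rewrite !lr_formE => ->.
  by move=> /(rran_rsqrt _ nB) /eqI; rewrite !lr_formE => ->.
rewrite -hA0 -hB0 => bA bB.
by apply: agm_bounded => // psi /eqI.
Qed.
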